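(* Let $(M,g_{ab},u,Y_{ab},\xi^a[Y],\lambda)$ be an Einstein CKY--RS structure with $M$ connected of dimension $n\ge3$. Let $\phi=e^{-u}$ with $d\phi\not\equiv0$, and suppose that $K=0$, where $K$ is the function determined by $\nabla_a\nabla_b\phi=-K\phi\,g_{ab}$. Then $d\phi$ is a non-zero parallel one-form. If $d\phi$ is non-null, then locally there exists an affine coordinate $\tau$ such that $g_{ab}$ splits as a product $$g=\epsilon\,d\tau^2+h_{AB}(x)\,dx^Adx^B,\qquad \epsilon=|\nabla\tau|^2=\pm1,$$ and $c=-\epsilon(n-1)c_2^2$, where $c_2>0$ is the constant with $|\nabla\phi|^2=\epsilon c_2^2$ (so $d\phi=c_2\,d\tau$). In particular, $h_{AB}$ is Ricci-flat. If $d\phi$ is null, then $g_{ab}$ is a Lorentzian metric which belongs locally to the Brinkmann class.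
   Context: Conformal Killing--Yano (CKY) 2-form on an $n$-dimensional pseudo-Riemannian manifold: a smooth 2-form $Y_{ab}$ with $\nabla_cY_{ab}=g_{ca}\xi_b-g_{cb}\xi_a+z_{abc}$, where $z_{abc}$ is totally antisymmetric and $\xi_a=\frac{1}{n-1}\nabla^bY_{ba}$; $\xi^a=\xi^a[Y]$ is its associated vector field. CKY--RS structure $(M,g_{ab},u,Y_{ab},\xi^a[Y],\lambda)$: $u\in C^\infty(M)$, $\lambda\in\mathbb{R}$, $Y$ is a CKY 2-form of $g$, and $\tilde g_{ab}=e^{2u}g_{ab}$ satisfies $\tilde R_{ab}+\frac12\mathcal{L}_{\xi}\tilde g_{ab}=\lambda\tilde g_{ab}$ with $\xi=\xi[Y]$, $\tilde R_{ab}$ being the Ricci tensor of $\tilde g$. It is an Einstein CKY--RS structure if the background $g$ is Einstein, $R_{ab}=\Lambda g_{ab}$ with $\Lambda$ constant. On an Einstein background $\xi$ is a Killing field of $g$, $c=\lambda-\xi(u)$ is constant with $\tilde R_{ab}=c\,\tilde g_{ab}$, and $\nabla_a\nabla_b\phi=-K\phi\,g_{ab}$ with $K=\frac{\Lambda-\mathcal{G}}{n-2}$, $\mathcal{G}=\Delta u+(n-2)|\nabla u|^2+ce^{2u}$. ''Affine coordinate'' means $\nabla_a\nabla_b\tau=0$. The Brinkmann class is the class of Lorentzian metrics admitting a non-zero parallel null vector field.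
   Formalization: In the null case, that g is Lorentzian and locally Brinkmann is proved assuming g is definite or Lorentzian (it fails in flat signature (2,2) with φ a null coordinate); for every signature a non-zero parallel null vector field is shown to exist locally. *)

(* Defs.v *)
(* MathComp-Analysis.

   Tensor calculus is done in components.  The first section works on R^n =
   'rV[R]_n: fields are total functions on 'rV[R]_n that are only meaningful on
   an open set U (the image of a chart).  The second section builds smooth
   manifolds from atlases, and represents a tensor field by its components in
   every chart together with the tensor transformation law. *)
From HB Require Import structures.
From mathcomp Require Import all_boot all_order all_algebra.
From mathcomp Require Import all_classical all_reals all_analysis.
Set Implicit Arguments.
Unset Strict Implicit.
Unset Printing Implicit Defensive.
Import Order.TTheory GRing.Theory Num.Theory.
Import numFieldNormedType.Exports.
Local Open Scope classical_set_scope.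
Local Open Scope ring_scope.

Section LocalCalculus.
Variables (R : realType) (n : nat).
Implicit Types (U : set 'rV[R]_n) (f : 'rV[R]_n -> R) (v : 'rV[R]_n).
Implicit Types (g T : 'rV[R]_n -> 'M[R]_n) (X : 'rV[R]_n -> 'rV[R]_n).

Definition pd (i : 'I_n) f : 'rV[R]_n -> R :=
  fun v => 'D_(delta_mx 0 i) f v.

Definition iter_pd (s : seq 'I_n) f : 'rV[R]_n -> R := foldr pd f s.

(* C^infty on the open set U: all iterated partial derivatives exist and are
   continuous on U. *)
Definition smooth_on U f : Prop :=
  forall (s : seq 'I_n) v, U v ->
    {for v, continuous (iter_pd s f)} /\
    (forall i, derivable (iter_pd s f) v (delta_mx 0 i)).

Definition entry (m k : nat) (T : 'rV[R]_n -> 'M[R]_(m, k))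
  (i : 'I_m) (j : 'I_k) : 'rV[R]_n -> R := fun v => T v i j.

Definition smooth_mx_on (m k : nat) U (T : 'rV[R]_n -> 'M[R]_(m, k)) : Prop :=
  forall i j, smooth_on U (entry T i j).

(* pseudo-Riemannian metric, of any signature *)
Definition metric_on U g : Prop :=
  smooth_mx_on U g /\
  (forall v, U v -> (g v)^T = g v /\ g v \in unitmx).

(* [ginv g i j v] is g^{ij}. *)
Definition ginv g (i j : 'I_n) v : R := invmx (g v) i j.

(* Levi-Civita connection: [christoffel g i j k] is Gamma^i_{jk}. *)
Definition christoffel g (i j k : 'I_n) v : R :=
  2^-1 * \sum_(l < n) ginv g i l v *
    (pd j (entry g l k) v + pd k (entry g l j) v - pd l (entry g j k) v).

(* R_{jk} = d_i Gamma^i_{jk} - d_j Gamma^i_{ik}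
            + Gamma^i_{il} Gamma^l_{jk} - Gamma^i_{jl} Gamma^l_{ik},
   the sign for which round spheres have positive Ricci curvature. *)
Definition ricci g v : 'M[R]_n := \matrix_(j, k) (
  \sum_(i < n) (pd i (christoffel g i j k) v - pd j (christoffel g i i k) v)
  + \sum_(i < n) \sum_(l < n)
      (christoffel g i i l v * christoffel g l j k v
       - christoffel g i j l v * christoffel g l i k v)).

(* nabla_a nabla_b f *)
Definition hess g f v : 'M[R]_n := \matrix_(a, b)
  (pd a (pd b f) v - \sum_(k < n) christoffel g k a b v * pd k f v).

(* |nabla f|^2 *)
Definition norm2_grad g f v : R :=
  \sum_(i < n) \sum_(j < n) ginv g i j v * pd i f v * pd j f v.

Definition laplacian g f v : R :=
  \sum_(i < n) \sum_(j < n) ginv g i j v * hess g f v i j.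

(* nabla_c T_{ab} *)
Definition nabla2 g T (c a b : 'I_n) v : R :=
  pd c (entry T a b) v
  - \sum_(d < n) christoffel g d c a v * T v d b
  - \sum_(d < n) christoffel g d c b v * T v a d.

(* nabla_i X^j *)
Definition nabla_vec g X (i j : 'I_n) v : R :=
  pd i (entry X 0 j) v + \sum_(k < n) christoffel g j i k v * X v 0 k.

(* X(f) *)
Definition vec_app X f v : R := \sum_(i < n) X v 0 i * pd i f v.

(* (L_X T)_{ab} *)
Definition lie2 X T v : 'M[R]_n := \matrix_(a, b)
  \sum_(c < n) (X v 0 c * pd c (entry T a b) v
                + T v c b * pd a (entry X 0 c) v
                + T v a c * pd b (entry X 0 c) v).

(* xi_a = (n-1)^-1 nabla^b Y_{ba} *)
Definition cky_form g Y (a : 'I_n) v : R :=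
  (n%:R - 1)^-1 *
  \sum_(b < n) \sum_(c < n) ginv g b c v * nabla2 g Y c b a v.

(* xi^a = g^{ab} xi_b *)
Definition cky_vec g Y v : 'rV[R]_n :=
  \row_a \sum_(b < n) ginv g a b v * cky_form g Y b v.

Definition totally_antisym (z : 'I_n -> 'I_n -> 'I_n -> R) : Prop :=
  forall a b c, z a b c = - z b a c /\ z a b c = - z a c b.

(* The remainder z is determined by the equation, so that its smoothness and
   tensoriality need not be required. *)
Definition cky_eq_on U g Y : Prop :=
  forall v, U v -> exists z : 'I_n -> 'I_n -> 'I_n -> R,
    totally_antisym z /\
    forall a b c, nabla2 g Y c a b v =
      g v c a * cky_form g Y b v - g v c b * cky_form g Y a v + z a b c.

Definition conf g (u : 'rV[R]_n -> R) v : 'M[R]_n := expR (2 * u v) *: g v.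

(* For a 2-form Y, the equation Ric~ + (1/2) L_xi g~ = lam g~
   with g~ = e^{2u} g and xi = xi[Y] (computed with g). *)
Definition rs_eq_on U g u Y (lam : R) : Prop :=
  forall v, U v ->
    ricci (conf g u) v + 2^-1 *: lie2 (cky_vec g Y) (conf g u) v
    = lam *: conf g u v.

(* c = lam - xi(u) *)
Definition rs_c g u Y (lam : R) v : R := lam - vec_app (cky_vec g Y) u v.

(* G = Delta u + (n-2) |nabla u|^2 + c e^{2u} *)
Definition rs_G g u Y (lam : R) v : R :=
  laplacian g u v + (n%:R - 2) * norm2_grad g u v
  + rs_c g u Y lam v * expR (2 * u v).

(* K = (Lam - G) / (n-2); on an Einstein background, where Ric = Lam g, this is
   the only function with nabla_a nabla_b phi = - K phi g_{ab}, phi = e^{-u}.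
   The latter equation is a consequence of the structure equations and is not
   assumed anywhere. *)
Definition rs_K g u Y (lam Lam : R) v : R :=
  (Lam - rs_G g u Y lam v) / (n%:R - 2).

(* q is the number of negative directions of the symmetric matrix A *)
Definition has_index (q : nat) (A : 'M[R]_n) : Prop :=
  exists P : 'M[R]_n, P \in unitmx /\
    P *m A *m P^T = diag_mx (\row_(i < n) (if (i < q)%N then -1 else 1)).

Definition index_on U g (q : nat) : Prop := forall v, U v -> has_index q (g v).

(* Both sign conventions, (-+...+) and (+-...-), are accepted. *)
Definition lorentzian_on U g : Prop := index_on U g 1 \/ index_on U g n.-1.

(* X is a nowhere zero parallel null vector field *)
Definition parallel_null_on U g X : Prop :=
  smooth_mx_on U X /\
  forall v, U v ->
    [/\ X v != 0,
        \sum_(i < n) \sum_(j < n) g v i j * X v 0 i * X v 0 j = 0 &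
        forall i j, nabla_vec g X i j v = 0].

Definition brinkmann_on U g : Prop :=
  lorentzian_on U g /\ exists X, parallel_null_on U g X.

(* The coordinate tau = v_{i0} splits off: U is the product of an interval (in
   the direction i0) and an open set V of R^{n-1}, and
   g = eps dtau^2 + h_{AB}(x) dx^A dx^B, where x^A are the coordinates other
   than tau and h is a metric on V. *)
Definition product_on U g (i0 : 'I_n) (eps : R)
    (V : set 'rV[R]_n.-1) (h : 'rV[R]_n.-1 -> 'M[R]_n.-1) : Prop :=
  [/\ open V,
      exists a b : R,
        U = [set v : 'rV[R]_n | a < v 0 i0 < b /\ V (col' i0 v)] &
      forall v, U v ->
        [/\ g v i0 i0 = eps,
            (forall A, g v i0 (lift i0 A) = 0 /\ g v (lift i0 A) i0 = 0) &
            forall A B, g v (lift i0 A) (lift i0 B) = h (col' i0 v) A B]].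

End LocalCalculus.

Section Manifold.
Variables (R : realType) (n : nat).

Record chart (M : topologicalType) := Chart {
  cdom : set M;
  cimg : set 'rV[R]_n;
  cfun : M -> 'rV[R]_n;
  cinv : 'rV[R]_n -> M;
  open_cdom : open cdom;
  open_cimg : open cimg;
  cfun_cimg : forall p, cdom p -> cimg (cfun p);
  cinv_cdom : forall v, cimg v -> cdom (cinv v);
  cfunK : forall p, cdom p -> cinv (cfun p) = p;
  cinvK : forall v, cimg v -> cfun (cinv v) = v;
  cfun_continuous : forall p, cdom p -> {for p, continuous cfun};
  cinv_continuous : forall v, cimg v -> {for v, continuous cinv} }.

Section Transition.
Variable M : topologicalType.
Implicit Types x y : chart M.

Definition transition x y : 'rV[R]_n -> 'rV[R]_n := cfun y \o cinv x.

Definition overlap x y : set 'rV[R]_n := cimg x `&` (cinv x @^-1` cdom y).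

Definition compatible x y : Prop :=
  smooth_mx_on (overlap x y) (transition x y) /\
  smooth_mx_on (overlap y x) (transition y x).

(* [jac x y v i j] is d y^j / d x^i. *)
Definition jac x y v : 'M[R]_n :=
  \matrix_(i, j) pd i (entry (transition x y) 0 j) v.

End Transition.

Record manifold := Manifold {
  mcarrier :> topologicalType;
  atlas : set (chart mcarrier);
  manifold_hausdorff : hausdorff_space mcarrier;
  manifold_second_countable : @second_countable mcarrier;
  atlas_cover : forall p : mcarrier, exists2 x, atlas x & cdom x p;
  atlas_compatible : forall x y, atlas x -> atlas y -> compatible x y }.

Variable M : manifold.
Implicit Types (f u : M -> R) (x y : chart M).

(* the charts of the maximal atlas *)
Definition smooth_chart x : Prop := forall y, atlas y -> compatible x y.

(* f in the chart x *)
Definition loc f x : 'rV[R]_n -> R := f \o cinv x.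

Definition smooth_fun f : Prop :=
  forall x, smooth_chart x -> smooth_on (cimg x) (loc f x).

(* components of a covariant 2-tensor field in each chart *)
Definition comp2 := chart M -> 'rV[R]_n -> 'M[R]_n.

(* T_{ij} = (d y^k / d x^i) (d y^l / d x^j) T'_{kl} *)
Definition tensor2 (T : comp2) : Prop :=
  (forall x, smooth_chart x -> smooth_mx_on (cimg x) (T x)) /\
  (forall x y, smooth_chart x -> smooth_chart y ->
    forall v, overlap x y v ->
      T x v = jac x y v *m T y (transition x y v) *m (jac x y v)^T).

Definition metric (g : comp2) : Prop :=
  tensor2 g /\ forall x, smooth_chart x -> metric_on (cimg x) (g x).

Definition two_form (Y : comp2) : Prop :=
  tensor2 Y /\
  forall x, smooth_chart x -> forall v, cimg x v -> (Y x v)^T = - Y x v.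

Definition cky (g Y : comp2) : Prop :=
  two_form Y /\ forall x, smooth_chart x -> cky_eq_on (cimg x) (g x) (Y x).

Definition einstein (g : comp2) (Lam : R) : Prop :=
  forall x, smooth_chart x -> forall v, cimg x v ->
    ricci (g x) v = Lam *: g x v.

Definition cky_rs (g : comp2) u (Y : comp2) (lam : R) : Prop :=
  [/\ metric g, smooth_fun u, cky g Y &
      forall x, smooth_chart x ->
        rs_eq_on (cimg x) (g x) (loc u x) (Y x) lam].

Definition einstein_cky_rs (g : comp2) u (Y : comp2) (lam Lam : R) : Prop :=
  cky_rs g u Y lam /\ einstein g Lam.

Definition metric_index (g : comp2) (q : nat) : Prop :=
  forall x, smooth_chart x -> index_on (cimg x) (g x) q.

Definition definite (g : comp2) : Prop := metric_index g 0 \/ metric_index g n.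

Definition lorentzian (g : comp2) : Prop :=
  metric_index g 1 \/ metric_index g n.-1.

End Manifold.

(* Main.v *)
Require Import Defs.
From HB Require Import structures.
From mathcomp Require Import all_boot all_order all_algebra.
From mathcomp Require Import all_classical all_reals all_analysis.
From mathcomp Require Import ring lra.
Set Implicit Arguments.
Unset Strict Implicit.
Unset Printing Implicit Defensive.
Import Order.TTheory GRing.Theory Num.Theory.
Import numFieldNormedType.Exports.
Local Open Scope classical_set_scope.
Local Open Scope ring_scope.

(* For phi = e^{-u}, the transformation of the Ricci tensor under a conformal
   change, together with the fact that the associated vector field of a CKY
   2-form on an Einstein background is Killing, turns the structure equation
   with K = 0 into nabla_a nabla_b u = u_a u_b, that is, nabla dphi = 0.
   A parallel one-form solves a linear first order system, hence it vanishes
   nowhere on a connected M as soon as it is non-zero at one point, and its norm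
   is constant; commuting derivatives gives R_{ab} nabla^b phi = 0, so Lam = 0.
   If dphi is non-null, the flow of the normalized gradient, started on a level
   set of phi, straightens both the gradient and phi; in the resulting chart the
   Christoffel symbols with an index tau vanish, so the metric does not depend on
   tau and the Ricci tensors of g and of the slice agree.  If dphi is null, the
   gradient is the parallel field of the Brinkmann class, and a definite metric
   has no non-zero null vector. *)

(** * Functions of class C^k on open subsets of R^n *)

(** Three points carry the weight. The associated field is Killing because the commutator of two
    covariant derivatives of Y, contracted with the metric, is skew in its two free indices: the
    Ricci part is [Lam * Y], skew since the background is Einstein, and the rest is skew by the pair
    symmetry of the curvature. Computed from the CKY equation, the symmetric part of the same
    expression is n - 2 times the symmetrized derivative of xi plus a trace term, and n >= 3 makes
    both vanish. Straightening needs a flow that is jointly smooth in time and initial point. Picard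
    iteration is therefore run on functions of all variables, and convergence of derivatives is
    proved by induction on their order. Top-order derivatives obey a linear recursion with the
    contraction constant of the iteration itself, so one cube serves all orders. To pass from a
    chart to M, a property is shown to be invariant under transitions and locally constant, hence
    constant on the connected M. In particular the norm of dphi is constant on M, so eps and c2 are
    the same for all splitting charts; these charts belong to the maximal atlas. *)

Section RowVectors.
Variable R : realType.

Lemma norm_mx_le (m n : nat) (v : 'M[R]_(m, n)) (e : R) :
  0 <= e -> (forall i j, `|v i j| <= e) -> `|v| <= e.
Proof.
move=> e0 ve; rewrite /Num.Def.normr/= mx_normrE bigmax_le// => i _; exact: ve.
Qed.

Lemma norm_mx_ge (m n : nat) (v : 'M[R]_(m, n)) i j : `|v i j| <= `|v|.
Proof.
by rewrite [leRHS]/Num.Def.normr/= mx_normrE (le_bigmax _ _ (i, j)).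
Qed.

Lemma norm_delta_le1 n (i : 'I_n) : `|delta_mx 0 i : 'rV[R]_n| <= 1.
Proof.
apply: norm_mx_le => // a j; rewrite !mxE.
by case: (_ && _); rewrite ?normr1 ?normr0.
Qed.

Lemma cvg_mxP (T : Type) (F : set_system T) (FF : Filter F) (m n : nat)
    (f : T -> 'M[R]_(m, n)) (l : 'M[R]_(m, n)) :
  f @ F --> l <-> forall i j, (fun t => f t i j) @ F --> l i j.
Proof.
split=> [fl i j|fl].
  by apply: (@cvg_comp _ _ _ f (fun M : 'M[R]_(m, n) => M i j) F _ _ fl);
     exact: coord_continuous.
apply/cvgrPdist_le => /= e e0.
have h (i : 'I_m) (j : 'I_n) : \forall t \near F, `|l i j - f t i j| <= e.
  by move/cvgrPdist_le: (fl i j) => /(_ e e0).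
have : \forall t \near F, forall i j, `|l i j - f t i j| <= e.
  by apply: filter_forall => i; apply: filter_forall => j; exact: h.
by apply: filterS => t ht; apply: norm_mx_le (ltW e0) _ => i j; rewrite !mxE.
Qed.

End RowVectors.

(** * Mean value theorem and derivatives along lines *)

Section MeanValue.
Variable R : realType.

(** Symmetric in the order of [a] and [t], so that increments of either sign are treated alike from
    here on. *)
Lemma MVT_dist (g dg : R -> R) (a t : R) :
  (forall s, `|s - a| <= `|t - a| -> is_derive s 1 g (dg s)) ->
  exists2 s, `|s - a| <= `|t - a| & g t - g a = dg s * (t - a).
Proof.
move=> dgs.
have [ta|ta] := leP a t.
- have h x : a <= x <= t -> `|x - a| <= `|t - a|.
    by move=> /andP[? ?]; rewrite !ger0_norm; lra.
  have [||s /[!in_itv]/= ast E] := @MVT_segment _ g dg a t ta.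
  + by move=> x /[!in_itv]/= /andP[ax xt]; apply/dgs/h; rewrite !ltW.
  + apply: derivable_within_continuous => x /[!in_itv]/= /h hx.
    by have := dgs _ hx.
  by exists s => //; exact: h.
- have h x : t <= x <= a -> `|x - a| <= `|t - a|.
    by move=> /andP[? ?]; rewrite !ler0_norm; lra.
  have [||s /[!in_itv]/= ast E] := @MVT_segment _ g dg t a (ltW ta).
  + by move=> x /[!in_itv]/= /andP[ax xt]; apply/dgs/h; rewrite !ltW.
  + apply: derivable_within_continuous => x /[!in_itv]/= /h hx.
    by have := dgs _ hx.
  by exists s; [exact: h|rewrite -opprB E -mulrN opprB].
Qed.

Lemma is_derive_line (V W : normedModType R) (f : V -> W) (w e : V) (t : R) :
  derivable f (t *: e + w) e ->
  is_derive t 1 (fun s => f (s *: e + w)) ('D_e f (t *: e + w)).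
Proof.
have E : (fun h : R => h^-1 *: (f ((h *: 1 + t) *: e + w) - f (t *: e + w)))
   = (fun h : R => h^-1 *: (f (h *: e + (t *: e + w)) - f (t *: e + w))).
  by apply/funext => h; rewrite addrA -scalerDl [_ *: 1]mulr1.
move=> df; apply: DeriveDef; first by rewrite /derivable E.
by rewrite /derive/= E.
Qed.

Lemma is_derive_line0 (V W : normedModType R) (f : V -> W) (w e : V) (d : W) :
  is_derive (0 : R) 1 (fun s => f (s *: e + w)) d -> is_derive w e f d.
Proof.
have E : (fun h : R => h^-1 *: (f ((h *: 1 + 0 : R) *: e + w) - f (0 *: e + w)))
   = (fun h : R => h^-1 *: (f (h *: e + w) - f w)).
  by apply/funext => h; rewrite scale0r add0r addr0 [_ *: 1]mulr1.
move=> [df dE]; apply: DeriveDef; first by move: df; rewrite /derivable E.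
by move: dE; rewrite /derive/= E.
Qed.

Lemma is_derive_comp1 (V : normedModType R) (f : V -> R) (h : R -> R) (w e : V)
    (df dh : R) :
  is_derive w e f df -> is_derive (f w) 1 h dh ->
  is_derive w e (h \o f) (dh * df).
Proof.
move=> [f1 f2] hh; apply: is_derive_line0.
have l : is_derive (0 : R) 1 (fun s => f (s *: e + w)) df.
  have := @is_derive_line _ _ f w e 0; rewrite scale0r add0r f2; exact.
have hh' : is_derive (f (0 *: e + w)) 1 h dh by rewrite scale0r add0r.
have := @is_derive1_comp _ h (fun s => f (s *: e + w)) 0 _ _ hh' l.
by rewrite mulrC.
Qed.

Lemma MVT_line (V : normedModType R) (f : V -> R) (w e : V) (t : R) :
  (forall s, `|s| <= `|t| -> derivable f (s *: e + w) e) ->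
  exists2 s, `|s| <= `|t| &
    f (t *: e + w) - f w = 'D_e f (s *: e + w) * t.
Proof.
move=> df.
have [s|s st E] := @MVT_dist (fun s => f (s *: e + w))
  (fun s => 'D_e f (s *: e + w)) 0 t.
  by rewrite !subr0 => st; apply: is_derive_line; exact: df.
rewrite !subr0 in st E; exists s => //.
by rewrite -E scale0r add0r.
Qed.

End MeanValue.

Section Ck.
Variables (R : realType) (n : nat).
Implicit Types (U : set 'rV[R]_n) (f g : 'rV[R]_n -> R).
Local Notation e_ i := (delta_mx 0 i : 'rV[R]_n).

(** Recursive in the order, whereas [smooth_on] quantifies over words of partial derivatives:
    closure under products, inverses and compositions then goes by induction on [k]. *)
Fixpoint ck (k : nat) U f : Prop :=
  (forall v, U v -> {for v, continuous f}) /\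
  match k with
  | 0 => True
  | k'.+1 => forall i, (forall v, U v -> derivable f v (e_ i)) /\
                       ck k' U (pd i f)
  end.

Lemma ck0I U f : (forall v, U v -> {for v, continuous f}) -> ck 0 U f.
Proof. by move=> h; split. Qed.

Lemma ckSI k U f : (forall v, U v -> {for v, continuous f}) ->
  (forall i v, U v -> derivable f v (e_ i)) ->
  (forall i, ck k U (pd i f)) -> ck k.+1 U f.
Proof. by move=> h d c; split=> // i; split=> //; exact: d. Qed.

Lemma ck_continuous k U f v : ck k U f -> U v -> {for v, continuous f}.
Proof. by case: k => [|k] [fc _]; exact: fc. Qed.

Lemma ck_derivable k U f v i : ck k.+1 U f -> U v -> derivable f v (e_ i).
Proof. by move=> [_ /(_ i)[+ _]]; exact. Qed.

Lemma ck_pd k U f i : ck k.+1 U f -> ck k U (pd i f).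
Proof. by move=> [_ /(_ i)[]]. Qed.

Lemma ckW k U f : ck k.+1 U f -> ck k U f.
Proof.
elim: k f => [|k IH] f; first by case.
move=> [fc fd]; split=> // i; split; first by case: (fd i).
by apply: IH; case: (fd i).
Qed.

Lemma ck_subset k U U' f : U' `<=` U -> ck k U f -> ck k U' f.
Proof.
move=> U'U; elim: k f => [|k IH] f [fc fd]; split => //.
- by move=> v /U'U; exact: fc.
- by move=> v /U'U; exact: fc.
- by move=> i; have [d c] := fd i; split; [move=> v /U'U; exact: d|exact: IH].
Qed.

Lemma iter_pd_rcons (s : seq 'I_n) i f : iter_pd (rcons s i) f = iter_pd s (pd i f).
Proof. by rewrite /iter_pd foldr_rcons. Qed.

Lemma smooth_onP U f : smooth_on U f <-> forall k, ck k U f.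
Proof.
split=> [sf k|cf s].
  elim: k f sf => [|k IH] f sf; split=> //.
  - by move=> v Uv; have [] := sf [::] v Uv.
  - by move=> v Uv; have [] := sf [::] v Uv.
  - move=> i; split; first by move=> v Uv; have [_] := sf [::] v Uv; exact.
    by apply: IH => s v Uv; rewrite -iter_pd_rcons; exact: sf.
(* [iter_pd] applies the last index of the word first, so the word is peeled from the right, as [ck]
   peels derivatives. *)
elim/last_ind: s f cf => [|s i IH] f cf v Uv.
  split; first exact: (ck_continuous (cf 0%N)).
  by move=> i; exact: (ck_derivable (cf 1%N)).
by rewrite iter_pd_rcons; apply: IH => // k; exact/ck_pd/cf.
Qed.

Lemma near_openP U v (P : 'rV[R]_n -> Prop) : open U -> U v ->
  (forall w, U w -> P w) -> \forall w \near v, P w.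
Proof.
move=> oU Uv h; near=> w; apply: h; near: w; exact: open_nbhs_nbhs.
Unshelve. all: by end_near. Qed.

Lemma pd_ext U f g i v : open U -> (forall w, U w -> f w = g w) -> U v ->
  pd i f v = pd i g v.
Proof.
by move=> oU fg Uv; apply: near_eq_derive; exact: (near_openP oU).
Qed.

Lemma continuous_at_ext U f g v : open U -> (forall w, U w -> f w = g w) ->
  U v -> {for v, continuous f} -> {for v, continuous g}.
Proof.
move=> oU fg Uv fc; change (g @ v --> g v); rewrite -(fg _ Uv).
by apply: cvg_trans fc; exact: (near_eq_cvg (near_openP oU Uv fg)).
Qed.

Lemma ck_ext k U f g : open U -> (forall w, U w -> f w = g w) ->
  ck k U f -> ck k U g.
Proof.
move=> oU; elim: k f g => [|k IH] f g fg [fc fd]; split => //.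
- by move=> v Uv; exact: (continuous_at_ext oU fg Uv (fc v Uv)).
- by move=> v Uv; exact: (continuous_at_ext oU fg Uv (fc v Uv)).
- move=> i; have [d c] := fd i; split.
    move=> v Uv; apply: near_eq_derivable (d v Uv).
    by apply: (near_openP oU Uv) => w /fg.
  by apply: IH c => w Uw; exact: (pd_ext _ oU).
Qed.

Lemma smooth_on_ext U f g : open U -> (forall w, U w -> f w = g w) ->
  smooth_on U f -> smooth_on U g.
Proof. by move=> oU fg /smooth_onP h; apply/smooth_onP => k; exact: ck_ext fg _. Qed.

Lemma smooth_on_subset U U' f : U' `<=` U -> smooth_on U f -> smooth_on U' f.
Proof. by move=> s h t v /s Uv; exact: h. Qed.

Lemma smooth_on_pd U f i : smooth_on U f -> smooth_on U (pd i f).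
Proof. by move=> /smooth_onP h; apply/smooth_onP => k; exact/ck_pd/h. Qed.

Lemma smooth_on_continuous U f v : smooth_on U f -> U v -> {for v, continuous f}.
Proof. by move=> h Uv; have [] := h [::] v Uv. Qed.

Lemma smooth_on_derivable U f v i : smooth_on U f -> U v -> derivable f v (e_ i).
Proof. by move=> h Uv; have [_] := h [::] v Uv; exact. Qed.

Section PdRules.
Variables (f g : 'rV[R]_n -> R) (v : 'rV[R]_n) (i : 'I_n).
Hypotheses (df : derivable f v (e_ i)) (dg : derivable g v (e_ i)).

Lemma pdD : pd i (fun w => f w + g w) v = pd i f v + pd i g v.
Proof. exact: deriveD. Qed.

Lemma pdB : pd i (fun w => f w - g w) v = pd i f v - pd i g v.
Proof. exact: deriveB. Qed.

Lemma pdN : pd i (fun w => - f w) v = - pd i f v.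
Proof. exact: deriveN. Qed.

Lemma pdM : pd i (fun w => f w * g w) v = pd i f v * g v + f v * pd i g v.
Proof.
rewrite /pd; rewrite (deriveM df dg) addrC /GRing.scale/=.
by rewrite [g v * _]mulrC.
Qed.

Lemma pdZ c : pd i (fun w => c * f w) v = c * pd i f v.
Proof. exact: (deriveZ c df). Qed.

Lemma pdV : f v != 0 -> pd i (fun w => (f w)^-1) v = - (f v)^-1 * (f v)^-1 * pd i f v.
Proof.
move=> f0; rewrite /pd (deriveV f0 df) /GRing.scale/= expr2.
by rewrite invfM !mulNr.
Qed.

Lemma pd_comp1 (h : R -> R) dh : is_derive (f v) 1 h dh ->
  derivable (fun w => h (f w)) v (e_ i) /\
  pd i (fun w => h (f w)) v = dh * pd i f v.
Proof.
move=> hh; have [] := is_derive_comp1 (derivableP df) hh.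
by move=> ? ?; split.
Qed.

End PdRules.

Lemma pd_cst (c : R) (v : 'rV[R]_n) i : pd i (fun=> c) v = 0.
Proof. exact: derive_cst. Qed.

Lemma is_derive_coord (j : 'I_n) (v : 'rV[R]_n) i :
  is_derive v (e_ i) (fun w : 'rV[R]_n => w 0 j : R) ((i == j)%:R).
Proof.
set c : R := (i == j)%:R.
have H1 : is_derive (0 : R) 1 (c \*: (@id R)) (c *: 1) by exact: is_deriveZ.
have H2 : is_derive (0 : R) (1 : R) (cst (v 0 j) : R -> R) 0 by exact: is_derive_cst.
have L : is_derive (0 : R) 1 (fun s : R => s * c + v 0 j) c.
  have := is_deriveD H1 H2; rewrite addr0 [c *: 1]mulr1.
  rewrite (_ : _ + _ = (fun s : R => s * c + v 0 j)) //.
  by apply/funext => s /=; rewrite /GRing.scale/= fctE/= mulrC.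
apply: is_derive_line0; rewrite (_ : (fun s => _) =
   (fun s : R => s * c + v 0 j)) //.
by apply/funext => s; rewrite !mxE eqxx /= eq_sym.
Qed.

Lemma pd_coord (j i : 'I_n) (v : 'rV[R]_n) : pd i (fun w => w 0 j) v = (i == j)%:R.
Proof. by have [] := is_derive_coord j v i. Qed.

Lemma ck_cst k U (c : R) : ck k U (fun=> c).
Proof.
have cc v : U v -> {for v, continuous (fun=> c : R)} by move=> _; exact: cst_continuous.
elim: k c cc => [|k IH] c cc; first exact: ck0I.
apply: ckSI => [|i|i]; [exact: cc|by move=> v _; exact: derivable_cst|].
rewrite (_ : pd i _ = fun=> 0); first by apply: IH => v _; exact: cst_continuous.
by apply/funext => v; rewrite pd_cst.
Qed.

Lemma ck_coord k U j : ck k U (fun w => w 0 j).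
Proof.
have cc v : U v -> {for v, continuous (fun w : 'rV[R]_n => w 0 j)}.
  by move=> _; exact: coord_continuous.
case: k => [|k]; first exact: ck0I.
apply: ckSI => [|i|i]; [exact: cc|by move=> v _; have [] := is_derive_coord j v i|].
rewrite (_ : pd i _ = fun=> (i == j)%:R); first exact: ck_cst.
by apply/funext => v; rewrite pd_coord.
Qed.

Section CkOpen.
Variable U : set 'rV[R]_n.
Hypothesis oU : open U.

Lemma ckD k f g : ck k U f -> ck k U g -> ck k U (fun w => f w + g w).
Proof.
elim: k f g => [|k IH] f g cf cg.
  by apply: ck0I; move=> v Uv; exact: (continuousD (ck_continuous cf Uv) (ck_continuous cg Uv)).
apply: ckSI => [|i|i].
- by move=> v Uv; exact: (continuousD (ck_continuous cf Uv) (ck_continuous cg Uv)).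
- by move=> v Uv; exact: (derivableD (ck_derivable cf Uv) (ck_derivable cg Uv)).
apply: (ck_ext oU (f := fun w => pd i f w + pd i g w)).
  by move=> w Uw; rewrite pdD//; [exact: (ck_derivable cf Uw)|exact: (ck_derivable cg Uw)].
by apply: IH; exact: ck_pd.
Qed.

Lemma ckM k f g : ck k U f -> ck k U g -> ck k U (fun w => f w * g w).
Proof.
elim: k f g => [|k IH] f g cf cg.
  by apply: ck0I; move=> v Uv; exact: (continuousM (ck_continuous cf Uv) (ck_continuous cg Uv)).
apply: ckSI => [|i|i].
- by move=> v Uv; exact: (continuousM (ck_continuous cf Uv) (ck_continuous cg Uv)).
- by move=> v Uv; exact: (derivableM (ck_derivable cf Uv) (ck_derivable cg Uv)).
apply: (ck_ext oU (f := fun w => pd i f w * g w + f w * pd i g w)).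
  by move=> w Uw; rewrite pdM//; [exact: (ck_derivable cf Uw)|exact: (ck_derivable cg Uw)].
by apply: ckD; apply: IH; try exact: ck_pd; exact: ckW.
Qed.

Lemma ckN k f : ck k U f -> ck k U (fun w => - f w).
Proof.
move=> cf; apply: (ck_ext oU (f := fun w => -1 * f w)).
  by move=> w _; rewrite mulN1r.
by apply: ckM => //; exact: ck_cst.
Qed.

Lemma ckB k f g : ck k U f -> ck k U g -> ck k U (fun w => f w - g w).
Proof. by move=> cf cg; apply: ckD => //; exact: ckN. Qed.

Lemma ck_sum k (I : Type) (r : seq I) (P : pred I) (F : I -> 'rV[R]_n -> R) :
  (forall i, P i -> ck k U (F i)) -> ck k U (fun w => \sum_(i <- r | P i) F i w).
Proof.
move=> cF; elim: r => [|a r IH].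
  apply: (ck_ext oU (f := fun=> 0)); last exact: ck_cst.
  by move=> w _; rewrite big_nil.
apply: (ck_ext oU (f := fun w => (if P a then F a w else 0) + \sum_(i <- r | P i) F i w)).
  by move=> w _; rewrite big_cons; case: (P a); rewrite ?add0r.
apply: ckD => //; case Pa: (P a); [exact: cF|exact: ck_cst].
Qed.

Lemma ck_prod k (I : Type) (r : seq I) (P : pred I) (F : I -> 'rV[R]_n -> R) :
  (forall i, P i -> ck k U (F i)) -> ck k U (fun w => \prod_(i <- r | P i) F i w).
Proof.
move=> cF; elim: r => [|a r IH].
  apply: (ck_ext oU (f := fun=> 1)); last exact: ck_cst.
  by move=> w _; rewrite big_nil.
apply: (ck_ext oU (f := fun w => (if P a then F a w else 1) * \prod_(i <- r | P i) F i w)).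
  by move=> w _; rewrite big_cons; case: (P a); rewrite ?mul1r.
apply: ckM => //; case Pa: (P a); [exact: cF|exact: ck_cst].
Qed.

Lemma ckV k f : (forall w, U w -> f w != 0) -> ck k U f ->
  ck k U (fun w => (f w)^-1).
Proof.
move=> f0; elim: k => [|k IH] cf.
  by apply: ck0I; move=> v Uv; exact: (continuousV (f0 _ Uv) (ck_continuous cf Uv)).
apply: ckSI => [|i|i].
- by move=> v Uv; exact: (continuousV (f0 _ Uv) (ck_continuous cf Uv)).
- by move=> v Uv; exact: (derivableV (f0 _ Uv) (ck_derivable cf Uv)).
apply: (ck_ext oU (f := fun w => - (f w)^-1 * (f w)^-1 * pd i f w)).
  by move=> w Uw; rewrite pdV//; [exact: (ck_derivable cf Uw)|exact: f0].
have cfV := IH (ckW cf).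
by apply: ckM; [apply: ckM => //; exact: ckN|exact: ck_pd].
Qed.

Lemma ck_expR k f : ck k U f -> ck k U (fun w => expR (f w)).
Proof.
elim: k => [|k IH] cf.
  by apply: ck0I; move=> v Uv; apply: continuous_comp; [exact: (ck_continuous cf Uv)|exact: continuous_expR].
apply: ckSI => [|i|i].
- by move=> v Uv; apply: continuous_comp; [exact: (ck_continuous cf Uv)|exact: continuous_expR].
- by move=> v Uv; have [h _] := pd_comp1 (ck_derivable (i := i) cf Uv) (is_derive_expR (f v)); exact: h.
apply: (ck_ext oU (f := fun w => expR (f w) * pd i f w)).
  by move=> w Uw; have [_ ->] := pd_comp1 (ck_derivable (i := i) cf Uw) (is_derive_expR (f w)).
by apply: ckM; [exact: (IH (ckW cf))|exact: ck_pd].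
Qed.

Lemma ck_det k m (A : 'rV[R]_n -> 'M[R]_m) :
  (forall i j, ck k U (entry A i j)) -> ck k U (fun w => \det (A w)).
Proof.
move=> cA; apply: ck_sum => s _; apply: ckM; first exact: ck_cst.
by apply: ck_prod => i _; exact: cA.
Qed.

(** Cramer's formula: the entries of the inverse are cofactors divided by the determinant. *)
Lemma ck_invmx k m (A : 'rV[R]_n -> 'M[R]_m) :
  (forall v, U v -> A v \in unitmx) ->
  (forall i j, ck k U (entry A i j)) ->
  forall i j, ck k U (fun w => invmx (A w) i j).
Proof.
move=> uA cA i j.
apply: (ck_ext oU (f := fun w => (\det (A w))^-1 * cofactor (A w) j i)).
  by move=> w Uw; rewrite /invmx uA// !mxE.
apply: ckM; first apply: ckV; first by move=> w /uA; rewrite unitmxE unitfE.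
  exact: ck_det.
apply: ckM; first exact: ck_cst.
apply: ck_det => a b.
apply: (ck_ext oU (f := entry A (lift j a) (lift i b))) => //.
by move=> w _; rewrite /entry !mxE.
Qed.

End CkOpen.

End Ck.

(** * From continuous partial derivatives to differentiability and the chain rule *)

Section Differentiability.
Variables (R : realType) (n : nat).
Implicit Types (U : set 'rV[R]_n) (f g : 'rV[R]_n -> R).
Local Notation e_ i := (delta_mx 0 i : 'rV[R]_n).

(** The path from [v] to [h + v] that changes one coordinate at a time stays within sup-norm
    distance |h| of [v], so the mean value theorem applies on each edge. The coefficients [c] are
    left free: the values [pd i f v] give differentiability, and [c = 0] gives a Lipschitz bound. *)
Lemma C1_increment f (c : 'I_n -> R) v h eps :
  0 <= eps ->
  (forall w, `|w - v| <= `|h| -> forall i,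
     derivable f w (e_ i) /\ `|pd i f w - c i| <= eps) ->
  `|f (h + v) - f v - \sum_i c i * h 0 i| <= n%:R * eps * `|h|.
Proof.
move=> eps0 H.
pose hk k : 'rV[R]_n := \row_(i < n) (if (i < k)%N then h 0 i else 0).
have hk0 : hk 0%N = 0 by apply/rowP => i; rewrite !mxE.
have hkn : hk n = h by apply/rowP => i; rewrite !mxE ltn_ord.
have hkS (k : 'I_n) : hk k.+1 = h 0 k *: e_ k + hk k.
  apply/rowP => i; rewrite !mxE eqxx /= ltnS leq_eqVlt.
  have [->|ik] := eqVneq i k; first by rewrite eqxx ltnn mulr1 addr0.
  by rewrite mulr0 add0r -(inj_eq val_inj) in ik *; rewrite (negbTE ik).
have step (k : 'I_n) : `|f (hk k.+1 + v) - f (hk k + v) - c k * h 0 k| <= eps * `|h|.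
  have near_s s : `|s| <= `|h 0 k| -> `|s *: e_ k + (hk k + v) - v| <= `|h|.
    move=> sh; rewrite addrA addrK; apply: norm_mx_le => // a i.
    rewrite (ord1 a) !mxE eqxx /=.
    have [->|ik] := eqVneq i k.
      by rewrite ltnn mulr1 addr0 (le_trans sh)// norm_mx_ge.
    rewrite mulr0 add0r; case: ifP => _; last by rewrite normr0.
    exact: norm_mx_ge.
  have [s /near_s sh E] := @MVT_line _ _ f (hk k + v) (e_ k) (h 0 k)
    (fun s sh => (H _ (near_s s sh) k).1).
  rewrite hkS -[_ + hk k + v]addrA E -mulrBl normrM.
  by rewrite ler_pM ?norm_mx_ge//; have [] := H _ sh k.
have -> : f (h + v) - f v = \sum_(k < n) (f (hk k.+1 + v) - f (hk k + v)).
  rewrite -(big_mkord xpredT (fun k => f (hk k.+1 + v) - f (hk k + v))).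
  by rewrite telescope_sumr// hk0 hkn add0r.
rewrite -sumrB (le_trans (ler_norm_sum _ _ _))//.
apply: le_trans (ler_sum _ (fun k _ => step k)) _.
by rewrite sumr_const card_ord -[leLHS]mulr_natl mulrA.
Qed.

Lemma ck1_near U f v (eps : R) : open U -> ck 1 U f -> U v -> 0 < eps ->
  exists2 d, 0 < d & forall w, `|w - v| < d ->
    U w /\ forall i, derivable f w (e_ i) /\ `|pd i f w - pd i f v| <= eps.
Proof.
move=> oU cf Uv e0.
have h1 : \forall w \near v, forall i, `|pd i f v - pd i f w| <= eps.
  have FF : Filter (nbhs v) by exact: nbhs_filter.
  apply: (@filter_forall _ _ (fun i w => `|pd i f v - pd i f w| <= eps) (nbhs v) FF) => i.
  by have /cvgrPdist_le/(_ _ e0) := ck_continuous (ck_pd i cf) Uv.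
have h2 : \forall w \near v, U w by exact: open_nbhs_nbhs.
have /nbhs_ballP[d /= d0 hd] : \forall w \near v, U w /\ forall i, `|pd i f v - pd i f w| <= eps.
  by apply: filterS2 h2 h1.
exists d => // w wv.
have [|Uw hw] := hd w; first by rewrite -ball_normE /= distrC.
split=> // i; split; first exact: (ck_derivable cf Uw).
by rewrite distrC.
Qed.

Lemma ck1_differentiable U f v : open U -> ck 1 U f -> U v -> differentiable f v.
Proof.
move=> oU cf Uv.
pose df (h : 'rV[R]_n) : R := \sum_i pd i f v * h 0 i.
have dfl : linear df.
  move=> a x y; rewrite /df scaler_sumr -big_split /=; apply: eq_bigr => i _.
  by rewrite !mxE /GRing.scale/= mulrDr mulrCA.
pose dfL := GRing.isLinear.Build _ _ _ _ _ dfl.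
pose D : {linear 'rV[R]_n -> R} := HB.pack df dfL.
have Dc : continuous D.
  move=> x; apply: (@ck_continuous _ _ 0 setT df) => //.
  apply: ck_sum => [|i _]; first exact: openT.
  by apply: ckM; [exact: openT|exact: ck_cst|exact: ck_coord].
have E : f \o shift v = cst (f v) + D +o_ (0 : 'rV[R]_n) id.
  apply/eqaddoP => _/posnumP[eps].
  (* [n.+1] in place of [n] avoids a division by zero in dimension 0. *)
  have n1 : 0 < n.+1%:R :> R by [].
  have [d d0 hd] := ck1_near oU cf Uv (divr_gt0 (gt0 eps) n1).
  near=> h.
  rewrite /= !fctE /= opprD addrA.
  have hd' : `|h| < d.
    by near: h; apply/nbhs_ballP; exists d => //= z; rewrite -ball_normE /= sub0r normrN.
  apply: le_trans (@C1_increment f (fun i => pd i f v) v h (eps%:num / n.+1%:R) _ _) _.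
  - by rewrite divr_ge0.
  - by move=> w wh; have [|_] := hd w; first exact: le_lt_trans hd'.
  - rewrite ler_wpM2r// mulrA ler_pdivrMr// mulrC ler_wpM2l// ler_nat//.
apply/diff_locallyP; rewrite (diff_unique Dc E); split => //.
Unshelve. all: by end_near. Qed.

End Differentiability.

Section Chain.
Variables (R : realType).

(** Restricted to the line through [v] in direction [w], the inner map is a curve, for which
    derivability and differentiability coincide. So directional derivatives of [P] suffice, while
    [f] is differentiable in the full sense. *)
Lemma is_derive_comp_mx (V : normedModType R) m (f : 'rV[R]_m -> R)
    (P : V -> 'rV[R]_m) v w :
  differentiable f (P v) ->
  (forall j, derivable (fun x => P x 0 j) v w) ->
  is_derive v w (f \o P) (\sum_j pd j f (P v) * 'D_w (fun x => P x 0 j) v).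
Proof.
move=> df dP.
have dPm : derivable P v w by apply/derivable_mxP => i j; rewrite (ord1 i).
apply: is_derive_line0.
pose c := fun s : R => P (s *: w + v).
have c0 : c 0 = P v by rewrite /c scale0r add0r.
have dc : is_derive (0 : R) 1 c ('D_w P v).
  have := @is_derive_line _ _ _ P v w 0; rewrite scale0r add0r => /(_ dPm) h.
  exact: h.
have [dc1 dc2] := dc.
have diffc : differentiable c (0 : R) := (derivable1_diffP c 0).1 dc1.
have df0 : differentiable f (c 0) by rewrite c0.
have dfc := differentiable_comp diffc df0.
rewrite (_ : (fun s : R => (f \o P) (s *: w + v)) = f \o c) //.
apply: DeriveDef; first exact: diff_derivable.
rewrite (deriveE _ dfc) diff_comp//= -(deriveE _ diffc) c0.
rewrite dc2.
rewrite (derive_mx dPm) [X in 'd f (P v) X]row_sum_delta linear_sum /=.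
apply: eq_bigr => j _; rewrite linearZ /= !mxE /GRing.scale/= mulrC.
by rewrite -deriveE.
Qed.

End Chain.

Section ChainPd.
Variables (R : realType) (n m : nat).
Implicit Types (U : set 'rV[R]_n) (W : set 'rV[R]_m).

Lemma pd_comp (f : 'rV[R]_m -> R) (P : 'rV[R]_n -> 'rV[R]_m) v i :
  differentiable f (P v) ->
  (forall j, derivable (entry P 0 j) v (delta_mx 0 i)) ->
  derivable (f \o P) v (delta_mx 0 i) /\
  pd i (f \o P) v = \sum_j pd j f (P v) * pd i (entry P 0 j) v.
Proof.
move=> df dP; have [] := is_derive_comp_mx df dP.
by move=> h1 h2; split.
Qed.

Lemma continuous_rv (T : topologicalType) (P : T -> 'rV[R]_m) (v : T) :
  (forall j, {for v, continuous (fun x => P x 0 j)}) -> {for v, continuous P}.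
Proof.
move=> h; change (P @ v --> P v); apply/cvg_mxP => i j.
by rewrite (ord1 i); exact: h.
Qed.

Lemma ck_comp k U W (f : 'rV[R]_m -> R) (P : 'rV[R]_n -> 'rV[R]_m) :
  open U -> open W -> (forall v, U v -> W (P v)) ->
  (forall j, ck k U (entry P 0 j)) -> ck k W f -> ck k U (f \o P).
Proof.
move=> oU oW UW; elim: k f => [|k IH] f cP cf.
  apply: ck0I => v Uv; apply: continuous_comp.
    by apply: continuous_rv => j; exact: (ck_continuous (cP j) Uv).
  exact: (ck_continuous cf (UW _ Uv)).
have df v : U v -> differentiable f (P v).
  move=> Uv; apply: (ck1_differentiable oW _ (UW _ Uv)).
  by elim: k cf {IH cP} => // k IH /ckW /IH.
have dP v i j : U v -> derivable (entry P 0 j) v (delta_mx 0 i).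
  by move=> Uv; exact: (ck_derivable (cP j) Uv).
apply: ckSI => [v Uv|i v Uv|i].
- apply: continuous_comp.
    by apply: continuous_rv => j; exact: (ck_continuous (cP j) Uv).
  exact: (ck_continuous cf (UW _ Uv)).
- by have [] := @pd_comp f P v i (df _ Uv) (fun j => dP _ i j Uv).
- apply: (ck_ext oU (f := fun v => \sum_j (pd j f \o P) v * pd i (entry P 0 j) v)).
    by move=> v Uv; have [_ ->] := @pd_comp f P v i (df _ Uv) (fun j => dP _ i j Uv).
  apply: ck_sum => // j _; apply: ckM => //.
    by apply: IH; [move=> l; exact: ckW|exact: ck_pd].
  exact: ck_pd.
Qed.

End ChainPd.

(** * Symmetry of second derivatives *)

Section Schwarz.
Variables (R : realType) (n : nat).
Implicit Types (U : set 'rV[R]_n) (f g : 'rV[R]_n -> R).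
Local Notation e_ i := (delta_mx 0 i : 'rV[R]_n).

(** The mean value theorem is applied twice: to the increment of [f] along [e_ j] as a function of
    the [i]-th coordinate, then to [pd i f]. The second difference is symmetric in [i] and [j],
    which is what [pd_comm] exploits. *)
Lemma pd_second_difference U f v i j (d : R) : ck 2 U f -> 0 < d ->
  (forall w, `|w - v| <= 2 * d -> U w) ->
  exists2 w, `|w - v| <= 2 * d &
    f (d *: e_ i + (d *: e_ j + v)) - f (d *: e_ i + v) - f (d *: e_ j + v) + f v
    = pd j (pd i f) w * d * d.
Proof.
move=> cf d0 hU.
have bnd s t : `|s| <= d -> `|t| <= d -> `|s *: e_ i + (t *: e_ j + v) - v| <= 2 * d.
  move=> sd td; rewrite addrA addrK (le_trans (ler_normD _ _))// !normrZ mulr2n mulrDl mul1r.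
  rewrite lerD// -[leRHS]mulr1 ler_pM// ?norm_delta_le1//.
have bnd0 s : `|s| <= d -> `|s *: e_ i + v - v| <= 2 * d.
  by move=> sd; have := @bnd s 0 sd; rewrite scale0r add0r normr0 => /(_ (ltW d0)).
pose g w := f (d *: e_ j + w) - f w.
have dn : `|d| = d by rewrite gtr0_norm.
have [s sd Eg] : exists2 s : R, `|s| <= `|d| & g (d *: e_ i + v) - g v =
    (pd i f (s *: e_ i + (d *: e_ j + v)) - pd i f (s *: e_ i + v)) * d.
  have [s|s sd E] := @MVT_dist _ (fun s => g (s *: e_ i + v)) (fun s =>
     pd i f (s *: e_ i + (d *: e_ j + v)) - pd i f (s *: e_ i + v)) 0 d.
    rewrite !subr0 dn => sd; apply: is_deriveB.
      rewrite (_ : (fun s => f (d *: e_ j + (s *: e_ i + v))) =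
                   (fun s => f (s *: e_ i + (d *: e_ j + v)))).
        apply: is_derive_line; apply: (ck_derivable cf); apply: hU; apply: bnd => //.
        by rewrite dn.
      by apply/funext => t; rewrite addrCA.
    apply: is_derive_line; apply: (ck_derivable cf); apply: hU; exact: bnd0.
  rewrite !subr0 in sd E; exists s => //.
  by rewrite -E scale0r add0r.
rewrite dn in sd.
have [t|t td Eh] := @MVT_line _ _ (pd i f) (s *: e_ i + v) (e_ j) d.
  rewrite dn => td; apply: (ck_derivable (ck_pd i cf)); apply: hU.
  by rewrite addrCA; exact: bnd.
rewrite dn in td.
exists (s *: e_ i + (t *: e_ j + v)); first exact: bnd.
rewrite [_ + (t *: _ + _)]addrCA -Eh [d *: e_ j + (s *: _ + _)]addrCA -Eg /g.
rewrite [d *: e_ j + (d *: _ + _)]addrCA; ring.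
Qed.

Lemma second_difference_eq (x1 x2 x3 x4 b a d : R) : d != 0 ->
  x1 - x2 - x3 + x4 = b * d * d -> x1 - x3 - x2 + x4 = a * d * d -> b = a.
Proof.
move=> d0 h1 h2; apply: (mulIf d0); apply: (mulIf d0); rewrite -h1 -h2; ring.
Qed.

Lemma dist_quarter_absurd (a b c : R) : 0 < `|a - b| / 4 ->
  `|c - a| <= `|a - b| / 4 -> `|c - b| <= `|a - b| / 4 -> False.
Proof.
move=> e0 h1 h2; have : `|a - b| <= `|c - a| + `|c - b|.
  by rewrite -(subrKA c) (le_trans (ler_normD _ _))// [`|a - c|]distrC.
lra.
Qed.

Lemma pd_comm U f v i j : open U -> ck 2 U f -> U v ->
  pd i (pd j f) v = pd j (pd i f) v.
Proof.
move=> oU cf Uv; apply/eqP/negPn/negP => ne.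
set A := pd i (pd j f); set B := pd j (pd i f).
have e0 : 0 < `|A v - B v| / 4.
  by rewrite divr_gt0// normr_gt0 subr_eq0.
(* A quarter of the supposed gap: the two mixed derivatives will take a common value at two points
   near [v], at each of which they are within [eps] of [A v] and [B v] respectively. *)
set eps := `|A v - B v| / 4 in e0.
have near_v C k : ck k U C -> exists2 d, 0 < d & forall w, `|w - v| < d -> `|C w - C v| <= eps.
  move=> cC; have /cvgrPdist_le/(_ _ e0)/nbhs_ballP[d /= d0 hd] := ck_continuous cC Uv.
  exists d => // w wv; rewrite distrC; apply: hd.
  by rewrite -ball_normE /= distrC.
have [d1 d10 h1] := near_v _ _ (ck_pd i (ck_pd j cf)).
have [d2 d20 h2] := near_v _ _ (ck_pd j (ck_pd i cf)).
have [d3 d30 h3] : exists2 d, 0 < d & forall w, `|w - v| < d -> U w.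
  have /nbhs_ballP[d /= d0 hd] : nbhs v U by exact: open_nbhs_nbhs.
  by exists d => // w wv; apply: hd; rewrite -ball_normE /= distrC.
have [d [d0 m1 m2 m4]] : exists d, [/\ 0 < d, 2 * d < d1, 2 * d < d2 & 2 * d < d3].
  have m0 : 0 < Num.min d1 (Num.min d2 d3) by rewrite !lt_min d10 d20 d30.
  have : 2 * (Num.min d1 (Num.min d2 d3) / 3) < Num.min d1 (Num.min d2 d3).
    move: (Num.min _ _) m0 => m m0; clear -m0; lra.
  rewrite !lt_min => /and3P[? ? ?].
  by exists (Num.min d1 (Num.min d2 d3) / 3); split=> //; rewrite divr_gt0.
have hU w : `|w - v| <= 2 * d -> U w by move=> h; apply: h3; exact: le_lt_trans m4.
have [w wv Ew] := pd_second_difference i j cf d0 hU.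
have [w' w'v Ew'] := pd_second_difference j i cf d0 hU.
rewrite (addrCA (d *: e_ j) (d *: e_ i) v) in Ew'.
have AB := second_difference_eq (lt0r_neq0 d0) Ew Ew'.
have := h2 _ (le_lt_trans wv m2); have := h1 _ (le_lt_trans w'v m1).
rewrite -AB => hA hB; exact: (dist_quarter_absurd e0 hA hB).
Qed.

End Schwarz.

(** * Primitives of continuous functions on an open interval *)

Section Primitive.
Variable R : realType.
Notation mu := (@lebesgue_measure R).

Lemma integrable_cc (f : R -> R) (x y : R) :
  (forall z, x <= z <= y -> {for z, continuous f}) ->
  mu.-integrable `[x, y] (EFin \o f).
Proof.
move=> fc; apply: continuous_compact_integrable; first exact: segment_compact.
apply: continuous_in_subspaceT => z; rewrite inE /= in_itv /=; exact: fc.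
Qed.

Lemma Rintegral_cc (f : R -> R) (c c' x : R) : c <= c' -> c' <= x ->
  (forall z, c <= z <= x -> {for z, continuous f}) ->
  \int[mu]_(t in `[c, x]) f t =
  \int[mu]_(t in `[c, c']) f t + \int[mu]_(t in `[c', x]) f t.
Proof.
move=> cc' c'x fc.
have i1 : mu.-integrable `[c, x] (EFin \o f) by exact: integrable_cc.
have := @Rintegral_itvB _ f (BLeft c) (BRight x) c' i1.
rewrite !bnd_simp => /(_ cc' c'x) /eqP; rewrite subr_eq addrC => /eqP ->.
congr (_ + _); rewrite Rintegral_itv_obnd_cbnd//.
have i2 : mu.-integrable `[c', x] (EFin \o f).
  by apply: integrable_cc => z /andP[z1 z2]; apply: fc; rewrite z2 (le_trans cc').
by apply: integrableS i2 => //; apply: subset_itvr; rewrite bnd_simp.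
Qed.

(** An integral over [[b, x]] needs a base point to the left of [x], and [x] may lie on either side
    of [a]. The base point [lo x] is left of both, and by [Jind] the normalized integral [J] does
    not depend on it. *)
Lemma primitive_exists (f : R -> R) (c a d : R) : c < a -> a < d ->
  (forall x, c < x < d -> {for x, continuous f}) ->
  exists F : R -> R, F a = 0 /\ forall x, c < x < d -> is_derive x 1 F (f x).
Proof.
move=> ca ad fc.
pose J (b x : R) := \int[mu]_(t in `[b, x]) f t - \int[mu]_(t in `[b, a]) f t.
pose lo x := (c + Num.min a x) / 2.
have lo_lt x : c < x -> [/\ c < lo x, lo x < a & lo x < x].
  by move=> cx; rewrite /lo; case: (leP a x) => h; split; clear -h cx ca; lra.
have Jind (b b' x : R) : c < b -> b <= b' -> b' <= a -> b' <= x -> x < d -> J b x = J b' x.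
  move=> cb bb' b'a b'x xd; rewrite /J.
  rewrite (@Rintegral_cc f b b' x)// ?(@Rintegral_cc f b b' a)//.
  - move: (\int[mu]_(t in _) _) (\int[mu]_(t in _) _) (\int[mu]_(t in _) _) => p q r.
    by clear; ring.
  - by move=> z /andP[bz za]; apply: fc; rewrite (lt_le_trans cb bz) (le_lt_trans za ad).
  - by move=> z /andP[bz za]; apply: fc; rewrite (lt_le_trans cb bz) (le_lt_trans za xd).
exists (fun x => J (lo x) x); split; first by rewrite /J subrr.
move=> x /andP[cx xd].
have [l1 l2 l3] := lo_lt x cx.
(* One base point that works for all [y] near [x], so that the fundamental theorem applies with a
   fixed lower limit. *)
pose b := (c + lo x) / 2.
have cb : c < b by rewrite /b; clear -l1; lra.
have bl : b < lo x by rewrite /b; clear -l1; lra.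
have E : \forall y \near x, J b y = J (lo y) y.
  near=> y.
  have cy : b < y by near: y; apply: lt_nbhsr; exact: lt_trans l3.
  have yd : y < d by near: y; exact: lt_nbhsl.
  have ly : lo x < y by near: y; exact: lt_nbhsr.
  have cy' : c < y by exact: lt_trans cy.
  have [k1 k2 k3] := lo_lt y cy'.
  have bly : b <= lo y.
    by rewrite /b {2}/lo; case: (leP a y) => _; clear -ly l2; lra.
  by apply: Jind => //; exact: ltW.
apply: near_eq_is_derive E _.
pose u := (x + d) / 2.
have xu : x < u by rewrite /u; clear -xd; lra.
have ud : u < d by rewrite /u; clear -xd; lra.
have bx : b < x by exact: lt_trans l3.
have intf : mu.-integrable `[b, u] (EFin \o f).
  apply: integrable_cc => z /andP[z1 z2]; apply: fc.
  by rewrite (lt_le_trans cb z1) (le_lt_trans z2 ud).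
have fx : {for x, continuous f} by apply: fc; rewrite cx.
have [d1 d2] := continuous_FTC1_closed xu intf bx fx.
have H1 : is_derive x 1 (fun y => \int[mu]_(t in `[b, y]) f t) (f x).
  by apply: DeriveDef; [exact: d1|rewrite -derive1E; exact: d2].
have H2 : is_derive x (1 : R) (cst (\int[mu]_(t in `[b, a]) f t) : R -> R) 0.
  exact: is_derive_cst.
by have := is_deriveB H1 H2; rewrite subr0.
Unshelve. all: by end_near. Qed.

End Primitive.

(** * Cubes, compactness and uniform continuity *)

Section Cube.
Variables (R : realType) (n : nat).
Implicit Types (p v w : 'rV[R]_n) (f : 'rV[R]_n -> R).
Local Notation e_ i := (delta_mx 0 i : 'rV[R]_n).

(** The ball of the sup norm. Being a product of intervals, it is also a suitable image for a chart
    adapted to a product metric. *)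
Definition cube p d : set 'rV[R]_n := [set v | `|v - p| < d].

Lemma norm_rV_lt v d : 0 < d -> (forall j, `|v 0 j| < d) -> `|v| < d.
Proof.
move=> d0 h; rewrite /Num.Def.normr/= mx_normrE; apply: bigmax_lt => // -[i j] _.
by rewrite (ord1 i); exact: h.
Qed.

Lemma cubeP p v d : 0 < d -> cube p d v <-> forall j, `|v 0 j - p 0 j| < d.
Proof.
move=> d0; split=> [pv j|h]; last by apply: norm_rV_lt => // j; rewrite !mxE.
by apply: le_lt_trans pv; have := norm_mx_ge (v - p) 0 j; rewrite !mxE.
Qed.

Lemma cube_ball p d : cube p d = ball p d.
Proof. by apply/seteqP; split=> v; rewrite -ball_normE /cube /= distrC. Qed.

Lemma open_cube p d : open (cube p d).
Proof. by rewrite cube_ball; exact: ball_open. Qed.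

Lemma cube_center p d : 0 < d -> cube p d p.
Proof. by move=> d0; rewrite /cube /= subrr normr0. Qed.

Lemma open_cube_subset (U : set 'rV[R]_n) p : open U -> U p ->
  exists2 d : R, 0 < d & cube p d `<=` U.
Proof.
move=> oU Up; have /nbhs_ballP[d /= d0 h] : nbhs p U by exact: open_nbhs_nbhs.
by exists d => //; rewrite cube_ball.
Qed.

Lemma compact_closed_cube p r : compact [set v | `|v - p| <= r].
Proof.
apply: bounded_closed_compact.
  exists (`|p| + r); split; first exact: num_real.
  move=> x xr v /= vp; apply: le_trans (ltW xr).
  by rewrite -(subrK p v) (le_trans (ler_normD _ _))// addrC lerD2l.
rewrite (_ : [set v | _] = (fun v => `|v - p|) @^-1` [set x | x <= r])//.
apply: preimage_closed; last exact: closed_le.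
move=> v _; apply: continuous_comp; last exact: norm_continuous.
by apply: continuousB; [by []|exact: cst_continuous].
Qed.

(** Only [v] is confined to the compact cube; [w] may lie outside it. Hence the covering argument at
    the points of the cube, rather than uniform continuity of the restriction of [f]. *)
Lemma uniform_continuity f p (r eps : R) :
  (forall v, `|v - p| <= r -> {for v, continuous f}) -> 0 < eps ->
  exists2 d : R, 0 < d & forall v w, `|v - p| <= r -> `|w - v| < d ->
    `|f w - f v| <= eps.
Proof.
move=> fc e0.
have /compact_near_coveringP := @compact_closed_cube p r.
move=> /(_ R (0^'+) (fun d v => forall w, `|w - v| < d -> `|f w - f v| <= eps) _).
case.
  move=> v /= vr.
  have e20 : 0 < eps / 2 by rewrite divr_gt0.
  have /cvgrPdist_le/(_ _ e20)/nbhs_ballP[d /= d0 hd] := fc v vr.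
  have d20 : 0 < d / 2 by rewrite divr_gt0.
  exists (ball v (d / 2), [set x : R | x < d / 2]) => /=.
    split; first exact: nbhsx_ballx.
    by apply: nbhs_right_lt.
  move=> [w x] /= [wv xd] z zx.
  have vw : `|v - w| < d / 2 by move: wv; rewrite -ball_normE.
  have h1 : `|f v - f w| <= eps / 2.
    apply: hd; rewrite -ball_normE /=; apply: lt_trans vw _.
    by rewrite ltr_pdivrMr// mulr_natr mulr2n ltrDl.
  have h2 : `|f v - f z| <= eps / 2.
    apply: hd; rewrite -ball_normE /= -(subrKA w).
    rewrite (le_lt_trans (ler_normD _ _))// (splitr d) ltrD// distrC.
    exact: lt_trans xd.
  rewrite -(subrKA (f v)) (le_trans (ler_normD _ _))// (splitr eps) lerD//.
  by rewrite distrC.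
move=> d /= d0 hd; exists (d / 2); first by rewrite divr_gt0.
move=> v w vr wv; apply: (hd (d / 2)) => //=.
- rewrite /ball_/= sub0r normrN gtr0_norm ?divr_gt0//.
  by rewrite ltr_pdivrMr// mulr_natr mulr2n ltrDl.
- by rewrite divr_gt0.
Qed.

Lemma compact_bounded_fun f p r :
  (forall v, `|v - p| <= r -> {for v, continuous f}) ->
  exists2 M : R, 0 < M & forall v, `|v - p| <= r -> `|f v| <= M.
Proof.
move=> fc.
have cK := @compact_closed_cube p r.
have : compact (f @` [set v | `|v - p| <= r]).
  apply: continuous_compact => //; apply: continuous_in_subspaceT => v.
  by rewrite inE; exact: fc.
move=> /compact_bounded[M [Mr hM]].
exists (Num.max 1 (M + 1)); first by rewrite lt_max ltr01.
move=> v vr; apply: hM; last by exists v.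
by rewrite lt_max ltrDl ltr01 orbT.
Qed.

End Cube.

Section DeriveMisc.
Variables (R : realType) (V : normedModType R).

Lemma is_derive_translate (F : V -> R) (h u e : V) (d : R) :
  is_derive (h + u) e F d -> is_derive u e (fun w => F (h + w)) d.
Proof.
have E : (fun t : R => t^-1 *: (F (h + (t *: e + u)) - F (h + u)))
       = (fun t : R => t^-1 *: (F (t *: e + (h + u)) - F (h + u))).
  by apply/funext => t; rewrite addrCA.
move=> [dF dE]; apply: DeriveDef; first by rewrite /derivable E.
by move: dE; rewrite /derive/= E.
Qed.

Lemma is_derive_eps (F : V -> R) (v e : V) (l : R) :
  (forall eps : R, 0 < eps -> exists2 d : R, 0 < d &
     forall h : R, `|h| < d -> `|F (h *: e + v) - F v - h * l| <= eps * `|h|) ->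
  is_derive v e F l.
Proof.
move=> H.
have C : h^-1 *: (F (h *: e + v) - F v) @[h --> (0:R)^'] --> l.
  apply/cvgrPdist_le => eps e0; have [d d0 hd] := H _ e0.
  near=> h.
  have h0 : h != 0 by near: h; exact: nbhs_dnbhs_neq.
  have hd' : `|h| < d by near: h; exact: dnbhs0_lt.
  rewrite distrC -[l](mulKf h0) /GRing.scale/= -mulrBr normrM normfV.
  by rewrite ler_pdivrMl ?normr_gt0// [_ * eps]mulrC hd.
apply: DeriveDef; first by apply/cvg_ex; exists l.
exact: cvg_lim.
Unshelve. all: by end_near. Qed.

End DeriveMisc.

Lemma mul_half (R : realFieldType) (M e : R) : M != 0 -> M * (e / (2 * M)) = e / 2.
Proof. by move=> M0; field. Qed.

(** * Picard iteration and flow boxes *)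

Section PrimitiveOperator.
Variables (R : realType) (n : nat) (i0 : 'I_n) (p : 'rV[R]_n) (dl : R).
Hypothesis dl0 : 0 < dl.
Implicit Types (v w : 'rV[R]_n) (f g : 'rV[R]_n -> R).
Local Notation e_ i := (delta_mx 0 i : 'rV[R]_n).
Local Notation a := (p 0 i0).
Local Notation W := (cube p dl).

Definition upd v (s : R) : 'rV[R]_n := \row_j (if j == i0 then s else v 0 j).

Lemma updE v s j : upd v s 0 j = if j == i0 then s else v 0 j.
Proof. by rewrite mxE. Qed.

Lemma upd_i0 v s : upd v s 0 i0 = s.
Proof. by rewrite updE eqxx. Qed.

Lemma upd_self v : upd v (v 0 i0) = v.
Proof. by apply/rowP => j; rewrite updE; case: eqVneq => [->|]. Qed.

Lemma upd_upd v s t : upd (upd v s) t = upd v t.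
Proof. by apply/rowP => j; rewrite !updE; case: eqVneq. Qed.

Lemma upd_line v s t : upd v s = (s - t) *: e_ i0 + upd v t.
Proof.
apply/rowP => j; rewrite !mxE eqxx /=.
by case: eqVneq => _; rewrite ?mulr1 ?subrK// mulr0 add0r.
Qed.

Lemma upd_add_line v s t : upd (t *: e_ i0 + v) s = upd v s.
Proof.
by apply/rowP => j; rewrite !mxE eqxx /=; case: eqVneq; rewrite ?mulr0 ?add0r.
Qed.

Lemma upd_addr (h v : 'rV[R]_n) s : h 0 i0 = 0 -> upd (h + v) s = h + upd v s.
Proof.
by move=> h0; apply/rowP => j; rewrite !mxE; case: eqVneq => [->|//]; rewrite h0 add0r.
Qed.

Lemma upd_near v s r : `|v - p| <= r -> `|s - a| <= r -> `|upd v s - p| <= r.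
Proof.
move=> vr sr; apply: norm_mx_le; first exact: le_trans sr.
move=> i j; rewrite (ord1 i) !mxE; case: eqVneq => [->//|_].
by apply: le_trans vr; have := norm_mx_ge (v - p) 0 j; rewrite !mxE.
Qed.

Lemma upd_cube v s : W v -> `|s - a| < dl -> W (upd v s).
Proof.
move=> Wv sd; rewrite /cube/=; apply: (@le_lt_trans _ _ (Num.max `|v - p| `|s - a|)).
  by apply: upd_near; rewrite le_max lexx ?orbT.
by rewrite gt_max sd Wv.
Qed.

Lemma cube_coord v j : W v -> `|v 0 j - p 0 j| < dl.
Proof. move=> Wv; exact: ((cubeP _ _ dl0).1 Wv j). Qed.

Lemma upd_cube_le v s : W v -> `|s - a| <= `|v 0 i0 - a| -> W (upd v s).
Proof. by move=> Wv sv; apply: upd_cube => //; exact: (le_lt_trans sv (cube_coord _ Wv)). Qed.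

(** Integration along the coordinate [i0] from the slice through [p], obtained for all [f] at once
    by choice. Afterwards [P] is used only through its derivative along [i0] and its vanishing on
    the slice, never as an integral. *)
Lemma primitive_operator_exists : exists P : ('rV[R]_n -> R) -> 'rV[R]_n -> R,
  forall f, ck 0 W f ->
    (forall v, W v -> is_derive v (e_ i0) (P f) (f v)) /\
    (forall v, P f (upd v a) = 0).
Proof.
have ex (fb : ('rV[R]_n -> R) * 'rV[R]_n) : exists F : R -> R,
    F a = 0 /\ (ck 0 W fb.1 -> W fb.2 ->
      forall x, a - dl < x < a + dl -> is_derive x 1 F (fb.1 (upd fb.2 x))).
  case: fb => f b /=.
  have [[cf Wb]|nfb] := pselect (ck 0 W f /\ W b); last first.
    by exists (fun=> 0); split=> // cf Wb; case: nfb.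
  have l1 : a - dl < a by rewrite ltrBlDr ltrDl.
  have l2 : a < a + dl by rewrite ltrDl.
  have [|F [Fa dF]] := @primitive_exists R (fun s => f (upd b s)) _ a _ l1 l2.
    move=> x xd; apply: continuous_comp.
      apply: continuous_rv => j.
      rewrite (_ : (fun x => upd b x 0 j) = if j == i0 then id else cst (b 0 j)).
        by case: ifP => _; [|exact: cst_continuous].
      by apply/funext => s; rewrite updE; case: ifP.
    by apply: (ck_continuous cf); apply: upd_cube => //; rewrite ltr_distl.
  by exists F.
have [F HF] := choice ex.
(* Indexing the chosen primitives by the foot [upd v a] on the slice makes all points of one line in
   direction [i0] share the same primitive. *)
exists (fun f v => F (f, upd v a) (v 0 i0)) => f cf; split=> v; last first.
  by rewrite upd_i0; have [] := HF (f, upd (upd v a) a).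
move=> Wv; apply: is_derive_line0.
rewrite (_ : (fun s => _) = F (f, upd v a) \o (fun s : R => s + v 0 i0)); last first.
  by apply/funext => s /=; rewrite upd_add_line !mxE !eqxx mulr1.
have [_ /(_ cf)] := HF (f, upd v a).
have Wa : W (upd v a) by apply: upd_cube => //; rewrite subrr normr0.
move=> /(_ Wa (v 0 i0)); rewrite -ltr_distl (cube_coord _ Wv) upd_upd upd_self => /(_ isT) dF.
have H1 : is_derive (0 : R) 1 (fun s : R => s + v 0 i0) 1.
  have H1 : is_derive (0 : R) (1 : R) (@id R) 1 by exact: is_derive_id.
  have H2 : is_derive (0 : R) (1 : R) (cst (v 0 i0) : R -> R) 0 by exact: is_derive_cst.
  by have := is_deriveD H1 H2; rewrite addr0.
rewrite -[f v]mulr1; apply: is_derive1_comp.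
by rewrite add0r.
Qed.

Variable P : ('rV[R]_n -> R) -> 'rV[R]_n -> R.
Hypothesis HP : forall f, ck 0 W f ->
  (forall v, W v -> is_derive v (e_ i0) (P f) (f v)) /\
  (forall v, P f (upd v a) = 0).

Lemma line_increment (G dG : 'rV[R]_n -> R) v s t M : 
  (forall x, `|x - s| <= `|t - s| ->
     is_derive (upd v x) (e_ i0) G (dG (upd v x)) /\ `|dG (upd v x)| <= M) ->
  `|G (upd v t) - G (upd v s)| <= M * `|t - s|.
Proof.
move=> H.
have [x|x xs] := @MVT_line _ _ G (upd v s) (e_ i0) (t - s).
  move=> xs; have := H (x + s); rewrite addrK => /(_ xs)[+ _].
  by rewrite (@upd_line v (x + s) s) addrK => -[].
rewrite -upd_line => ->; rewrite normrM ler_wpM2r//.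
have := H (x + s); rewrite addrK => /(_ xs)[].
by rewrite (@upd_line v (x + s) s) addrK => -[_ ->].
Qed.

(** The source of contraction: the length of integration is at most [dl], so shrinking the cube
    makes [P] as contracting as desired. *)
Lemma prim_dist f g v M : 0 <= M -> ck 0 W f -> ck 0 W g -> W v ->
  (forall w, W w -> `|f w - g w| <= M) -> `|P f v - P g v| <= dl * M.
Proof.
move=> M0 cf cg Wv fg.
have [df f0] := HP cf; have [dg g0] := HP cg.
have := @line_increment (fun w => P f w - P g w) (fun w => f w - g w) v a (v 0 i0) M.
rewrite f0 g0 !subr0 upd_self => h.
rewrite (le_trans (h _))//; last first.
  by rewrite mulrC ler_wpM2r// ltW// cube_coord.
move=> x xa; have Wx := upd_cube_le Wv xa; split; last exact: fg.
by apply: is_deriveB; [exact: df|exact: dg].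
Qed.

Lemma cube_between v : W v -> exists r, `|v - p| < r /\ r < dl.
Proof.
move=> Wv; exists ((`|v - p| + dl) / 2).
by have [? ?] := midf_lt Wv.
Qed.

Lemma prim_continuous f v : ck 0 W f -> W v -> {for v, continuous (P f)}.
Proof.
move=> cf Wv; have [df f0] := HP cf.
have [r [vr rdl]] := cube_between Wv.
have fc w : `|w - p| <= r -> {for w, continuous f}.
  by move=> wr; apply: (ck_continuous cf); exact: le_lt_trans rdl.
have [M M0 fM] := compact_bounded_fun fc.
have FF : Filter (nbhs v) by exact: nbhs_filter.
apply/(@cvgrPdist_le _ _ _ (nbhs v) FF) => eps e0.
have e1 : 0 < eps / (2 * dl) by rewrite divr_gt0// mulr_gt0.
have [d d0 hd] := uniform_continuity fc e1.
have vr0 : 0 < r - `|v - p| by rewrite subr_gt0.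
pose d' := Num.min (Num.min d (r - `|v - p|)) (eps / (2 * M)).
have d'0 : 0 < d' by rewrite !lt_min d0 vr0 divr_gt0// mulr_gt0.
apply/nbhs_ballP; exists d' => // w; rewrite -ball_normE /= distrC => wv.
have [wd wr wM] : [/\ `|w - v| < d, `|w - v| < r - `|v - p| & `|w - v| < eps / (2 * M)].
  by move: wv; rewrite !lt_min => /andP[/andP[? ?] ?].
have wpr : `|w - p| <= r.
  rewrite -(subrKA v) (le_trans (ler_normD _ _))//.
  by rewrite -lerBrDr ltW.
have arng x : `|x - a| <= `|v 0 i0 - a| -> `|x - a| <= r.
  move=> xa; rewrite (le_trans xa)// (le_trans _ (ltW vr))//.
  by have := norm_mx_ge (v - p) 0 i0; rewrite !mxE.
rewrite distrC.
(* The variation is split into one along the [i0]-line of [w], bounded through [M], and one between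
   parallel lines, bounded through the uniform continuity of [f]. *)
have -> : P f w - P f v = (P f w - P f (upd w (v 0 i0))) + (P f (upd w (v 0 i0)) - P f v).
  by rewrite subrKA.
rewrite (le_trans (ler_normD _ _))// (splitr eps) lerD//.
- have := @line_increment (P f) f w (v 0 i0) (w 0 i0) M.
  rewrite upd_self => h; rewrite (le_trans (h _))//.
    move=> x xs.
    have xr : `|upd w x - p| <= r.
      apply: upd_near => //.
      rewrite -(subrKA (v 0 i0)) (le_trans (ler_normD _ _))//.
      have h1 : `|w 0 i0 - v 0 i0| <= `|w - v|.
        by have := norm_mx_ge (w - v) 0 i0; rewrite !mxE.
      have h2 : `|v 0 i0 - a| <= `|v - p|.
        by have := norm_mx_ge (v - p) 0 i0; rewrite !mxE.
      by rewrite (le_trans (lerD (le_trans xs h1) h2))// -lerBrDr ltW.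
    by split; [apply: df; exact: le_lt_trans rdl|exact: fM].
  have h1 : `|w 0 i0 - v 0 i0| <= eps / (2 * M).
    by apply: le_trans (ltW wM); have := norm_mx_ge (w - v) 0 i0; rewrite !mxE.
  apply: le_trans (ler_wpM2l (ltW M0) h1) _.
  by rewrite mul_half// gt_eqF.
- pose h := upd w (v 0 i0) - v.
  have h0 : h 0 i0 = 0 by rewrite !mxE eqxx subrr.
  have hle : `|h| <= `|w - v|.
    apply: norm_mx_le => // i j; rewrite (ord1 i) /h !mxE.
    case: eqVneq => [->|_]; first by rewrite subrr normr0.
    by have := norm_mx_ge (w - v) 0 j; rewrite !mxE.
  have Ew : upd w (v 0 i0) = h + v by rewrite subrK.
  have := @line_increment (fun u => P f (h + u) - P f u) (fun u => f (h + u) - f u)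
     v a (v 0 i0) (eps / (2 * dl)).
  rewrite upd_self -upd_addr// !f0 subrr subr0 Ew => H.
  rewrite (le_trans (H _))//.
    move=> x /arng xr.
    have ur : `|upd v x - p| <= r by apply: upd_near => //; exact: ltW.
    have hur : `|h + upd v x - p| <= r.

      have -> : h + upd v x - p = upd w x - p.
        by rewrite -upd_addr// -Ew upd_upd.
      exact: upd_near.
    split.
      apply: is_deriveB; last by apply: df; exact: le_lt_trans rdl.
      by apply: is_derive_translate; apply: df; exact: le_lt_trans rdl.
    by apply: hd => //; rewrite addrK (le_lt_trans hle).
  apply: le_trans (ler_wpM2l (ltW e1) (ltW (cube_coord i0 Wv))) _.
  by rewrite mulrC mul_half// gt_eqF.
Qed.

(** Differentiation under the integral sign: the remainder [P f (h' + u) - P f u - h * P (pd j f) u]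
    vanishes on the slice, and its derivative along [i0] is the first-order remainder of [f] in
    direction [j], which is uniformly small. *)
Lemma prim_derive_other f v j : ck 1 W f -> W v -> j != i0 ->
  is_derive v (e_ j) (P f) (P (pd j f) v).
Proof.
move=> cf Wv ji0.
have [df f0] := HP (ckW cf); have [dpf pf0] := HP (ck_pd j cf).
have [r [vr rdl]] := cube_between Wv.
have fc w : `|w - p| <= r -> {for w, continuous (pd j f)}.
  by move=> wr; apply: (ck_continuous (ck_pd j cf)); exact: le_lt_trans rdl.
apply: is_derive_eps => eps e0.
have e1 : 0 < eps / dl by rewrite divr_gt0.
have [d d0 hd] := uniform_continuity fc e1.
have rd0 : 0 < dl - r by rewrite subr_gt0.
exists (Num.min d (dl - r)); first by rewrite lt_min d0.
move=> h; rewrite lt_min => /andP[hd1 hd2].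
pose h' : 'rV[R]_n := h *: e_ j.
have h'0 : h' 0 i0 = 0 by rewrite !mxE eqxx eq_sym (negbTE ji0) mulr0.
have inW u t : `|u - p| <= r -> `|t| <= `|h| -> W (t *: e_ j + u).
  move=> ur th; rewrite /cube/= -addrA (le_lt_trans (ler_normD _ _))//.
  rewrite normrZ -(subrK r dl) ltr_leD//.
  apply: le_lt_trans hd2; rewrite -[leRHS]mulr1 ler_pM//.
  exact: norm_delta_le1.
have := @line_increment (fun u => P f (h' + u) - P f u - h * P (pd j f) u)
   (fun u => f (h' + u) - f u - h * pd j f u) v a (v 0 i0) (eps / dl * `|h|).
rewrite upd_self -upd_addr// !f0 pf0 mulr0 !subrr subr0 => H.
rewrite (le_trans (H _))//.
  move=> x xa.
  have ur : `|upd v x - p| <= r.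
    apply: upd_near => //; first exact: ltW.
    rewrite (le_trans xa)// (le_trans _ (ltW vr))//.
    by have := norm_mx_ge (v - p) 0 i0; rewrite !mxE.
  have Wu : W (upd v x) by exact: le_lt_trans rdl.
  have Whu : W (h' + upd v x) by apply: inW.
  split.
    apply: is_deriveB; last by apply: is_deriveZ; exact: dpf.
    by apply: is_deriveB; [apply: is_derive_translate; exact: df|exact: df].
  have [s sh ->] := @MVT_line _ _ f (upd v x) (e_ j) h
     (fun s sh => ck_derivable (i := j) cf (inW _ _ ur sh)).
  rewrite [_ * h]mulrC -mulrBr normrM mulrC ler_wpM2r// hd// addrK.
  rewrite normrZ; apply: le_lt_trans hd1; rewrite -[leRHS]mulr1 ler_pM//.
  exact: norm_delta_le1.
rewrite mulrAC ler_wpM2r//.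
apply: le_trans (ler_wpM2l (ltW e1) (ltW (cube_coord i0 Wv))) _.
by rewrite divfK// gt_eqF.
Qed.

Lemma pd_prim_i0 f v : ck 0 W f -> W v -> pd i0 (P f) v = f v.
Proof. by move=> cf Wv; have [df _] := HP cf; have [] := df _ Wv. Qed.

Lemma pd_prim_other f v j : ck 1 W f -> W v -> j != i0 ->
  pd j (P f) v = P (pd j f) v.
Proof. by move=> cf Wv ji; have [] := prim_derive_other cf Wv ji. Qed.

Lemma ck0W k f : ck k W f -> ck 0 W f.
Proof. by elim: k => // k IH /ckW. Qed.

Lemma ck_prim k f : ck k W f -> ck k W (P f).
Proof.
elim: k f => [|k IH] f cf; first by apply: ck0I => v; exact: prim_continuous.
have c0 := ck0W cf.
have c1 : ck 1 W f.
  by elim: k cf {IH} => // k IH /ckW /IH.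
apply: ckSI => [v|i v Wv|i].
- exact: prim_continuous.
- have [->|ii0] := eqVneq i i0.
    by have [df _] := HP c0; have [h _] := df _ Wv; exact: h.
  by have [h _] := prim_derive_other c1 Wv ii0; exact: h.
- have [->|ii0] := eqVneq i i0.
    apply: (ck_ext (@open_cube _ _ _ _) (f := f)); last exact: ckW.
    by move=> w Ww; rewrite pd_prim_i0.
  apply: (ck_ext (@open_cube _ _ _ _) (f := P (pd i f))); last exact/IH/ck_pd.
  by move=> w Ww; rewrite pd_prim_other.
Qed.

End PrimitiveOperator.

(** * Calculus of smooth functions and of their iterated derivatives *)

Section IterPd.
Variables (R : realType) (n : nat) (W : set 'rV[R]_n).
Hypothesis oW : open W.
Implicit Types f g : 'rV[R]_n -> R.

Lemma smooth_on_iter_pd s f : smooth_on W f -> smooth_on W (iter_pd s f).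
Proof. elim: s => [|i s IH] h; [exact: h|exact: (smooth_on_pd i (IH h))]. Qed.

Lemma iter_pd_ext s f g v : (forall w, W w -> f w = g w) -> W v ->
  iter_pd s f v = iter_pd s g v.
Proof.
move=> fg; elim: s v => [|i s IH] v Wv /=; first exact: fg.
by apply: (pd_ext _ oW).
Qed.

Lemma smoothM f g : smooth_on W f -> smooth_on W g -> smooth_on W (fun v => f v * g v).
Proof. by move=> /smooth_onP cf /smooth_onP cg; apply/smooth_onP => k; exact: ckM. Qed.

Lemma smoothD f g : smooth_on W f -> smooth_on W g -> smooth_on W (fun v => f v + g v).
Proof. by move=> /smooth_onP cf /smooth_onP cg; apply/smooth_onP => k; exact: ckD. Qed.

Lemma smoothB f g : smooth_on W f -> smooth_on W g -> smooth_on W (fun v => f v - g v).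
Proof. by move=> /smooth_onP cf /smooth_onP cg; apply/smooth_onP => k; exact: ckB. Qed.

Lemma smoothN f : smooth_on W f -> smooth_on W (fun v => - f v).
Proof. by move=> /smooth_onP cf; apply/smooth_onP => k; exact: ckN. Qed.

Lemma smooth_cst c : smooth_on W (fun=> c).
Proof. by apply/smooth_onP => k; exact: ck_cst. Qed.

Lemma smooth_coord j : smooth_on W (fun v => v 0 j).
Proof. by apply/smooth_onP => k; exact: ck_coord. Qed.

Lemma smooth_sum (I : Type) (r : seq I) (P : pred I) (F : I -> 'rV[R]_n -> R) :
  (forall i, P i -> smooth_on W (F i)) ->
  smooth_on W (fun w => \sum_(i <- r | P i) F i w).
Proof.
move=> sF; apply/smooth_onP => k; apply: ck_sum => // i Pi.
by have /smooth_onP := sF i Pi.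
Qed.

Lemma smooth_expR f : smooth_on W f -> smooth_on W (fun v => expR (f v)).
Proof. by move=> /smooth_onP cf; apply/smooth_onP => k; exact: ck_expR. Qed.

Lemma smooth_comp m (U : set 'rV[R]_m) (f : 'rV[R]_m -> R) (P : 'rV[R]_n -> 'rV[R]_m) :
  open U -> (forall v, W v -> U (P v)) ->
  (forall j, smooth_on W (entry P 0 j)) -> smooth_on U f -> smooth_on W (f \o P).
Proof.
move=> oU WU sP /smooth_onP cf; apply/smooth_onP => k.
by apply: (ck_comp oW oU WU) (cf k) => j; have /smooth_onP := sP j.
Qed.

Lemma smooth_invmx m (A : 'rV[R]_n -> 'M[R]_m) :
  (forall v, W v -> A v \in unitmx) -> smooth_mx_on W A ->
  forall i j, smooth_on W (fun w => invmx (A w) i j).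
Proof.
move=> uA sA i j; apply/smooth_onP => k; apply: ck_invmx => // a b.
by have /smooth_onP := sA a b.
Qed.

Lemma smooth_derivable f v i : smooth_on W f -> W v -> derivable f v (delta_mx 0 i).
Proof. exact: smooth_on_derivable. Qed.

Lemma smooth_pd_comm f v i j : smooth_on W f -> W v ->
  pd i (pd j f) v = pd j (pd i f) v.
Proof. by move=> /smooth_onP cf; exact: (pd_comm _ _ oW (cf 2%N)). Qed.

Lemma pd_sum (I : Type) (r : seq I) (P : pred I) (F : I -> 'rV[R]_n -> R) i v :
  W v -> (forall l, P l -> smooth_on W (F l)) ->
  pd i (fun w => \sum_(l <- r | P l) F l w) v = \sum_(l <- r | P l) pd i (F l) v.
Proof.
move=> Wv sF; elim: r => [|a r IH].
  rewrite big_nil (_ : (fun w => _) = fun=> 0) ?pd_cst//.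
  by apply/funext => w; rewrite big_nil.
rewrite big_cons; case: (boolP (P a)) => Pa.
  rewrite -IH -pdD.
  - by congr (pd i _ v); apply/funext => w; rewrite big_cons Pa.
  - exact: smooth_derivable (sF _ Pa) Wv.
  - exact: smooth_derivable (smooth_sum _ sF) Wv.
rewrite -IH; congr (pd i _ v); apply/funext => w; by rewrite big_cons (negbTE Pa).
Qed.

Lemma iter_pdD s f g v : smooth_on W f -> smooth_on W g -> W v ->
  iter_pd s (fun w => f w + g w) v = iter_pd s f v + iter_pd s g v.
Proof.
move=> sf sg; elim: s v => [|i s IH] v Wv //=.
rewrite (pd_ext _ oW IH Wv) pdD//.
- exact: smooth_derivable (smooth_on_iter_pd _ sf) Wv.
- exact: smooth_derivable (smooth_on_iter_pd _ sg) Wv.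
Qed.

Lemma iter_pd_cst s (c : R) : exists c' : R,
  iter_pd s ((fun=> c) : 'rV[R]_n -> R) = (fun=> c').
Proof.
elim: s c => [|i s IH] c /=; first by exists c.
have [c' ->] := IH c; exists 0; apply/funext => v; exact: pd_cst.
Qed.

Lemma iter_pd_sum s (I : Type) (r : seq I) (P : pred I) (F : I -> 'rV[R]_n -> R) v :
  W v -> (forall l, P l -> smooth_on W (F l)) ->
  iter_pd s (fun w => \sum_(l <- r | P l) F l w) v = \sum_(l <- r | P l) iter_pd s (F l) v.
Proof.
move=> + sF; elim: s v => [|i s IH] v Wv //=.
rewrite (pd_ext _ oW IH Wv) pd_sum// => l Pl.
exact/smooth_on_iter_pd/sF.
Qed.

Lemma pd_comp_smooth m (U : set 'rV[R]_m) (f : 'rV[R]_m -> R) (P : 'rV[R]_n -> 'rV[R]_m) v i :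
  open U -> (forall v, W v -> U (P v)) ->
  (forall j, smooth_on W (entry P 0 j)) -> smooth_on U f -> W v ->
  pd i (f \o P) v = \sum_j pd j f (P v) * pd i (entry P 0 j) v.
Proof.
move=> oU WU sP sf Wv.
have [] := @pd_comp _ _ _ f P v i => //.
- by have /smooth_onP/(_ 1%N) := sf; move=> /ck1_differentiable; apply => //; exact: WU.
- by move=> j; exact: smooth_derivable (sP j) Wv.
Qed.

End IterPd.

(** * Sequences that are uniformly Cauchy together with their derivatives *)

Section UniformlyCauchy.
Variables (R : realType) (n : nat) (W : set 'rV[R]_n).
Hypothesis oW : open W.
Implicit Types F G : nat -> 'rV[R]_n -> R.

Definition ubounded F := exists M : R, forall k v, W v -> `|F k v| <= M.

Definition ucauchy F := forall eps : R, 0 < eps -> exists N, forall k l,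
  (N <= k)%N -> (N <= l)%N -> forall v, W v -> `|F k v - F l v| <= eps.

(** Boundedness accompanies the Cauchy property because products of uniformly Cauchy sequences are
    uniformly Cauchy only under uniform bounds. *)
Definition ucb F := ubounded F /\ ucauchy F.

Lemma ucb_ext F G : (forall k v, W v -> F k v = G k v) -> ucb F -> ucb G.
Proof.
move=> FG [[M hM] h]; split; first by exists M => k v Wv; rewrite -FG// hM.
move=> e /h[N hN]; exists N => k l Nk Nl v Wv; rewrite -!FG//; exact: hN.
Qed.

Lemma ucbD F G : ucb F -> ucb G -> ucb (fun k v => F k v + G k v).
Proof.
move=> [[M hM] hF] [[M' hM'] hG]; split.
  exists (M + M') => k v Wv; rewrite (le_trans (ler_normD _ _))// lerD//.
  - exact: hM.
  - exact: hM'.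
move=> e e0; have e20 : 0 < e / 2 by rewrite divr_gt0.
have [N hN] := hF _ e20; have [N' hN'] := hG _ e20.
exists (maxn N N') => k l; rewrite !geq_max => /andP[k1 k2] /andP[l1 l2] v Wv.
rewrite opprD addrACA (le_trans (ler_normD _ _))// (splitr e) lerD//.
- exact: hN.
- exact: hN'.
Qed.

Lemma ucbM F G : ucb F -> ucb G -> ucb (fun k v => F k v * G k v).
Proof.
move=> [[M hM] hF] [[M' hM'] hG]; split.
  exists (M * M') => k v Wv; rewrite normrM ler_pM//.
  - exact: hM.
  - exact: hM'.
move=> e e0.
pose C := Num.max 1 (Num.max M M').
have C0 : 0 < C by rewrite lt_max ltr01.
have FC k v : W v -> `|F k v| <= C.
  by move=> /(hM k) h; rewrite !le_max h orbT.
have GC k v : W v -> `|G k v| <= C.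
  by move=> /(hM' k) h; rewrite !le_max h !orbT.
have e20 : 0 < e / (2 * C) by rewrite divr_gt0// mulr_gt0.
have [N hN] := hF _ e20; have [N' hN'] := hG _ e20.
exists (maxn N N') => k l; rewrite !geq_max => /andP[k1 k2] /andP[l1 l2] v Wv.
have -> : F k v * G k v - F l v * G l v =
   F k v * (G k v - G l v) + G l v * (F k v - F l v).
  by move: (F k v) (G k v) (F l v) (G l v) => x1 x2 x3 x4; ring.
rewrite (le_trans (ler_normD _ _))// (splitr e) -(@mul_half _ C e) ?gt_eqF// !normrM.
rewrite lerD// ler_pM//.
- exact: FC.
- exact: hN'.
- exact: GC.
- exact: hN.
Qed.

Lemma ucb_cst (f : 'rV[R]_n -> R) M : (forall v, W v -> `|f v| <= M) -> ucb (fun=> f).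
Proof.
move=> fM; split; first by exists M => _.
by move=> e e0; exists 0%N => k l _ _ v Wv; rewrite subrr normr0 ltW.
Qed.

Lemma ucb_sum (I : Type) (r : seq I) (P : pred I) (F : I -> nat -> 'rV[R]_n -> R) :
  (forall i, P i -> ucb (F i)) -> ucb (fun k v => \sum_(i <- r | P i) F i k v).
Proof.
move=> uF; elim: r => [|a r IH].
  apply: (ucb_ext (F := fun _ => fun=> 0)); first by move=> k v _; rewrite big_nil.
  by apply: (@ucb_cst _ 0) => v _; rewrite normr0.
apply: (ucb_ext (F := fun k v => (if P a then F a k v else 0) + \sum_(i <- r | P i) F i k v)).
  by move=> k v _; rewrite big_cons; case: (P a); rewrite ?add0r.
apply: ucbD => //; case Pa: (P a); first exact: uF.
by apply: (@ucb_cst _ 0) => v _; rewrite normr0.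
Qed.

Lemma ucb_shift F M : (forall v, W v -> `|F 0%N v| <= M) ->
  ucb (fun k => F k.+1) -> ucb F.
Proof.
move=> FM [[M' hM'] h]; split.
  exists (Num.max M M') => -[|k] v Wv; rewrite le_max ?FM//.
  by rewrite (hM' k v Wv) orbT.
move=> e /h[N hN]; exists N.+1 => -[//|k] [//|l] kN lN v Wv; exact: hN.
Qed.

(** Cauchy sequences for the C^m norm on [W], given by the same recursion as [ck]. *)
Fixpoint good (m : nat) F : Prop :=
  ucb F /\ match m with
           | 0 => True
           | m'.+1 => forall i, good m' (fun k => pd i (F k))
           end.

Definition allsmooth F := forall k, smooth_on W (F k).

Lemma good_ucb m F : good m F -> ucb F.
Proof. by case: m => [|m] []. Qed.

Lemma good_ext m F G : (forall k v, W v -> F k v = G k v) -> good m F -> good m G.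
Proof.
elim: m F G => [|m IH] F G FG [uF gF]; split=> //; try exact: (ucb_ext FG).
move=> i; apply: IH (gF i) => k v Wv; exact: (pd_ext _ oW (FG k)).
Qed.

Lemma goodW m F : good m.+1 F -> good m F.
Proof.
elim: m F => [|m IH] F [uF gF]; split=> // i.
by apply: IH; exact: gF.
Qed.

Lemma good_le m m' F : (m' <= m)%N -> good m F -> good m' F.
Proof.
move=> /subnK <-; elim: (m - m')%N => // k IH; rewrite addSn => /goodW; exact: IH.
Qed.

Lemma goodD m F G : allsmooth F -> allsmooth G -> good m F -> good m G ->
  good m (fun k v => F k v + G k v).
Proof.
elim: m F G => [|m IH] F G sF sG gF gG; split=> //.
- by apply: ucbD; [case: gF|case: gG].
- by apply: ucbD; [case: gF|case: gG].
move=> i; apply: (good_ext (F := fun k v => pd i (F k) v + pd i (G k) v)).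
  by move=> k v Wv; rewrite pdD//; [exact: smooth_derivable (sF k) Wv|exact: smooth_derivable (sG k) Wv].
apply: IH.
- by move=> k; apply: smooth_on_pd; exact: sF.
- by move=> k; apply: smooth_on_pd; exact: sG.
- by case: gF => _ h; exact: h.
- by case: gG => _ h; exact: h.
Qed.

Lemma goodM m F G : allsmooth F -> allsmooth G -> good m F -> good m G ->
  good m (fun k v => F k v * G k v).
Proof.
elim: m F G => [|m IH] F G sF sG gF gG; split=> //.
- by apply: ucbM; [case: gF|case: gG].
- by apply: ucbM; [case: gF|case: gG].
have sdF i : allsmooth (fun k => pd i (F k)) by move=> k; apply: smooth_on_pd; exact: sF.
have sdG i : allsmooth (fun k => pd i (G k)) by move=> k; apply: smooth_on_pd; exact: sG.
move=> i; apply: (good_ext (F := fun k v => pd i (F k) v * G k v + F k v * pd i (G k) v)).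
  by move=> k v Wv; rewrite pdM//; [exact: smooth_derivable (sF k) Wv|exact: smooth_derivable (sG k) Wv].
apply: goodD.
- by move=> k; exact: (smoothM oW (sdF i k) (sG k)).
- by move=> k; exact: (smoothM oW (sF k) (sdG i k)).
- by apply: (IH _ _ (sdF i) sG _ (goodW gG)); case: gF => _ h; exact: h.
- by apply: (IH _ _ sF (sdG i) (goodW gF)); case: gG => _ h; exact: h.
Qed.

Lemma good_cst0 m : good m (fun _ _ => 0).
Proof.
have u : ucb (fun _ _ => 0) by apply: (@ucb_cst _ 0) => v _; rewrite normr0.
elim: m => [|m IH]; split=> // i.
by apply: good_ext IH => k v _; rewrite pd_cst.
Qed.

Lemma good_sum m (I : Type) (r : seq I) (P : pred I) (F : I -> nat -> 'rV[R]_n -> R) :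
  (forall i, P i -> allsmooth (F i)) -> (forall i, P i -> good m (F i)) ->
  good m (fun k v => \sum_(i <- r | P i) F i k v).
Proof.
move=> sF uF; elim: r => [|a r IH].
  by apply: good_ext (good_cst0 m) => k v _; rewrite big_nil.
case: (boolP (P a)) => Pa; last first.
  by apply: good_ext IH => k v _; rewrite big_cons (negbTE Pa).
apply: (good_ext (F := fun k v => F a k v + \sum_(i <- r | P i) F i k v)).
  by move=> k v _; rewrite big_cons Pa.
apply: goodD => //; [exact: sF| |exact: uF].
by move=> k; apply: smooth_sum => // i Pi; exact: sF.
Qed.

Lemma good_iter m s F : good m F -> (size s <= m)%N -> ucb (fun k => iter_pd s (F k)).
Proof.
elim/last_ind: s m F => [|s i IH] m F gF; first by move=> _; exact: good_ucb gF.
case: m gF => [//|m] gF; first by rewrite size_rcons.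
rewrite size_rcons ltnS => sm.
apply: (ucb_ext (F := fun k => iter_pd s (pd i (F k)))).
  by move=> k v _; rewrite iter_pd_rcons.
case: gF => _ /(_ i) h; exact: (IH m _ h sm).
Qed.

Lemma iter_good m F : (forall s, (size s <= m)%N -> ucb (fun k => iter_pd s (F k))) ->
  good m F.
Proof.
elim: m F => [|m IH] F H; split=> //; try exact: (H [::]).
move=> i; apply: IH => s sm.
apply: (ucb_ext (F := fun k => iter_pd (rcons s i) (F k))).
  by move=> k v _; rewrite iter_pd_rcons.
by apply: H; rewrite size_rcons.
Qed.

(* Only b itself is differentiated to the top order in the difference, so that
   one derivative less of b has to be controlled. *)
Lemma ucb_commutator s a b : allsmooth a -> allsmooth b ->
  good (size s) a -> (forall m, (m < size s)%N -> good m b) ->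
  ucb (fun k v => iter_pd s (fun w => a k w * b k w) v - a k v * iter_pd s (b k) v).
Proof.
elim/last_ind: s a b => [|s i IH] a b sa sb.
  move=> _ _; apply: (ucb_ext (F := fun _ => fun=> 0)).
    by move=> k v _ /=; rewrite subrr.
  by apply: (@ucb_cst _ 0) => v _; rewrite normr0.
rewrite size_rcons => ga gb.
have sda : allsmooth (fun k => pd i (a k)) by move=> k; apply: smooth_on_pd; exact: sa.
have sdb : allsmooth (fun k => pd i (b k)) by move=> k; apply: smooth_on_pd; exact: sb.
apply: (ucb_ext (F := fun k v => iter_pd s (fun w => pd i (a k) w * b k w) v +
  (iter_pd s (fun w => a k w * pd i (b k) w) v - a k v * iter_pd s (pd i (b k)) v))).
  move=> k v Wv; rewrite !iter_pd_rcons addrA -(iter_pdD oW)//.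
  - congr (_ - _); apply: iter_pd_ext Wv => // w Ww.
    by rewrite pdM//; [exact: smooth_derivable (sa k) Ww|exact: smooth_derivable (sb k) Ww].
  - exact: (smoothM oW (sda k) (sb k)).
  - exact: (smoothM oW (sa k) (sdb k)).
apply: ucbD.
  have gda : good (size s) (fun k => pd i (a k)) by case: ga => _ /(_ i).
  exact: (good_iter (goodM sda sb gda (gb _ (ltnSn _))) (leqnn _)).
apply: (IH a _ sa sdb (goodW ga)) => m ms.
by have [_ /(_ i)] : good m.+1 b := gb m.+1 ms.
Qed.

End UniformlyCauchy.

(** * Smoothness of uniform limits *)

Section UniformLimit.
Variables (R : realType) (n : nat) (W : set 'rV[R]_n).
Hypothesis oW : open W.
Implicit Types (F G : nat -> 'rV[R]_n -> R) (f g : 'rV[R]_n -> R).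
Local Notation e_ i := (delta_mx 0 i : 'rV[R]_n).

Definition uconv F f := forall eps : R, 0 < eps -> exists N, forall k,
  (N <= k)%N -> forall v, W v -> `|F k v - f v| <= eps.

Lemma ucauchy_uconv F : ucauchy W F -> exists f, uconv F f.
Proof.
move=> cF; exists (fun v => lim (F k v @[k --> \oo])) => eps e0.
have [N hN] := cF _ e0; exists N => k Nk v Wv.
have cv : cvgn (fun k => F k v).
  apply/cauchy_cvgP; apply: cauchy_exP => e e0'.
  have e20 : 0 < e / 2 by rewrite divr_gt0.
  have [M hM] := cF _ e20.
  exists (F M v); exists M => // m /= Mm; rewrite -ball_normE /=.
  apply: le_lt_trans (hM _ _ (leqnn _) Mm _ Wv) _.
  by rewrite ltr_pdivrMr// mulr_natr mulr2n ltrDl.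
have h : (fun l => `|F k v - F l v|) @ \oo --> `|F k v - lim (F k v @[k --> \oo])|.
  by apply: cvg_norm; apply: cvgB; [exact: cvg_cst|exact: cv].
apply: (cvgr_to_le h); exists N => // l /= Nl; exact: hN.
Qed.

Lemma uconv_continuous F f v : (forall k, ck 0 W (F k)) -> uconv F f -> W v ->
  {for v, continuous f}.
Proof.
move=> cF uF Wv.
have FF : Filter (nbhs v) by exact: nbhs_filter.
apply/(@cvgrPdist_le _ _ _ (nbhs v) FF) => eps e0.
have e3 : 0 < eps / 3 by rewrite divr_gt0.
have [N /(_ N (leqnn _)) hN] := uF _ e3.
have h1 : \forall w \near v, `|F N v - F N w| <= eps / 3.
  by have /(@cvgrPdist_le _ _ _ (nbhs v) FF)/(_ _ e3) := ck_continuous (cF N) Wv.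
have h2 : \forall w \near v, W w by exact: open_nbhs_nbhs.
apply: filterS2 h1 h2 => w hw Ww.
have := hN _ Wv; have := hN _ Ww.
move: (F N v) (F N w) (f v) (f w) hw => a b c d h h' h''.
have -> : c - d = - (a - c) + (a - b) + (b - d) by ring.
rewrite (le_trans (ler_normD _ _))// (le_trans (lerD (ler_normD _ _) h'))// normrN.
clear -h h''; lra.
Qed.

Lemma uconv_derive F f f' i v : (forall k, ck 1 W (F k)) -> uconv F f ->
  uconv (fun k => pd i (F k)) f' -> W v -> is_derive v (e_ i) f (f' v).
Proof.
move=> cF uF uF' Wv; apply: is_derive_eps => eps e0.
have e1 : 0 < eps / 4 by rewrite divr_gt0.
have [d0 d00 dW] := open_cube_subset oW Wv.
have [N hN] := uF' _ e1.
have [d1 d10 hd1] := ck1_near oW (cF N) Wv e1.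
exists (Num.min d0 d1); first by rewrite lt_min d00.
move=> h; rewrite lt_min => /andP[hd0 hd1'].
have near_s s : `|s| <= `|h| -> `|s *: e_ i + v - v| <= `|h|.
  move=> sh; rewrite addrK normrZ -[leRHS]mulr1 ler_pM//; exact: norm_delta_le1.
have inW s : `|s| <= `|h| -> W (s *: e_ i + v).
  by move=> sh; apply: dW; rewrite /cube/=; exact: le_lt_trans (near_s _ sh) hd0.
have Whv : W (h *: e_ i + v) by exact: inW.
pose D k := F k (h *: e_ i + v) - F k v.
(* The mean value theorem for [F N - F l] compares the increments uniformly in [l]; letting [l] grow
   yields [Dlim], where [F l] is replaced by the limit. *)
have DD l : (N <= l)%N -> `|D N - D l| <= eps / 2 * `|h|.
  move=> Nl.
  have [s sh E] := @MVT_line _ _ (fun w => F N w - F l w) v (e_ i) h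
    (fun s sh => derivableB (ck_derivable (i := i) (cF N) (inW s sh))
                            (ck_derivable (i := i) (cF l) (inW s sh))).
  have -> : D N - D l = (F N (h *: e_ i + v) - F l (h *: e_ i + v)) - (F N v - F l v).
    rewrite /D; move: (F N _) (F l _) (F N v) (F l v) => x1 x2 x3 x4; ring.
  rewrite E normrM ler_wpM2r//.
  have -> : 'D_(e_ i) (fun w => F N w - F l w) (s *: e_ i + v) =
     pd i (F N) (s *: e_ i + v) - pd i (F l) (s *: e_ i + v).
    exact: (pdB (ck_derivable (cF N) (inW s sh)) (ck_derivable (cF l) (inW s sh))).
  have := hN _ (leqnn N) _ (inW _ sh); have := hN _ Nl _ (inW _ sh).
  move: (pd i (F N) _) (pd i (F l) _) (f' _) => x1 x2 x3 g1 g2.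
  have -> : x1 - x2 = (x1 - x3) - (x2 - x3) by ring.
  rewrite (le_trans (ler_normB _ _))//; clear -g1 g2; lra.
have Dlim : `|D N - (f (h *: e_ i + v) - f v)| <= eps / 2 * `|h|.
  apply/ler_addgt0Pr => e e0'.
  have e20 : 0 < e / 2 by rewrite divr_gt0.
  have [M hM] := uF _ e20.
  have h1 := hM (maxn N M) (leq_maxr _ _) _ Whv.
  have h2 := hM (maxn N M) (leq_maxr _ _) _ Wv.
  have h3 := DD (maxn N M) (leq_maxl _ _).
  have -> : D N - (f (h *: e_ i + v) - f v) = (D N - D (maxn N M)) +
     (F (maxn N M) (h *: e_ i + v) - f (h *: e_ i + v)) - (F (maxn N M) v - f v).
    rewrite /D; move: (F _ _) (F _ v) (F N _) (F N v) (f _) (f v) => x1 x2 x3 x4 x5 x6; ring.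
  rewrite (le_trans (ler_normB _ _))// (le_trans (lerD (ler_normD _ _) h2))//.
  by apply: le_trans (lerD (lerD h3 h1) (lexx _)) _; rewrite -addrA -splitr.
have [s sh E] := @MVT_line _ _ (F N) v (e_ i) h
    (fun s sh => ck_derivable (i := i) (cF N) (inW s sh)).
have hs : `|pd i (F N) (s *: e_ i + v) - pd i (F N) v| <= eps / 4.
  have [|_ /(_ i)[]//] := hd1 (s *: e_ i + v).
  exact: le_lt_trans (near_s _ sh) hd1'.
have hv := hN _ (leqnn N) _ Wv.
have -> : f (h *: e_ i + v) - f v - h * f' v = - (D N - (f (h *: e_ i + v) - f v))
  + (pd i (F N) (s *: e_ i + v) - pd i (F N) v) * h + (pd i (F N) v - f' v) * h.
  have -> : D N = pd i (F N) (s *: e_ i + v) * h by exact: E.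
  move: (pd i (F N) _) (pd i (F N) v) (f _) (f v) (f' v) => x1 x2 x3 x4 x5; ring.
rewrite (le_trans (ler_normD _ _))// (le_trans (lerD (ler_normD _ _) (lexx _)))//.
rewrite normrN !normrM.
have -> : eps * `|h| = eps / 2 * `|h| + eps / 4 * `|h| + eps / 4 * `|h|.
  by move: `|h| => x; field.
by rewrite !lerD// ler_wpM2r.
Qed.

(** The limits [lf s] of the derivatives along words [s] are chosen separately; [dlf] then
    identifies [lf (i :: s)] as the [i]-th derivative of [lf s], so that all of them are derivatives
    of [lf [::]]. *)
Lemma good_limit F : allsmooth W F -> (forall m, good W m F) ->
  exists f, smooth_on W f /\ forall s, uconv (fun k => iter_pd s (F k)) (iter_pd s f).
Proof.
move=> sF gF.
have ex s : exists f, uconv (fun k => iter_pd s (F k)) f.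
  by apply: ucauchy_uconv; have [] := good_iter (gF (size s)) (leqnn _).
have [lf hlf] := choice ex.
have sFs s k : smooth_on W (iter_pd s (F k)) := smooth_on_iter_pd s (sF k).
have dlf s i v : W v -> is_derive v (e_ i) (lf s) (lf (i :: s) v).
  move=> Wv; apply: uconv_derive (hlf s) (hlf (i :: s)) Wv => k.
  by have /smooth_onP := sFs s k.
have clf s k : ck k W (lf s).
  have c0 s' v : W v -> {for v, continuous (lf s')}.
    move=> Wv; apply: uconv_continuous (hlf s') Wv => l.
    by have /smooth_onP := sFs s' l.
  elim: k s => [|k IH] s; first by apply: ck0I => v; exact: c0.
  apply: ckSI => [v|i v Wv|i]; first exact: c0.
    by have [h _] := dlf s i v Wv; exact: h.
  apply: (ck_ext oW (f := lf (i :: s))) => [w Ww|]; last exact: IH.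
  by have [_] := dlf s i w Ww.
have E s v : W v -> iter_pd s (lf [::]) v = lf s v.
  elim: s v => [//|i s IH] v Wv /=.
  rewrite (pd_ext i oW IH Wv).
  by have [_] := dlf s i v Wv.
exists (lf [::]); split; first by apply/smooth_onP => k; exact: clf.
move=> s eps e0; have [N hN] := hlf s _ e0.
by exists N => k Nk v Wv; rewrite E//; exact: hN.
Qed.

End UniformLimit.

(** * Composition of a smooth function with a convergent sequence of maps *)

Section GoodComposition.
Variables (R : realType) (n m : nat) (W : set 'rV[R]_n) (V : set 'rV[R]_m).
Variables (p : 'rV[R]_m) (r : R) (phi : nat -> 'rV[R]_n -> 'rV[R]_m).
Hypotheses (oW : open W) (oV : open V).
Hypothesis KV : forall v, `|v - p| <= r -> V v.
Hypothesis phiK : forall k v, W v -> `|phi k v - p| <= r.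
Hypothesis sphi : forall j, allsmooth W (fun k => entry (phi k) 0 j).

Let WV k v : W v -> V (phi k v).
Proof. by move=> Wv; exact/KV/phiK. Qed.

Lemma ucauchy_common (I : finType) (F : I -> nat -> 'rV[R]_n -> R) (eps : R) :
  (forall j, ucauchy W (F j)) -> 0 < eps -> exists N, forall j k l,
  (N <= k)%N -> (N <= l)%N -> forall v, W v -> `|F j k v - F j l v| <= eps.
Proof.
move=> cF e0; have /choice[N hN] : forall j, exists N, forall k l,
  (N <= k)%N -> (N <= l)%N -> forall v, W v -> `|F j k v - F j l v| <= eps.
  by move=> j; exact: cF.
exists (\max_j N j) => j k l Nk Nl; apply: hN.
  exact: leq_trans (leq_bigmax j) Nk.
exact: leq_trans (leq_bigmax j) Nl.
Qed.

(** All maps take values in one closed cube inside [V], on which [H] is bounded and uniformly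
    continuous. *)
Lemma ucb_comp (H : 'rV[R]_m -> R) : smooth_on V H ->
  (forall j, ucauchy W (fun k => entry (phi k) 0 j)) ->
  ucb W (fun k => H \o phi k).
Proof.
move=> sH cphi.
have Hc v : `|v - p| <= r -> {for v, continuous H}.
  by move=> /KV Vv; exact: smooth_on_continuous sH Vv.
split.
  have [M M0 hM] := compact_bounded_fun Hc.
  by exists M => k v Wv; apply/hM/phiK.
move=> eps e0; have [d d0 hd] := uniform_continuity Hc e0.
have d20 : 0 < d / 2 by rewrite divr_gt0.
have [N hN] := ucauchy_common cphi d20.
exists N => k l Nk Nl v Wv; apply: hd; first exact: phiK.
apply: (@le_lt_trans _ _ (d / 2)).
  apply: norm_mx_le => [|i j]; first exact: ltW.
  by rewrite (ord1 i) !mxE; exact: hN.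
by rewrite ltr_pdivrMr// mulr_natr mulr2n ltrDl.
Qed.

Lemma allsmooth_comp (H : 'rV[R]_m -> R) : smooth_on V H -> allsmooth W (fun k => H \o phi k).
Proof.
move=> sH k; apply: (smooth_comp oW oV) => //.
- by move=> v Wv; exact/KV/phiK.
- by move=> j; exact: sphi.
Qed.

Lemma good_comp q (H : 'rV[R]_m -> R) : smooth_on V H ->
  (forall j, good W q (fun k => entry (phi k) 0 j)) ->
  good W q (fun k => H \o phi k).
Proof.
elim: q H => [|q IH] H sH gphi.
  by split=> //; apply: ucb_comp => // j; have [[]] := gphi j.
have gphi' j : good W q (fun k => entry (phi k) 0 j) by exact: goodW.
split; first by apply: ucb_comp => // j; have [[]] := gphi j.
move=> i; apply: (good_ext oW
  (F := fun k v => \sum_j (pd j H \o phi k) v * pd i (entry (phi k) 0 j) v)).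
  move=> k v Wv.
  by rewrite (@pd_comp_smooth _ _ W _ V H (phi k) v i oV (WV k) (fun j => sphi j k) sH Wv).
have sd j := smooth_on_pd j sH.
have sphid j : allsmooth W (fun k => pd i (entry (phi k) 0 j)).
  by move=> k; exact: (smooth_on_pd i (sphi j k)).
apply: good_sum => // j _.
  by move=> k; exact: (smoothM oW (allsmooth_comp (sd j) k) (sphid j k)).
apply: (goodM oW (allsmooth_comp (sd j)) (sphid j)); first exact: IH.
by have [_ /(_ i)] := gphi j.
Qed.

End GoodComposition.

(** * The contraction argument for integral recursions *)

Section Picard.
Variables (R : realType) (n : nat) (i0 : 'I_n) (p : 'rV[R]_n) (dl : R).
Hypothesis dl0 : 0 < dl.
Local Notation a := (p 0 i0).
Local Notation W := (cube p dl).
Variable P : ('rV[R]_n -> R) -> 'rV[R]_n -> R.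
Hypothesis HP : forall f, ck 0 W f ->
  (forall v, W v -> is_derive v (delta_mx 0 i0) (P f) (f v)) /\
  (forall v, P f (upd i0 v a) = 0).

(** The error has a part [C] and a floor [2 * dl * eta]. One iteration halves the first and
    reproduces the floor, because half of it plus the new error [dl * eta] is the floor again. *)
Lemma halving_bound (q C eta D D' : R) : 0 <= D -> dl * q <= 1 / 2 ->
  D = C + 2 * dl * eta -> D' = C / 2 + 2 * dl * eta ->
  dl * (q * D + eta) <= D'.
Proof.
move=> D0 dq DE D'E.
have h : dl * q * D <= D / 2.
  by rewrite [leRHS]mulrC; apply: ler_wpM2r => //; rewrite -div1r.
have -> : dl * (q * D + eta) = dl * q * D + dl * eta by ring.
rewrite D'E; apply: (le_trans (lerD h (lexx _))).
have -> : D / 2 + dl * eta = C / 2 + 2 * dl * eta by rewrite DE; field.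
exact: lexx.
Qed.

(** Covers both the iteration itself and its differentiated versions. The bound on [g] admits an
    error [eps] besides the Lipschitz term because, after differentiation, the coefficients of the
    recursion vary with [k] and are themselves merely Cauchy. *)
Lemma picard_ucauchy (I : finType) (y g : I -> nat -> 'rV[R]_n -> R)
    (c : I -> 'rV[R]_n -> R) (q C : R) :
  (forall j k v, W v -> y j k.+1 v = c j v + P (g j k) v) ->
  (forall j k, ck 0 W (g j k)) ->
  (forall j k v, W v -> `|y j k v| <= C) ->
  0 <= q -> dl * q <= 1 / 2 ->
  (forall eps, 0 < eps -> exists N, forall k l, (N <= k)%N -> (N <= l)%N ->
     forall D, 0 <= D -> (forall j v, W v -> `|y j k v - y j l v| <= D) ->
     forall j v, W v -> `|g j k v - g j l v| <= q * D + eps) ->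
  forall j, ucauchy W (y j).
Proof.
move=> yS cg yC q0 dq gL j eps e0.
have [Cneg|C0] := ltP C 0.
  exists 0%N => k l _ _ v Wv.
  by have := le_lt_trans (yC j k v Wv) Cneg; rewrite normr_lt0.
(* Chosen so that the floor [2 * dl * eta] of the error is half of [eps]. *)
pose eta := eps / (4 * dl).
have eta0 : 0 < eta by rewrite divr_gt0// mulr_gt0.
have [N hN] := gL _ eta0.
have detaE : 2 * dl * eta = eps / 2.
  by rewrite /eta; field; rewrite gt_eqF.
have key t : forall k l, (N + t <= k)%N -> (N + t <= l)%N -> forall j v, W v ->
    `|y j k v - y j l v| <= 2 * C / 2 ^+ t + 2 * dl * eta.
  elim: t => [|t IH] k l.
    move=> _ _ j' v Wv; rewrite expr0 divr1.
    apply: (@le_trans _ _ (2 * C)); last by rewrite lerDl detaE ltW// divr_gt0.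
    rewrite (le_trans (ler_normB _ _))// mulr2n mulrDl mul1r lerD//; exact: yC.
  case: k => [|k]; first by rewrite addnS.
  case: l => [|l]; first by rewrite addnS.
  rewrite addnS !ltnS => Nk Nl j' v Wv.
  have D0 : 0 <= 2 * C / 2 ^+ t + 2 * dl * eta.
    by rewrite addr_ge0// ?detaE ?divr_ge0 ?mulr_ge0 ?exprn_ge0// ltW.
  rewrite !yS// opprD addrACA subrr add0r.
  apply: le_trans (prim_dist (M := q * (2 * C / 2 ^+ t + 2 * dl * eta) + eta) dl0 HP _ _ _ Wv _) _.
  - exact: (addr_ge0 (mulr_ge0 q0 D0) (ltW eta0)).
  - exact: cg.
  - exact: cg.
  - move=> w Ww; apply: hN => //.
    + exact: leq_trans (leq_addr _ _) Nk.
    + exact: leq_trans (leq_addr _ _) Nl.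
    + by move=> j'' v' Wv'; exact: IH.
  - apply: (@halving_bound _ (2 * C / 2 ^+ t) _ _ _ D0 dq) => //.
    by rewrite exprSr invfM mulrA.
have [t ht] : exists t : nat, 2 * C / 2 ^+ t <= eps / 2.
  pose x := 4 * C / eps.
  exists (Num.bound x).
  have x0 : 0 <= x by rewrite divr_ge0 ?mulr_ge0// ltW.
  have := archi_boundP x0; set t := Num.bound x => xt.
  have t2 : (t%:R : R) <= 2 ^+ t.
    by rewrite -natrX ler_nat ltnW// ltn_expl.
  rewrite ler_pdivrMr ?exprn_gt0//.
  apply: (@le_trans _ _ (eps / 2 * x)).
    have -> : eps / 2 * x = 2 * C by rewrite /x; field; rewrite gt_eqF.
    exact: lexx.
  by rewrite ler_wpM2l ?divr_ge0 ?(ltW e0)// (le_trans (ltW xt)).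
exists (N + t)%N => k l Nk Nl v Wv.
apply: le_trans (key t k l Nk Nl j v Wv) _.
by rewrite detaE [leRHS]splitr lerD.
Qed.

End Picard.

Lemma row_subE (R : zmodType) n (x y : 'rV[R]_n) j : (x - y) 0 j = x 0 j - y 0 j.
Proof. by rewrite !mxE. Qed.

(** * The flow of a smooth vector field, jointly smooth in all variables *)

Section FlowBox.
Variables (R : realType) (n : nat) (i0 : 'I_n) (p : 'rV[R]_n) (dl r M A0 : R).
Variables (V : set 'rV[R]_n) (X : 'I_n -> 'rV[R]_n -> R).
Hypotheses (dl0 : 0 < dl) (M0 : 0 <= M) (A00 : 0 <= A0) (oV : open V).
Hypothesis sX : forall j, smooth_on V (X j).
Hypothesis KV3 : forall v : 'rV[R]_n, `|v - p| <= 3 * r -> V v.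
Hypothesis XM : forall j v, `|v - p| <= r -> `|X j v| <= M.
Hypothesis XA : forall j l v, `|v - p| <= 3 * r -> `|pd l (X j) v| <= A0.
Hypothesis dlr : dl * (1 + M) <= r.
Hypothesis dlq : dl * (n%:R * A0) <= 1 / 2.
Local Notation a := (p 0 i0).
Local Notation W := (cube p dl).
Variable P : ('rV[R]_n -> R) -> 'rV[R]_n -> R.
Hypothesis HP : forall f, ck 0 W f ->
  (forall v, W v -> is_derive v (delta_mx 0 i0) (P f) (f v)) /\
  (forall v, P f (upd i0 v a) = 0).

Let oW : open W. Proof. exact: open_cube. Qed.

Let r0 : 0 <= r.
Proof. by apply: le_trans dlr; rewrite mulr_ge0 ?addr_ge0// ltW. Qed.

Let KV v : `|v - p| <= r -> V v.
Proof.
move=> vr; apply: KV3; apply: (le_trans vr); rewrite ler_peMl//.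
by rewrite ler1n.
Qed.

Let b v := upd i0 v a.

(** Time and initial point are packed into one argument: [v 0 i0 - a] is the flow time, and [b v] is
    the initial point on the slice. *)
Fixpoint picard (k : nat) : 'rV[R]_n -> 'rV[R]_n :=
  match k with
  | 0 => b
  | k'.+1 => fun v => \row_j (b v 0 j + P (X j \o picard k') v)
  end.

Lemma picardS k v j : picard k.+1 v 0 j = b v 0 j + P (X j \o picard k) v.
Proof. by rewrite mxE. Qed.

Lemma smooth_entry_b j : smooth_on W (entry b 0 j).
Proof.
have -> : entry b 0 j = if j == i0 then (fun=> a) else (fun v => v 0 j).
  by apply/funext => v; rewrite /entry /b updE; case: ifP.
by case: ifP => _; [exact: smooth_cst|exact: smooth_coord].
Qed.

Lemma iter_pd_b_bounded s : exists2 C : R, 0 <= C &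
  forall j v, W v -> `|iter_pd s (entry b 0 j) v| <= C.
Proof.
suff H j : exists2 C : R, 0 <= C & forall v, W v -> `|iter_pd s (entry b 0 j) v| <= C.
  have /choice[C HC] j : exists C : R, 0 <= C /\ forall v, W v -> `|iter_pd s (entry b 0 j) v| <= C.
    by have [C ? ?] := H j; exists C.
  have C0 j : 0 <= C j by have [] := HC j.
  exists (\sum_j C j); first exact: sumr_ge0.
  move=> j v Wv; have [_ h] := HC j; apply: (le_trans (h v Wv)).
  by rewrite (bigD1 j)//= lerDl sumr_ge0.
case/lastP: s => [|s i].
  exists (`|p| + dl); first by rewrite addr_ge0// ltW.
  move=> v Wv; rewrite /= /entry -(subrK (p 0 j) (b v 0 j)).
  rewrite (le_trans (ler_normD _ _))// addrC lerD//; first exact: norm_mx_ge.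
  rewrite /b updE; case: eqVneq => [->|_]; first by rewrite subrr normr0 ltW.
  exact/ltW/cube_coord.
have [c Ec] : exists c : R, pd i (entry b 0 j) = fun=> c.
  have -> : entry b 0 j = if j == i0 then (fun=> a) else (fun v => v 0 j).
    by apply/funext => v; rewrite /entry /b updE; case: ifP.
  case: ifP => _.
    by exists 0; apply/funext => v; rewrite pd_cst.
  by exists (i == j)%:R; apply/funext => v; rewrite pd_coord.
have [c' Ec'] := @iter_pd_cst R n s c.
exists `|c'| => // v Wv.
by rewrite iter_pd_rcons Ec Ec'.
Qed.

Lemma prim_le f v C : 0 <= C -> ck 0 W f -> W v ->
  (forall w, W w -> `|f w| <= C) -> `|P f v| <= dl * C.
Proof.
move=> C0 cf Wv fC; have [df f0] := HP cf.
have := @line_increment _ _ i0 (P f) f v a (v 0 i0) C.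
rewrite f0 subr0 upd_self => h.
rewrite (le_trans (h _))//; last first.
  by rewrite mulrC ler_wpM2r//; exact/ltW/cube_coord.
by move=> x xa; have Wx := upd_cube_le dl0 Wv xa; split; [exact: df|exact: fC].
Qed.

Lemma picard_inv k : (forall j, smooth_on W (entry (picard k) 0 j)) /\
  (forall v, W v -> `|picard k v - p| <= r).
Proof.
have dlr' : dl <= r.
  by apply: le_trans dlr; rewrite ler_peMr ?lerDl// ltW.
have bj v j : W v -> `|b v 0 j - p 0 j| <= dl.
  move=> Wv; rewrite /b updE; case: eqVneq => [->|_]; first by rewrite subrr normr0 ltW.
  exact/ltW/cube_coord.
elim: k => [|k [IHs IHr]].
  split=> [j|v Wv]; first exact: smooth_entry_b.
  apply: norm_mx_le => // i j; rewrite (ord1 i) row_subE /=.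
  exact: le_trans (bj v j Wv) dlr'.
have sXp j : smooth_on W (X j \o picard k).
  by apply: (smooth_comp oW oV _ IHs (sX j)) => v Wv; exact/KV/IHr.
split=> [j|v Wv].
  have -> : entry (picard k.+1) 0 j = fun v => entry b 0 j v + P (X j \o picard k) v.
    by apply/funext => v; rewrite /entry picardS.
  apply: (smoothD oW (smooth_entry_b j)).
  apply/smooth_onP => q; apply: (ck_prim dl0 HP).
  by have /smooth_onP := sXp j.
apply: norm_mx_le => // i j; rewrite (ord1 i) row_subE picardS.
(* The displacement from [p] is at most [dl] from [b v] plus [dl * M] from the integral, which
   explains the hypothesis [dl * (1 + M) <= r]. *)
rewrite addrAC (le_trans (ler_normD _ _))//; apply: le_trans dlr.
rewrite mulrDr mulr1 lerD//; first exact: bj.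
apply: prim_le => //; first by have /smooth_onP := sXp j; apply.
by move=> w Ww; apply/XM/IHr.
Qed.

Let sphi j : allsmooth W (fun k => entry (picard k) 0 j).
Proof. by move=> k; have [h _] := picard_inv k. Qed.

Let phiK k v : W v -> `|picard k v - p| <= r.
Proof. by have [_ h] := picard_inv k; exact: h. Qed.

Let sXphi j : allsmooth W (fun k => X j \o picard k).
Proof. exact: (allsmooth_comp oW oV KV phiK sphi (sX j)). Qed.

Let ck_of_smooth f q : smooth_on W f -> ck q W f.
Proof. by move=> /smooth_onP. Qed.

Let q := n%:R * A0.
Let q0 : 0 <= q. Proof. by rewrite mulr_ge0. Qed.

(** [C1_increment] looks at all points within |x - y| <= 2r of [y], which can leave the cube of
    radius [r]; this is the reason for the radius [3 * r] in [KV3] and [XA]. *)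
Lemma X_lipschitz j x y D : `|x - p| <= r -> `|y - p| <= r -> `|x - y| <= D ->
  `|X j x - X j y| <= q * D.
Proof.
move=> xr yr xyD.
have H : forall w, `|w - y| <= `|x - y| -> forall i,
    derivable (X j) w (delta_mx 0 i) /\ `|pd i (X j) w - 0| <= A0.
  move=> w wy i; have w3 : `|w - p| <= 3 * r.
    rewrite -(subrKA y) (le_trans (ler_normD _ _))//.
    have h2 : `|x - y| <= r + r.
      by rewrite -(subrKA p) (le_trans (ler_normD _ _))// lerD// distrC.
    apply: (le_trans (lerD (le_trans wy h2) yr)).
    have -> : 3 * r = r + r + r by ring.
    exact: lexx.
  by rewrite subr0; split; [exact: (smooth_on_derivable (sX j) (KV3 w3))|exact: XA].
have := C1_increment A00 H; rewrite subrK.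
rewrite big1 ?subr0 => [h|i _]; last by rewrite mul0r.
by apply: (le_trans h); rewrite ler_wpM2l.
Qed.

Lemma picard_ubounded j : ubounded W (fun k => entry (picard k) 0 j).
Proof.
exists (`|p| + r) => k v Wv; rewrite /entry -(subrK (p 0 j) (picard k v 0 j)).
rewrite (le_trans (ler_normD _ _))// addrC lerD//; first exact: norm_mx_ge.
by apply: le_trans (phiK k Wv); have := norm_mx_ge (picard k v - p) 0 j; rewrite !mxE.
Qed.

Lemma picard_good0 j : good W 0 (fun k => entry (picard k) 0 j).
Proof.
split=> //; split; first exact: picard_ubounded.
apply: (@picard_ucauchy _ _ i0 p dl dl0 P HP _ (fun j k => entry (picard k) 0 j)
  (fun j k => X j \o picard k) (fun j v => b v 0 j) q (`|p| + r)).
- by move=> j' k v Wv; rewrite /entry picardS.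
- by move=> j' k; exact/ck_of_smooth/sXphi.
- move=> j' k v Wv; rewrite /entry -(subrK (p 0 j') (picard k v 0 j')).
  rewrite (le_trans (ler_normD _ _))// addrC lerD//; first exact: norm_mx_ge.
  by apply: le_trans (phiK k Wv); have := norm_mx_ge (picard k v - p) 0 j'; rewrite !mxE.
- exact: q0.
- exact: dlq.
- move=> eps e0; exists 0%N => k l _ _ D D0 hD j' v Wv.
  apply: (@le_trans _ _ (q * D)); last by rewrite lerDl ltW.
  apply: X_lipschitz; [exact: phiK|exact: phiK|].
  by apply: norm_mx_le => // i i'; rewrite (ord1 i) !mxE; exact: hD.
Qed.

(** Either no derivative along [i0] occurs and the whole word commutes with [P], or the first one to
    be applied cancels the integration and the order drops by one. *)
Lemma iter_pd_prim s :
  (forall f, smooth_on W f -> forall v, W v -> iter_pd s (P f) v = P (iter_pd s f) v) \/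
  (exists s', size s = (size s').+1 /\
    forall f, smooth_on W f -> forall v, W v -> iter_pd s (P f) v = iter_pd s' f v).
Proof.
elim: s => [|i s [IH|[s' [ss IH]]]]; first by left.
- have [->|ii0] := eqVneq i i0.
    right; exists s; split=> // f sf v Wv /=.
    rewrite (pd_ext i0 oW (IH f sf) Wv) (pd_prim_i0 HP _ Wv)//.
    exact/ck_of_smooth/smooth_on_iter_pd.
  left=> f sf v Wv /=.
  rewrite (pd_ext i oW (IH f sf) Wv) (pd_prim_other dl0 HP _ Wv)//.
  exact/ck_of_smooth/smooth_on_iter_pd.
- right; exists (i :: s'); split; first by rewrite /= ss.
  by move=> f sf v Wv /=; rewrite (pd_ext i oW (IH f sf) Wv).
Qed.

Lemma smooth_prim f : smooth_on W f -> smooth_on W (P f).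
Proof.
by move=> /smooth_onP cf; apply/smooth_onP => k; exact: (ck_prim dl0 HP).
Qed.

Lemma iter_pd_picardS s k j v : W v ->
  iter_pd s (entry (picard k.+1) 0 j) v =
  iter_pd s (entry b 0 j) v + iter_pd s (P (X j \o picard k)) v.
Proof.
move=> Wv; rewrite -(iter_pdD oW _ (smooth_entry_b j) (smooth_prim (sXphi j k)) Wv).
by congr (iter_pd s _ v); apply/funext => w; rewrite /entry picardS.
Qed.

Section InductionStep.
Variable m : nat.
Hypothesis gm : forall j, good W m (fun k => entry (picard k) 0 j).

Let gX j : good W m (fun k => X j \o picard k).
Proof. exact: (good_comp oW oV KV phiK sphi (sX j) gm). Qed.

Let A j l k := pd l (X j) \o picard k.

Let gA j l : good W m (A j l).
Proof. exact: (good_comp oW oV KV phiK sphi (smooth_on_pd l (sX j)) gm). Qed.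

Let sA j l : allsmooth W (A j l).
Proof. exact: (allsmooth_comp oW oV KV phiK sphi (smooth_on_pd l (sX j))). Qed.

(** Derivatives of top order enter the iterated chain rule linearly, with the coefficients [A].
    Everything else involves lower orders only and is collected in [B], which the induction
    hypothesis [gm] controls. *)
Lemma linearized_step s i j : size s = m ->
  exists2 B : nat -> 'rV[R]_n -> R, ucb W B &
  forall k v, W v -> iter_pd (rcons s i) (X j \o picard k) v =
    \sum_l A j l k v * iter_pd (rcons s i) (entry (picard k) 0 l) v + B k v.
Proof.
move=> sm.
have sd l : allsmooth W (fun k => pd i (entry (picard k) 0 l)).
  by move=> k; exact: (smooth_on_pd i (sphi l k)).
pose T l k v := iter_pd s (fun w => A j l k w * pd i (entry (picard k) 0 l) w) v
   - A j l k v * iter_pd s (pd i (entry (picard k) 0 l)) v.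
exists (fun k v => \sum_l T l k v).
  apply: ucb_sum => l _; apply: (ucb_commutator oW (sA j l) (sd l)).
    by rewrite sm; exact: gA.
  rewrite sm => m' m'm; have := good_le m'm (gm l).
  by case=> _ /(_ i).
move=> k v Wv; rewrite -big_split /= iter_pd_rcons.
rewrite (@iter_pd_ext _ _ _ oW s _ (fun w => \sum_l A j l k w * pd i (entry (picard k) 0 l) w) v _ Wv).
  rewrite (iter_pd_sum oW _ _ Wv); last first.
    by move=> l _; exact: (smoothM oW (sA j l k) (sd l k)).
  by apply: eq_bigr => l _; rewrite /T iter_pd_rcons addrC subrK.
move=> w Ww; rewrite (@pd_comp_smooth _ _ W _ V (X j) (picard k) w i oV _ _ (sX j) Ww)//.
- by move=> w' Ww'; exact/KV/phiK.
- by move=> l; exact: sphi.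
Qed.

(** The top-order derivatives satisfy a linear recursion whose coefficients are bounded by [A0], a
    bound on the first derivatives of [X] alone. Thus [dl * (n%:R * A0) <= 1 / 2] gives contraction
    at every order, and the cube does not shrink as the order grows. *)
Lemma picard_step_linear s i j : size s = m ->
  (forall f, smooth_on W f -> forall v, W v ->
     iter_pd (rcons s i) (P f) v = P (iter_pd (rcons s i) f) v) ->
  ucb W (fun k => iter_pd (rcons s i) (entry (picard k) 0 j)).
Proof.
move=> sm PS.
have /choice[B HB] j' : exists B : nat -> 'rV[R]_n -> R, ucb W B /\
  forall k v, W v -> iter_pd (rcons s i) (X j' \o picard k) v =
    \sum_l A j' l k v * iter_pd (rcons s i) (entry (picard k) 0 l) v + B k v.
  by have [B ? ?] := linearized_step i j' sm; exists B.
have uB j' : ucb W (B j') by have [] := HB j'.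
have EB j' k v : W v -> iter_pd (rcons s i) (X j' \o picard k) v =
    \sum_l A j' l k v * iter_pd (rcons s i) (entry (picard k) 0 l) v + B j' k v.
  by have [_] := HB j'; exact.
have [MB MB0 BM] : exists2 MB : R, 0 <= MB & forall j k v, W v -> `|B j k v| <= MB.
  have /choice[C HC] j' : exists C : R, forall k v, W v -> `|B j' k v| <= C.
    by have [[]] := uB j'; move=> C; exists C.
  exists (\sum_j `|C j|); first exact: sumr_ge0.
  move=> j' k v Wv; apply: (le_trans (HC j' k v Wv)).
  by rewrite (le_trans (ler_norm _))// (bigD1 j')//= lerDl sumr_ge0.
have [Cb Cb0 hCb] := iter_pd_b_bounded (rcons s i).
(* Chosen so that [Cb + dl * (q * C + MB) <= C] whenever [dl * q <= 1 / 2]: the bound [C] reproduces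
   itself under the recursion. *)
pose C := 2 * (Cb + dl * MB).
have dMB : 0 <= dl * MB by rewrite mulr_ge0// ltW.
have C0 : 0 <= C by rewrite mulr_ge0// addr_ge0.
pose y j k := iter_pd (rcons s i) (entry (picard k) 0 j).
pose g j k := iter_pd (rcons s i) (X j \o picard k).
have sg j' k : smooth_on W (g j' k) by exact: (smooth_on_iter_pd _ (sXphi j' k)).
have yS j' k v : W v -> y j' k.+1 v = iter_pd (rcons s i) (entry b 0 j') v + P (g j' k) v.
  by move=> Wv; rewrite /y iter_pd_picardS// PS//; exact: sXphi.
have AA j' l k v : W v -> `|A j' l k v| <= A0.
  move=> Wv; apply: XA; apply: (le_trans (phiK k Wv)); rewrite ler_peMl//.
  by rewrite ler1n.
have yC j' k v : W v -> `|y j' k v| <= C.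
  elim: k j' v => [|k IH] j' v Wv.
    apply: le_trans (hCb j' v Wv) _; rewrite /C mulrDr.
    rewrite (@le_trans _ _ (2 * Cb))//; last by rewrite lerDl mulr_ge0.
    by rewrite ler_peMl// ler1n.
  rewrite yS// (le_trans (ler_normD _ _))//.
  have h : `|P (g j' k) v| <= dl * (q * C + MB).
    apply: prim_le => //.
    - exact: (addr_ge0 (mulr_ge0 q0 C0) MB0).
    - exact: ck_of_smooth.
    - move=> w Ww; rewrite /g EB// (le_trans (ler_normD _ _))// lerD//; last exact: BM.
      rewrite (le_trans (ler_norm_sum _ _ _))//.
      apply: (@le_trans _ _ (\sum_(l < n) A0 * C)).
        apply: ler_sum => l _; rewrite normrM ler_pM//; [exact: AA|exact: IH].
      by rewrite sumr_const card_ord -[leLHS]mulr_natl mulrA.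
  apply: le_trans (lerD (hCb j' v Wv) h) _.
  have h2 : dl * (q * C) <= C / 2.
    by rewrite mulrA [leRHS]mulrC -div1r; apply: ler_wpM2r.
  rewrite mulrDr [leLHS]addrCA (le_trans (lerD h2 (lexx _)))//.
  have {2}-> : C = C / 2 + C / 2 by exact: splitr.
  by rewrite lerD2l /C [leRHS]mulrC mulKf// pnatr_eq0.
split.
  by exists C => k v Wv; exact: yC.
apply: (@picard_ucauchy _ _ i0 p dl dl0 P HP _ y g
  (fun j v => iter_pd (rcons s i) (entry b 0 j) v) q C) => //.
- by move=> j' k; exact/ck_of_smooth.
move=> eps e0.
have nC0 : 0 < n%:R * C + 1 by rewrite ltr_wpDl// mulr_ge0.
(* Half of [eps] absorbs the variation of the coefficients [A], amplified by at most [n%:R * C], and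
   the other half that of [B]. The added 1 keeps the denominator positive. *)
have e1 : 0 < eps / (2 * (n%:R * C + 1)) by rewrite divr_gt0// mulr_gt0.
have e2 : 0 < eps / 2 by rewrite divr_gt0.
have [N1 hN1] := @ucauchy_common _ _ W _ (fun jl : 'I_n * 'I_n => A jl.1 jl.2) _
  (fun jl => (good_ucb (gA jl.1 jl.2)).2) e1.
have [N2 hN2] := @ucauchy_common _ _ W _ B _ (fun j => (uB j).2) e2.
exists (maxn N1 N2) => k l; rewrite !geq_max => /andP[k1 k2] /andP[l1 l2] D D0 hD j' v Wv.
rewrite /g !EB// opprD addrACA -sumrB (le_trans (ler_normD _ _))//.
have hB := hN2 j' k l k2 l2 v Wv.
have hS : `|\sum_l0 (A j' l0 k v * y l0 k v - A j' l0 l v * y l0 l v)| <=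
   n%:R * (A0 * D + C * (eps / (2 * (n%:R * C + 1)))).
  rewrite (le_trans (ler_norm_sum _ _ _))//.
  apply: (@le_trans _ _ (\sum_(l0 < n) (A0 * D + C * (eps / (2 * (n%:R * C + 1)))))).
    apply: ler_sum => l0 _.
    have hA := hN1 (j', l0) k l k1 l1 v Wv.
    have hy := hD l0 v Wv; have hAA := AA j' l0 k v Wv; have hyC := yC l0 l v Wv.
    have -> : A j' l0 k v * y l0 k v - A j' l0 l v * y l0 l v =
       A j' l0 k v * (y l0 k v - y l0 l v) + y l0 l v * (A j' l0 k v - A j' l0 l v).
      move: (A j' l0 k v) (A j' l0 l v) (y l0 k v) (y l0 l v) => x1 x2 x3 x4; ring.
    by rewrite (le_trans (ler_normD _ _))// !normrM lerD// ler_pM.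
  by rewrite sumr_const card_ord -[leLHS]mulr_natl.
apply: le_trans (lerD hS hB) _.
rewrite mulrDr mulrA -/q -addrA lerD2l [leRHS]splitr lerD2r.
have -> : n%:R * (C * (eps / (2 * (n%:R * C + 1)))) =
    (eps / 2) * ((n%:R * C) / (n%:R * C + 1)).
  by field; rewrite gt_eqF.
rewrite ler_piMr ?(ltW e2)// ler_pdivrMr// mul1r lerDl//.
Qed.

Lemma picard_good_step j : good W m.+1 (fun k => entry (picard k) 0 j).
Proof.
apply: iter_good => s; rewrite leq_eqVlt ltnS => /orP[/eqP sm|sm]; last first.
  exact: (good_iter (gm j) sm).
have [PS|[s' [ss' PS]]] := iter_pd_prim s.
  case/lastP: s sm PS => [//|s i]; rewrite size_rcons => -[sm] PS.
  exact: picard_step_linear.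
(* Here a derivative along [i0] has cancelled the integral, so only derivatives of lower order of
   the previous iterate remain, and no contraction is involved. *)
have [Cb Cb0 hCb] := iter_pd_b_bounded s.
apply: (@ucb_shift _ _ _ _ Cb); first by move=> v; exact: hCb.
apply: (ucb_ext (F := fun k v => iter_pd s (entry b 0 j) v + iter_pd s' (X j \o picard k) v)).
  by move=> k v Wv; rewrite iter_pd_picardS// PS//; exact: sXphi.
apply: ucbD.
  by apply: (@ucb_cst _ _ _ _ Cb) => v; exact: hCb.
apply: good_iter (gX j) _.
by rewrite -ltnS -ss' sm.
Qed.

End InductionStep.

Lemma picard_good m j : good W m (fun k => entry (picard k) 0 j).
Proof.
by elim: m j => [|m IH] j; [exact: picard_good0|exact: picard_good_step].
Qed.

Lemma picard_slice k (v : 'rV[R]_n) : v 0 i0 = a -> picard k v = v.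
Proof.
move=> va; have bv : b v = v by rewrite /b -va upd_self.
case: k => [//|k]; apply/rowP => j; rewrite picardS bv.
have [_ h] := HP (@ck_of_smooth _ 0%N (sXphi j k)).
by have := h v; rewrite -/(b v) bv => ->; rewrite addr0.
Qed.

Lemma picard_limit : exists Phi : 'rV[R]_n -> 'rV[R]_n,
  [/\ forall j, smooth_on W (entry Phi 0 j),
      forall v, W v -> V (Phi v),
      forall v j, W v -> pd i0 (entry Phi 0 j) v = X j (Phi v) &
      forall v, W v -> v 0 i0 = a -> Phi v = v].
Proof.
have /choice[f Hf] j := good_limit oW (sphi j) (fun m => picard_good m j).
pose Phi v : 'rV[R]_n := \row_j f j v.
have EPhi j : entry Phi 0 j = f j by apply/funext => v; rewrite /entry mxE.
have sf j : smooth_on W (f j) by have [] := Hf j.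
have uf j s : uconv W (fun k => iter_pd s (entry (picard k) 0 j)) (iter_pd s (f j)).
  by have [_] := Hf j.
have near_Phi eps : 0 < eps -> exists N, forall k, (N <= k)%N -> forall v, W v ->
    `|picard k v - Phi v| <= eps.
  move=> e0; have /choice[N hN] j := uf j [::] _ e0.
  exists (\max_j N j) => k Nk v Wv; apply: norm_mx_le (ltW e0) _ => i j.
  rewrite (ord1 i) !mxE; apply: hN Wv; exact: leq_trans (leq_bigmax j) Nk.
have PhiK v : W v -> `|Phi v - p| <= r.
  move=> Wv; apply/ler_addgt0Pr => e e0; have [N hN] := near_Phi _ e0.
  rewrite -(subrKA (picard N v)) (le_trans (ler_normD _ _))// addrC lerD//.
    exact: phiK.
  by rewrite distrC; exact: hN.
exists Phi; split.
- by move=> j; rewrite EPhi.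
- by move=> v Wv; exact/KV/PhiK.
- move=> v j Wv; rewrite EPhi.
  apply/eqP; rewrite -subr_eq0 -normr_le0; apply/ler_addgt0Pr => e e0; rewrite add0r.
  have e20 : 0 < e / 2 by rewrite divr_gt0.
  have Xc w : `|w - p| <= r -> {for w, continuous (X j)}.
    by move=> /KV Vw; exact: (smooth_on_continuous (sX j) Vw).
  have [d d0 hd] := uniform_continuity Xc e20.
  have d20 : 0 < d / 2 by rewrite divr_gt0.
  have [N1 hN1] := near_Phi _ d20.
  have [N2 hN2] := uf j [:: i0] _ e20.
  have h1 := hN2 (maxn N1 N2).+1 (leqW (leq_maxr _ _)) v Wv.
  rewrite /= in h1.
  (* The exact relation between consecutive iterates; both of its sides converge, and the limit is
     the flow equation. *)
  have E : pd i0 (entry (picard (maxn N1 N2).+1) 0 j) v = X j (picard (maxn N1 N2) v).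
    have := iter_pd_picardS [:: i0] (maxn N1 N2) j Wv; rewrite /= => ->.
    rewrite (pd_prim_i0 HP (@ck_of_smooth _ 0%N (sXphi j _)) Wv).
    rewrite (_ : pd i0 (entry b 0 j) v = 0) ?add0r//.
    have -> : entry b 0 j = if j == i0 then (fun=> a) else (fun v => v 0 j).
      by apply/funext => w; rewrite /entry /b updE; case: ifP.
    by case: eqVneq => [_|ji]; rewrite ?pd_cst// pd_coord eq_sym (negbTE ji).
  rewrite E in h1.
  have h2 : `|X j (picard (maxn N1 N2) v) - X j (Phi v)| <= e / 2.
    apply: hd; first exact: PhiK.
    apply: le_lt_trans (hN1 _ (leq_maxl _ _) v Wv) _.
    by rewrite ltr_pdivrMr// mulr_natr mulr2n ltrDl.
  rewrite -(subrKA (X j (picard (maxn N1 N2) v))) (le_trans (ler_normD _ _))//.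
  by rewrite [leRHS]splitr lerD// distrC.
- move=> v Wv va; apply/eqP; rewrite -subr_eq0 -normr_le0.
  apply/ler_addgt0Pr => e e0; rewrite add0r; have [N hN] := near_Phi _ e0.
  by have := hN N (leqnn _) v Wv; rewrite picard_slice// distrC.
Qed.

End FlowBox.

(** [Phi] is the flow of [X] with the coordinate [i0] as time, started on the slice through [p]. Its
    invertibility is a separate matter, settled in [straighten_function] by a choice of [i0]
    transversal to [X]. *)
Theorem flow_box (R : realType) (n : nat) (i0 : 'I_n) (p : 'rV[R]_n)
    (V : set 'rV[R]_n) (X : 'I_n -> 'rV[R]_n -> R) :
  open V -> V p -> (forall j, smooth_on V (X j)) ->
  exists2 dl : R, 0 < dl & exists Phi : 'rV[R]_n -> 'rV[R]_n,
  [/\ forall j, smooth_on (cube p dl) (entry Phi 0 j),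
      forall v, cube p dl v -> V (Phi v),
      forall v j, cube p dl v -> pd i0 (entry Phi 0 j) v = X j (Phi v) &
      forall v, cube p dl v -> v 0 i0 = p 0 i0 -> Phi v = v].
Proof.
move=> oV Vp sX.
have [rho rho0 rhoV] := open_cube_subset oV Vp.
(* A quarter, so that the closed cube of radius [3 * r] lies in [V]. *)
pose r := rho / 4.
have r0 : 0 < r by rewrite divr_gt0.
have KV3 (v : 'rV[R]_n) : `|v - p| <= 3 * r -> V v.
  move=> vr; apply: rhoV; apply: (le_lt_trans vr).
  by rewrite /r; clear -rho0; lra.
have [M M0 XM] : exists2 M : R, 0 <= M & forall j v, `|v - p| <= r -> `|X j v| <= M.
  have /choice[C HC] j : exists C : R, 0 < C /\ forall v, `|v - p| <= r -> `|X j v| <= C.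
    have [|C C0 HC] := @compact_bounded_fun _ _ (X j) p r; last by exists C.
    move=> v vr; apply: (smooth_on_continuous (sX j)); apply: KV3.
    by apply: (le_trans vr); rewrite ler_peMl ?ler1n// ltW.
  exists (\sum_j C j); first by apply: sumr_ge0 => j _; have [/ltW] := HC j.
  move=> j v vr; have [_ /(_ v vr) h] := HC j; apply: (le_trans h).
  by rewrite (bigD1 j)//= lerDl sumr_ge0// => l _; have [/ltW] := HC l.
have [A0 A00 XA] : exists2 A0 : R, 0 <= A0 & forall j l v, `|v - p| <= 3 * r -> `|pd l (X j) v| <= A0.
  have /choice[C HC] (jl : 'I_n * 'I_n) : exists C : R, 0 < C /\ forall v, `|v - p| <= 3 * r -> `|pd jl.2 (X jl.1) v| <= C.
    have [|C C0 HC] := @compact_bounded_fun _ _ (pd jl.2 (X jl.1)) p (3 * r); last by exists C.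
    move=> v vr; apply: (smooth_on_continuous (smooth_on_pd jl.2 (sX jl.1))); exact: KV3.
  exists (\sum_jl C jl); first by apply: sumr_ge0 => j _; have [/ltW] := HC j.
  move=> j l v vr; have [_ /(_ v vr) h] := HC (j, l); apply: (le_trans h).
  by rewrite (bigD1 (j, l))//= lerDl sumr_ge0// => l' _; have [/ltW] := HC l'.
pose q := n%:R * A0.
have q0 : 0 <= q by rewrite mulr_ge0.
(* The first bound keeps the iterates in the cube of radius [r]; the second makes the iteration
   contract by one half. *)
pose dl := Num.min (r / (1 + M)) (1 / (2 * (q + 1))).
have M1 : 0 < 1 + M by rewrite ltr_pwDl.
have q1 : 0 < q + 1 by rewrite ltr_wpDl.
have dl0 : 0 < dl by rewrite lt_min !divr_gt0// mulr_gt0.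
have dlr : dl * (1 + M) <= r by rewrite -ler_pdivlMr// ge_min lexx.
have dlq : dl * (n%:R * A0) <= 1 / 2.
  have h : dl <= 1 / (2 * (q + 1)) by rewrite ge_min lexx orbT.
  apply: (le_trans (ler_wpM2r q0 h)).
  have -> : 1 / (2 * (q + 1)) * q = 1 / 2 * (q / (q + 1)) by field; rewrite gt_eqF.
  by rewrite ler_piMr// ler_pdivrMr// mul1r lerDl.
have [P HP] := primitive_operator_exists i0 p dl0.
exists dl => //.
exact: (picard_limit dl0 M0 A00 oV sX KV3 XM XA dlr dlq HP).
Qed.

Lemma mx_subE (R : zmodType) m n (A B : 'M[R]_(m, n)) i j : (A - B) i j = A i j - B i j.
Proof. by rewrite !mxE. Qed.

Lemma mx_addE (R : nmodType) m n (A B : 'M[R]_(m, n)) i j : (A + B) i j = A i j + B i j.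
Proof. by rewrite !mxE. Qed.

(** * The inverse function theorem *)

Section InverseFunction.
Variables (R : realType) (n : nat).
Local Notation e_ i := (delta_mx 0 i : 'rV[R]_n).

Lemma mulmx_norm_le (u : 'rV[R]_n) (B : 'M[R]_n) : `|u *m B| <= n%:R * `|B| * `|u|.
Proof.
apply: norm_mx_le => [|i j]; first by rewrite !mulr_ge0.
rewrite mxE (le_trans (ler_norm_sum _ _ _))//.
apply: (@le_trans _ _ (\sum_(l < n) `|B| * `|u|)).
  by apply: ler_sum => l _; rewrite normrM mulrC ler_pM// norm_mx_ge.
by rewrite sumr_const card_ord -[leLHS]mulr_natl mulrA.
Qed.

Definition jacobian_mx (f : 'rV[R]_n -> 'rV[R]_n) v : 'M[R]_n :=
  \matrix_(i, j) pd i (entry f 0 j) v.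

Section NearIdentity.
Variables (F : 'rV[R]_n -> 'rV[R]_n) (W : set 'rV[R]_n).
Hypothesis F_near_id : forall v w, W v -> W w ->
  `|(F v - F w) - (v - w)| <= 1 / 2 * `|v - w|.

Lemma near_id_expanding v w : W v -> W w -> `|v - w| <= 2 * `|F v - F w|.
Proof.
move=> Wv Ww; have h := F_near_id Wv Ww.
have : `|v - w| <= `|F v - F w| + `|(F v - F w) - (v - w)|.
  by rewrite -[X in `|X| <= _](subKr (F v - F w)) ler_normB.
move: (`|v - w|) (`|F v - F w|) (`|_ - _|) h => x y z; clear; lra.
Qed.

(* A minimizer of |F - y| over a closed cube is a solution of F v = y, as the
   step along y - F v would otherwise decrease the distance. *)
Lemma near_id_open : open W -> (forall v, W v -> {for v, continuous F}) ->
  open (F @` W).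
Proof.
move=> oW cF; rewrite openE => _ [w0 Ww0 <-].
have [r' r'0 hr'] := open_cube_subset oW Ww0.
pose r := r' / 2.
have r0 : 0 < r by rewrite divr_gt0.
have KW v : `|v - w0| <= r -> W v.
  move=> vr; apply: hr'; apply: (le_lt_trans vr).
  by rewrite /r ltr_pdivrMr// mulr_natr mulr2n ltrDl.
have r40 : 0 < r / 4 by rewrite divr_gt0.
rewrite /interior; apply/nbhs_ballP; exists (r / 4) => //= y; rewrite -ball_normE /= => yF.
have cG : {within [set v | `|v - w0| <= r], continuous (fun v => `|F v - y|)}.
  apply: continuous_in_subspaceT => v; rewrite inE /= => /KW Wv.
  apply: continuous_comp; last exact: norm_continuous.
  by apply: continuousB; [exact: cF|exact: cst_continuous].
have [|v] := @EVT_min_rV R n _ [set v | `|v - w0| <= r] _ (@compact_closed_cube _ _ w0 r) cG.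
  by exists w0; rewrite /= subrr normr0 ltW.
rewrite inE /= => vr vmin.
have Wv := KW _ vr.
exists v => //; apply/eqP/negPn/negP => Fvy.
have d0 : 0 < `|F v - y| by rewrite normr_gt0 subr_eq0.
have vmin0 : `|F v - y| <= `|F w0 - y| by apply: vmin; rewrite inE /= subrr normr0 ltW.
have vw0 : `|v - w0| < r.
  have h1 := near_id_expanding Wv Ww0.
  have h2 : `|F v - F w0| <= `|F v - y| + `|F w0 - y|.
    by rewrite -(subrKA y) (le_trans (ler_normD _ _))// [`|y - _|]distrC.
  move: h1 h2 vmin0 yF; clear.
  move: (`|v - w0|) (`|F v - F w0|) (`|F v - y|) (`|F w0 - y|) => x1 x2 x3 x4; lra.
pose s := Num.min 1 ((r - `|v - w0|) / `|F v - y|).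
have s0 : 0 < s by rewrite lt_min ltr01 divr_gt0// subr_gt0.
have s1 : s <= 1 by rewrite ge_min lexx.
have sd : s * `|F v - y| <= r - `|v - w0| by rewrite -ler_pdivlMr// ge_min lexx orbT.
pose v' := v + s *: (y - F v).
have v'v : v' - v = s *: (y - F v) by rewrite /v' addrC addKr.
have nv' : `|v' - v| = s * `|F v - y| by rewrite v'v normrZ gtr0_norm// distrC.
have v'r : `|v' - w0| <= r.
  by rewrite -(subrKA v) (le_trans (ler_normD _ _))// nv' -lerBrDr.
have Wv' := KW _ v'r.
have h1 : `|F v - y| <= `|F v' - y| by apply: vmin; rewrite inE.
have h2 := F_near_id Wv' Wv.
have : `|F v' - y| <= (1 - s) * `|F v - y| + 1 / 2 * (s * `|F v - y|).
  have -> : F v' - y = (1 - s) *: (F v - y) + ((F v' - F v) - (v' - v)).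
    rewrite v'v scalerBl scale1r -[s *: (y - F v)]opprK -scalerN !opprB.
    by apply/rowP => j; rewrite !mxE; ring.
  rewrite (le_trans (ler_normD _ _))// lerD//.
    by rewrite normrZ ger0_norm// subr_ge0.
  by rewrite -nv'.
move: h1 d0 s0; clear; move: (`|F v - y|) (`|F v' - y|) (s) => x1 x2 x3 h1 h2 h3 h4.
have h5 : 0 < x3 * x1 by rewrite mulr_gt0.
move: h4 h5; rewrite mulrBl mul1r; move: (x3 * x1) => x4; clear -h1; lra.
Qed.

End NearIdentity.

Lemma three_thirds (x1 x2 x3 d : R) : x1 <= x3 -> x2 < d / 3 ->
  x3 < d / 3 + d / 3 -> x1 + x2 < d.
Proof. by move=> h1 h2 h3; lra. Qed.

Lemma half_absurd (x : R) : x <= 1 / 2 * x -> x <= 0.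
Proof. by move=> h; lra. Qed.

Section Inverse.
Variables (f : 'rV[R]_n -> 'rV[R]_n) (U : set 'rV[R]_n) (v0 : 'rV[R]_n).
Hypotheses (oU : open U) (Uv0 : U v0).
Hypothesis sf : forall j, smooth_on U (entry f 0 j).
Hypothesis Ju : jacobian_mx f v0 \in unitmx.
(** Multiplying by the inverse Jacobian normalizes the derivative at [v0] to the identity, which
    puts [F] in the situation of [NearIdentity]. *)
Let B := invmx (jacobian_mx f v0).
Let F v := f v *m B.

Let oU1 j : ck 1 U (entry f 0 j).
Proof. by have /smooth_onP := sf j. Qed.

Lemma smooth_F j : smooth_on U (entry F 0 j).
Proof.
have -> : entry F 0 j = fun v => \sum_l entry f 0 l v * B l j.
  by apply/funext => v; rewrite /entry /F mxE.
apply: (smooth_sum oU) => l _; apply: (smoothM oU (sf l)); exact: smooth_cst.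
Qed.

Lemma jacobian_F v : U v -> jacobian_mx F v = jacobian_mx f v *m B.
Proof.
move=> Uv; apply/matrixP => i j; rewrite !mxE.
have -> : entry F 0 j = fun v => \sum_l entry f 0 l v * B l j.
  by apply/funext => w; rewrite /entry /F mxE.
rewrite (pd_sum oU _ _ Uv); last first.
  by move=> l _; apply: (smoothM oU (sf l)); exact: smooth_cst.
apply: eq_bigr => l _; rewrite pdM ?pd_cst ?mulr0 ?addr0 ?mxE//.
- exact: (smooth_on_derivable (sf l) Uv).
Qed.

(** The bound per entry is such that a sum of [n] of them is at most 1/2, the constant in
    [F_near_id]. *)
Lemma near_C1 : exists2 d : R, 0 < d & forall w, `|w - v0| < d ->
  U w /\ forall i j, `|pd i (entry F 0 j) w - (i == j)%:R| <= (2 * (n%:R + 1))^-1.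
Proof.
have n1 : 0 < (2 * (n%:R + 1))^-1 :> R by rewrite invr_gt0 mulr_gt0// ltr_wpDl.
have JF0 i j : pd i (entry F 0 j) v0 = (i == j)%:R.
  have := congr1 (fun A : 'M[R]_n => A i j) (jacobian_F Uv0).
  by rewrite /B mulmxV// !mxE.
have /choice[d hd] (j : 'I_n) : exists d : R, 0 < d /\ forall w, `|w - v0| < d ->
    U w /\ forall i, `|pd i (entry F 0 j) w - (i == j)%:R| <= (2 * (n%:R + 1))^-1.
  have cF : ck 1 U (entry F 0 j) by have /smooth_onP := smooth_F j.
  have [d d0 hd] := ck1_near oU cF Uv0 n1.
  exists d; split=> // w /hd[Uw h]; split=> // i.
  by have [_] := h i; rewrite JF0.
have [d0 d00 dU] := open_cube_subset oU Uv0.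
exists (\big[Num.min/d0]_j d j).
  by apply: lt_bigmin => // j _; have [] := hd j.
move=> w wd; split.
  by apply: dU; apply: (lt_le_trans wd); exact: bigmin_le_id.
move=> i j; have [_ /(_ w)[|_]] := hd j; last exact.
by apply: (lt_le_trans wd); exact: bigmin_le_cond.
Qed.

Lemma near_C1_cube : exists2 d : R, 0 < d & [/\ cube v0 d `<=` U,
  (forall v w, cube v0 d v -> cube v0 d w -> `|(F v - F w) - (v - w)| <= 1 / 2 * `|v - w|) &
  forall w, cube v0 d w -> jacobian_mx f w \in unitmx].
Proof.
have [d d0 hd] := near_C1.
have hn : n%:R * (2 * (n%:R + 1))^-1 <= 1 / 2 :> R.
  have n1 : 0 < n%:R + 1 :> R by rewrite ltr_wpDl.
  by rewrite invfM mulrCA div1r ler_piMr// ler_pdivrMr// mul1r lerDl.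
have n1 : 0 <= (2 * (n%:R + 1))^-1 :> R by rewrite invr_ge0 mulr_ge0// addr_ge0.
(* A third of the radius: for two points of the small cube, [C1_increment] looks at points up to
   three times its radius away from [v0]. *)
have d30 : 0 < d / 3 by rewrite divr_gt0.
have d3d : d / 3 < d by rewrite ltr_pdivrMr// ltr_pMr// ltr1n.
have dU : cube v0 (d / 3) `<=` U.
  by move=> v vd; have [] := hd v (lt_trans vd d3d).
exists (d / 3) => //; split=> //.
  move=> v w vd wd; apply: norm_mx_le => [|a j].
    by rewrite mulr_ge0.
  rewrite (ord1 a).
  have H : forall x, `|x - w| <= `|v - w| -> forall i,
      derivable (entry F 0 j) x (e_ i) /\
      `|pd i (entry F 0 j) x - (i == j)%:R| <= (2 * (n%:R + 1))^-1.
    move=> x xw i; have xd : `|x - v0| < d.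
      rewrite -(subrKA w) (le_lt_trans (ler_normD _ _))//.
      have : `|v - w| < d / 3 + d / 3.
        by rewrite -(subrKA v0) (le_lt_trans (ler_normD _ _))// ltrD// distrC.
      by move=> vw; exact: three_thirds xw wd vw.
    have [Ux h] := hd x xd; split; last exact: h.
    exact: (smooth_on_derivable (smooth_F j) Ux).
  have := C1_increment n1 H; rewrite subrK.
  have -> : \sum_i (i == j)%:R * (v - w) 0 i = (v - w) 0 j.
    rewrite (bigD1 j)//= eqxx mul1r big1 ?addr0// => i ij.
    by rewrite (negbTE ij) mul0r.
  rewrite /entry -!row_subE => h; apply: (le_trans h).
  by rewrite ler_wpM2r.
move=> w wd; have [Uw h] := hd w (lt_trans wd d3d).
(* A row [u] killed by the Jacobian [J] satisfies [u = u *m (1%:M - J)], whose norm is at most half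
   that of [u]. *)
have JBu : jacobian_mx F w \in unitmx.
  rewrite -row_free_unit -kermx_eq0; apply/eqP/row_matrixP => a.
  rewrite row0; set u := row a _.
  have uJ : u *m jacobian_mx F w = 0.
    by apply/eqP; rewrite -sub_kermx /u row_sub.
  have : `|u| <= 1 / 2 * `|u|.
    have E : u = u *m (1%:M - jacobian_mx F w) by rewrite mulmxBr mulmx1 uJ subr0.
    rewrite {1}E; apply: (le_trans (mulmx_norm_le _ _)); rewrite ler_wpM2r//.
    apply: le_trans hn; rewrite ler_wpM2l//; apply: norm_mx_le => // i j.
    by rewrite mx_subE !mxE distrC; exact: h.
  move=> hu; apply/eqP; rewrite -normr_le0.
  exact: half_absurd hu.
by move: JBu; rewrite jacobian_F// unitmx_mul => /andP[].
Qed.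

Theorem inverse_function : exists2 d : R, 0 < d &
  cube v0 d `<=` U /\ exists g : 'rV[R]_n -> 'rV[R]_n,
  [/\ forall v, cube v0 d v -> g (f v) = v,
      open (f @` cube v0 d) &
      forall j, smooth_on (f @` cube v0 d) (entry g 0 j)].
Proof.
have [d d0 [dU Fid Jun]] := near_C1_cube.
exists d => //; split => //.
pose W := cube v0 d.
have oW : open W by exact: open_cube.
have cF v : W v -> {for v, continuous F}.
  by move=> /dU Uv; apply: continuous_rv => j; exact: (smooth_on_continuous (smooth_F j) Uv).
have oFW := near_id_open Fid oW cF.
have Bu : B \in unitmx by rewrite unitmx_inv.
pose O := f @` W.
have OE : O = (fun z => z *m B) @^-1` (F @` W).
  apply/seteqP; split=> [_ [v Wv <-]|z [v Wv E]]; first by exists v.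
  by exists v => //; move: (congr1 (fun x => x *m invmx B) E); rewrite /F !mulmxK.
have oO : open O.
  rewrite OE; apply: open_comp => // z _.
  apply: continuous_rv => j.
  rewrite (_ : (fun x => (x *m B) 0 j) = fun x : 'rV[R]_n => \sum_l x 0 l * B l j).
    apply: (@ck_continuous _ _ 0 setT) => //; apply: ck_sum => [|l _]; first exact: openT.
    by apply: ckM; [exact: openT|exact: ck_coord|exact: ck_cst].
  by apply/funext => x; rewrite mxE.
have fexp v w : W v -> W w -> `|v - w| <= 2 * (n%:R * `|B|) * `|f v - f w|.
  move=> Wv Ww; apply: (le_trans (near_id_expanding Fid Wv Ww)).
  by rewrite /F -mulmxBl -mulrA ler_pM2l// mulmx_norm_le.
have finj v w : W v -> W w -> f v = f w -> v = w.
  move=> Wv Ww fvw; have := fexp v w Wv Ww.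
  by rewrite fvw subrr normr0 mulr0 normr_le0 subr_eq0 => /eqP.
have /choice[g Hg] (z : 'rV[R]_n) : exists v, O z -> W v /\ f v = z.
  have [[v Wv fv]|nO] := pselect (O z); first by exists v.
  by exists 0.
have gW z : O z -> W (g z) by move=> /Hg[].
have fg z : O z -> f (g z) = z by move=> /Hg[].
have gf v : W v -> g (f v) = v.
  move=> Wv; have Of : O (f v) by exists v.
  by apply: finj => //; [exact: gW|exact: fg].
exists g; split=> //.
pose C := 2 * (n%:R * `|B|).
have C0 : 0 <= C by rewrite !mulr_ge0.
have C10 : 0 < C + 1 by rewrite ltr_wpDl.
have gexp z z' : O z -> O z' -> `|g z - g z'| <= C * `|z - z'|.
  move=> Oz Oz'; apply: (le_trans (fexp _ _ (gW _ Oz) (gW _ Oz'))).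
  by rewrite !fg.
have gd z i j : O z ->
    is_derive z (e_ i) (entry g 0 j) (invmx (jacobian_mx f (g z)) i j).
  move=> Oz; apply: is_derive_eps => eps e0.
  set A := jacobian_mx f (g z).
  have Au : A \in unitmx by apply: Jun; exact: gW.
  (* The total factor by which the first-order remainder of [f] is amplified: the inverse Jacobian,
     the Lipschitz constant [C] of [g] and the dimension factors of the sup norm. The 1 makes it
     positive. *)
  pose K := n%:R * `|invmx A| * n%:R * C + 1.
  have K0 : 0 < K by rewrite ltr_wpDl// !mulr_ge0.
  have eK : 0 < eps / K by rewrite divr_gt0.
  have /choice[d1 hd1] (l : 'I_n) : exists d1 : R, 0 < d1 /\ forall w, `|w - g z| < d1 ->
      U w /\ forall i, derivable (entry f 0 l) w (e_ i) /\
        `|pd i (entry f 0 l) w - pd i (entry f 0 l) (g z)| <= eps / K.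
    have [d1 d10 hd1] := ck1_near oU (oU1 l) (dU _ (gW _ Oz)) eK.
    by exists d1.
  have [d2 d20 hd2] := open_cube_subset oO Oz.
  pose d3 := \big[Num.min/d2]_l (d1 l / (C + 1)).
  have d30 : 0 < d3.
    by apply: lt_bigmin => // l _; rewrite divr_gt0//; have [] := hd1 l.
  exists d3 => // h hd3.
  have nh : `|h *: e_ i| <= `|h|.
    by rewrite normrZ -[leRHS]mulr1 ler_pM//; exact: norm_delta_le1.
  have Oh : O (h *: e_ i + z).
    apply: hd2; rewrite /cube/= addrK; apply: (le_lt_trans nh).
    by apply: (lt_le_trans hd3); exact: bigmin_le_id.
  pose k := g (h *: e_ i + z) - g z.
  have kC : `|k| <= C * `|h|.
    apply: (le_trans (gexp _ _ Oh Oz)); rewrite addrK ler_wpM2l//.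
  have kd l : `|k| < d1 l.
    apply: (le_lt_trans kC).
    have h3 : `|h| < d1 l / (C + 1) by apply: (lt_le_trans hd3); exact: bigmin_le_cond.
    apply: (@le_lt_trans _ _ ((C + 1) * `|h|)); first by rewrite ler_wpM2r// lerDl.
    by rewrite mulrC -ltr_pdivlMr.
  have rem : `|h *: e_ i - k *m A| <= n%:R * (eps / K) * `|k|.
    apply: norm_mx_le => [|a l].
      exact: (mulr_ge0 (mulr_ge0 (ler0n _ _) (ltW eK)) (normr_ge0 _)).
    rewrite (ord1 a).
    have H : forall x, `|x - g z| <= `|k| -> forall i',
        derivable (entry f 0 l) x (e_ i') /\
        `|pd i' (entry f 0 l) x - pd i' (entry f 0 l) (g z)| <= eps / K.
      move=> x xk i'; have [_ /(_ x (le_lt_trans xk (kd l)))[_]] := hd1 l; exact.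
    have := C1_increment (ltW eK) H; rewrite /k subrK -/k /entry !fg// => h4.
    apply: le_trans h4; rewrite row_subE.
    have -> : (h *: e_ i) 0 l = (h *: e_ i + z) 0 l - z 0 l.
      by rewrite mx_addE addrK.
    have -> // : (k *m A) 0 l = \sum_i0 pd i0 (fun v => f v 0 l) (g z) * k 0 i0.
    by rewrite mxE; apply: eq_bigr => i' _; rewrite mulrC; congr (_ * _); rewrite /A mxE.
  have E : k - (h *: e_ i) *m invmx A = - ((h *: e_ i - k *m A) *m invmx A).
    by rewrite mulmxBl mulmxK// opprB.
  have -> : entry g 0 j (h *: e_ i + z) - entry g 0 j z - h * invmx A i j =
      (k - (h *: e_ i) *m invmx A) 0 j.
    rewrite row_subE row_subE /entry; congr (_ - _).
    by rewrite -scalemxAl mxE -rowE mxE.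
  apply: (le_trans (norm_mx_ge _ _ _)); rewrite E normrN.
  apply: (le_trans (mulmx_norm_le _ _)).
  apply: (@le_trans _ _ (n%:R * `|invmx A| * (n%:R * (eps / K) * (C * `|h|)))).
    rewrite ler_wpM2l ?mulr_ge0//; apply: (le_trans rem).
    by rewrite ler_wpM2l// mulr_ge0// ltW.
  have -> : n%:R * `|invmx A| * (n%:R * (eps / K) * (C * `|h|)) =
     eps * `|h| * ((n%:R * `|invmx A| * n%:R * C) / K).
    by move: (K^-1) (`|h|) (`|invmx A|) => x0 x1 x2; ring.
  rewrite ler_piMr ?mulr_ge0 ?(ltW e0)// ler_pdivrMr// mul1r lerDl//.
have gcj j z : O z -> {for z, continuous (entry g 0 j)}.
  move=> Oz; have FF : Filter (nbhs z) by exact: nbhs_filter.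
  apply/(@cvgrPdist_le _ _ _ (nbhs z) FF) => eps e0.
  have [d2 d20 hd2] := open_cube_subset oO Oz.
  apply/nbhs_ballP; exists (Num.min d2 (eps / (C + 1))).
    by rewrite /= lt_min d20 divr_gt0.
  move=> w; rewrite -ball_normE /= lt_min => /andP[w1 w2].
  have Ow : O w by apply: hd2; rewrite /cube/= distrC.
  rewrite /entry -row_subE; apply: (le_trans (norm_mx_ge _ _ _)).
  apply: (le_trans (gexp _ _ Oz Ow)).
  apply: (@le_trans _ _ ((C + 1) * `|z - w|)); first by rewrite ler_wpM2r// lerDl.
  by rewrite mulrC -ler_pdivlMr// ltW.
(* Bootstrapping: the derivative of [g] is the inverse Jacobian of [f] evaluated at [g], so it is
   C^k as soon as [g] is, and [g] gains one order. *)
have ckg k : forall j, ck k O (entry g 0 j).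
  elim: k => [|k IH] j; first by apply: ck0I => z Oz; exact: gcj.
  apply: ckSI => [z Oz|i z Oz|i]; first exact: gcj.
    by have [h _] := gd z i j Oz; exact: h.
  apply: (ck_ext oO (f := (fun v => invmx (jacobian_mx f v) i j) \o g)).
    by move=> z Oz; have [_ E] := gd z i j Oz; exact: (esym E).
  apply: (ck_comp oO oW gW IH).
  apply: (ck_invmx oW Jun) => a b.
  have -> : entry (jacobian_mx f) a b = pd a (entry f 0 b).
    by apply/funext => v; rewrite /entry mxE.
  have /smooth_onP h := smooth_on_pd a (sf b).
  exact: (ck_subset dU (h k)).
by move=> j; apply/smooth_onP => k; exact: ckg.
Qed.

End Inverse.

End InverseFunction.

#[local] Opaque pd.

(** * Levi-Civita connection and curvature *)

Section MatrixCalculus.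
Variables (R : realType) (n : nat) (U : set 'rV[R]_n).
Hypothesis oU : open U.

(** With components packed into matrices, contractions become products, and the tensor identities
    below reduce to polynomial identities between matrices. *)
Definition mxd m k (c : 'I_n) (T : 'rV[R]_n -> 'M[R]_(m, k)) v : 'M[R]_(m, k) :=
  \matrix_(i, j) pd c (entry T i j) v.

Lemma mxdE m k c (T : 'rV[R]_n -> 'M[R]_(m, k)) v i j :
  mxd c T v i j = pd c (entry T i j) v.
Proof. by rewrite mxE. Qed.

Lemma mxd_ext m k c (T S : 'rV[R]_n -> 'M[R]_(m, k)) v :
  (forall w, U w -> T w = S w) -> U v -> mxd c T v = mxd c S v.
Proof.
move=> TS Uv; apply/matrixP => i j; rewrite !mxdE.
by apply: (pd_ext _ oU) => // w Uw; rewrite /entry TS.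
Qed.

Lemma smooth_mx_ext m k (T S : 'rV[R]_n -> 'M[R]_(m, k)) :
  (forall w, U w -> T w = S w) -> smooth_mx_on U T -> smooth_mx_on U S.
Proof.
move=> TS sT i j; apply: (smooth_on_ext oU) (sT i j) => w Uw.
by rewrite /entry TS.
Qed.

Lemma entry_mul m l k (T : 'rV[R]_n -> 'M[R]_(m, l)) (S : 'rV[R]_n -> 'M[R]_(l, k)) i j :
  entry (fun v => T v *m S v) i j = fun v => \sum_h entry T i h v * entry S h j v.
Proof. by apply/funext => v; rewrite /entry mxE. Qed.

Lemma entry_add m k (T S : 'rV[R]_n -> 'M[R]_(m, k)) i j :
  entry (fun v => T v + S v) i j = fun v => entry T i j v + entry S i j v.
Proof. by apply/funext => v; rewrite /entry mxE. Qed.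

Lemma entry_sub m k (T S : 'rV[R]_n -> 'M[R]_(m, k)) i j :
  entry (fun v => T v - S v) i j = fun v => entry T i j v - entry S i j v.
Proof. by apply/funext => v; rewrite /entry mx_subE. Qed.

Lemma entry_tr m k (T : 'rV[R]_n -> 'M[R]_(m, k)) i j :
  entry (fun v => (T v)^T) i j = entry T j i.
Proof. by apply/funext => v; rewrite /entry mxE. Qed.

Lemma entry_scale m k (f : 'rV[R]_n -> R) (T : 'rV[R]_n -> 'M[R]_(m, k)) i j :
  entry (fun v => f v *: T v) i j = fun v => f v * entry T i j v.
Proof. by apply/funext => v; rewrite /entry mxE. Qed.

Lemma entry_mxd m k c (T : 'rV[R]_n -> 'M[R]_(m, k)) i j :
  entry (mxd c T) i j = pd c (entry T i j).
Proof. by apply/funext => v; rewrite /entry mxE. Qed.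

Section Rules.
Variables (m l k : nat).
Implicit Types (T : 'rV[R]_n -> 'M[R]_(m, l)) (S : 'rV[R]_n -> 'M[R]_(l, k)).

Lemma smooth_mx_mul T S : smooth_mx_on U T -> smooth_mx_on U S ->
  smooth_mx_on U (fun v => T v *m S v).
Proof.
move=> sT sS i j; rewrite entry_mul; apply: (smooth_sum oU) => h _.
exact: (smoothM oU (sT i h) (sS h j)).
Qed.

Lemma mxd_mul c T S v : smooth_mx_on U T -> smooth_mx_on U S -> U v ->
  mxd c (fun v => T v *m S v) v = mxd c T v *m S v + T v *m mxd c S v.
Proof.
move=> sT sS Uv; apply/matrixP => i j; rewrite mxdE entry_mul mx_addE !mxE.
rewrite (pd_sum oU _ _ Uv) => [|h _]; last exact: (smoothM oU (sT i h) (sS h j)).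
rewrite -big_split; apply: eq_bigr => h _ /=; rewrite !mxE.
rewrite pdM//; [exact: (smooth_on_derivable (sT i h) Uv)|
                exact: (smooth_on_derivable (sS h j) Uv)].
Qed.

Lemma smooth_mx_add T T' : smooth_mx_on U T -> smooth_mx_on U T' ->
  smooth_mx_on U (fun v => T v + T' v).
Proof. by move=> sT sS i j; rewrite entry_add; exact: (smoothD oU (sT i j) (sS i j)). Qed.

Lemma mxdD c T T' v : smooth_mx_on U T -> smooth_mx_on U T' -> U v ->
  mxd c (fun v => T v + T' v) v = mxd c T v + mxd c T' v.
Proof.
move=> sT sS Uv; apply/matrixP => i j; rewrite mxdE entry_add mx_addE !mxE.
by rewrite pdD//; [exact: (smooth_on_derivable (sT i j) Uv)|
                exact: (smooth_on_derivable (sS i j) Uv)].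
Qed.

Lemma smooth_mx_sub T T' : smooth_mx_on U T -> smooth_mx_on U T' ->
  smooth_mx_on U (fun v => T v - T' v).
Proof. by move=> sT sS i j; rewrite entry_sub; exact: (smoothB oU (sT i j) (sS i j)). Qed.

Lemma mxdB c T T' v : smooth_mx_on U T -> smooth_mx_on U T' -> U v ->
  mxd c (fun v => T v - T' v) v = mxd c T v - mxd c T' v.
Proof.
move=> sT sS Uv; apply/matrixP => i j; rewrite mxdE entry_sub mx_subE !mxE.
by rewrite pdB//; [exact: (smooth_on_derivable (sT i j) Uv)|
                exact: (smooth_on_derivable (sS i j) Uv)].
Qed.

Lemma smooth_mx_tr T : smooth_mx_on U T -> smooth_mx_on U (fun v => (T v)^T).
Proof. by move=> sT i j; rewrite entry_tr. Qed.

Lemma mxd_tr c T v : mxd c (fun v => (T v)^T) v = (mxd c T v)^T.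
Proof. by apply/matrixP => i j; rewrite mxdE entry_tr !mxE. Qed.

Lemma smooth_mx_mxd c T : smooth_mx_on U T -> smooth_mx_on U (mxd c T).
Proof. by move=> sT i j; rewrite entry_mxd; exact: (smooth_on_pd c (sT i j)). Qed.

Lemma mxd_comm c d T v : smooth_mx_on U T -> U v ->
  mxd c (mxd d T) v = mxd d (mxd c T) v.
Proof.
move=> sT Uv; apply/matrixP => i j.
have E c' d' : mxd c' (mxd d' T) v i j = pd c' (pd d' (entry T i j)) v.
  exact: (etrans (mxdE _ _ _ _ _) (congr1 (fun f => pd c' f v) (entry_mxd d' T i j))).
have h := @smooth_pd_comm _ _ U oU (entry T i j) v c d (sT i j) Uv.
exact: (etrans (E c d) (etrans h (esym (E d c)))).
Qed.

Lemma smooth_mx_cst (C : 'M[R]_(m, l)) : smooth_mx_on U (fun=> C).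
Proof. by move=> i j; exact: smooth_cst. Qed.

Lemma mxd_cst c (C : 'M[R]_(m, l)) v : mxd c (fun=> C) v = 0.
Proof. by apply/matrixP => i j; rewrite mxdE mxE; exact: pd_cst. Qed.

Lemma smooth_mx_scale (f : 'rV[R]_n -> R) T : smooth_on U f -> smooth_mx_on U T ->
  smooth_mx_on U (fun v => f v *: T v).
Proof. by move=> sf sT i j; rewrite entry_scale; exact: (smoothM oU sf (sT i j)). Qed.

Lemma mxd_scale c (f : 'rV[R]_n -> R) T v : smooth_on U f -> smooth_mx_on U T -> U v ->
  mxd c (fun v => f v *: T v) v = pd c f v *: T v + f v *: mxd c T v.
Proof.
move=> sf sT Uv; apply/matrixP => i j; rewrite mxdE entry_scale !mxE.
by rewrite pdM//; [exact: (smooth_on_derivable sf Uv)|exact: (smooth_on_derivable (sT i j) Uv)].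
Qed.

End Rules.

End MatrixCalculus.

(** What the symmetry of the second derivatives of the metric becomes once
    [mxd c g = A_c g + g A_c^T] has been inserted twice; [X - Y - (A *m B - B *m A)] is then the
    curvature. *)
Lemma skew_of_comm (R : comNzRingType) n (X Y A B G : 'M[R]_n) :
  X *m G + B *m (A *m G + G *m A^T) + ((A *m G + G *m A^T) *m B^T + G *m X^T) =
  Y *m G + A *m (B *m G + G *m B^T) + ((B *m G + G *m B^T) *m A^T + G *m Y^T) ->
  (X - Y - (A *m B - B *m A)) *m G + G *m (X - Y - (A *m B - B *m A))^T = 0.
Proof.
have tB (M N : 'M[R]_n) : (M - N)^T = M^T - N^T by apply/matrixP => i j; rewrite !mxE.
move/eqP; rewrite -subr_eq0 => /eqP H; rewrite -[RHS]H !tB !trmx_mul.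
rewrite !(mulmxBl, mulmxBr, mulmxDl, mulmxDr) !mulmxA.
move: (X *m G) (Y *m G) (A *m B *m G) (B *m A *m G) (G *m X^T) (G *m Y^T)
  (G *m B^T *m A^T) (G *m A^T *m B^T) (A *m G *m B^T) (B *m G *m A^T) => x1 x2 x3 x4 x5 x6 x7 x8 x9 x10.
apply/matrixP => i j; rewrite !mxE; ring.
Qed.

Lemma mulmxE (R : pzSemiRingType) m l k (A : 'M[R]_(m, l)) (B : 'M[R]_(l, k)) i j :
  (A *m B) i j = \sum_h A i h * B h j.
Proof. by rewrite mxE. Qed.

Lemma sub_sumE (R : zmodType) n (x y : R) (p q r : 'I_n -> R) : x = y ->
  (forall l, r l = q l - p l) ->
  x + \sum_l r l = y - (\sum_l p l - \sum_l q l).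
Proof. by move=> -> h; rewrite opprB -sumrB; congr (_ + _); apply: eq_bigr => l _. Qed.

Section Curvature.
Variables (R : realType) (n : nat) (U : set 'rV[R]_n) (g : 'rV[R]_n -> 'M[R]_n).
Hypotheses (oU : open U) (mg : metric_on U g).

(** Rows carry the lower index and columns the upper one, so that the covariant derivative of a
    column [w] of covector components is [mxd c w - conn g c *m w]. *)
Definition conn (g : 'rV[R]_n -> 'M[R]_n) c v : 'M[R]_n := \matrix_(a, d) christoffel g d c a v.

(** The Christoffel symbols of the first kind. *)
Definition conn_low (g : 'rV[R]_n -> 'M[R]_n) c v : 'M[R]_n := \matrix_(a, l)
  (2^-1 * (pd c (entry g l a) v + pd a (entry g l c) v - pd l (entry g c a) v)).

(* R_{dca}^e, with the sign for which [nabla_d, nabla_c] w_a = - R_{dca}^e w_e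
   and R_{jk} = R_{ijk}^i. *)
Definition curv (g : 'rV[R]_n -> 'M[R]_n) d c v : 'M[R]_n :=
  mxd d (conn g c) v - mxd c (conn g d) v
  - (conn g d v *m conn g c v - conn g c v *m conn g d v).

Lemma metric_smooth : smooth_mx_on U g. Proof. by case: mg. Qed.

Lemma metric_sym v i j : U v -> g v i j = g v j i.
Proof. by move=> Uv; have [_ /(_ v Uv)[gT _]] := mg; rewrite -{1}gT mxE. Qed.

Lemma metric_tr v : U v -> (g v)^T = g v.
Proof. by move=> Uv; have [_ /(_ v Uv)[gT _]] := mg. Qed.

Lemma metric_unit v : U v -> g v \in unitmx.
Proof. by move=> Uv; have [_ /(_ v Uv)[_ gu]] := mg. Qed.

Lemma invg_tr v : U v -> (invmx (g v))^T = invmx (g v).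
Proof. by move=> Uv; rewrite trmx_inv metric_tr. Qed.

Lemma ginv_sym v i j : U v -> ginv g i j v = ginv g j i v.
Proof. by move=> Uv; rewrite /ginv -{1}invg_tr// mxE. Qed.

Lemma smooth_invg : smooth_mx_on U (fun v => invmx (g v)).
Proof.
move=> i j; apply: (smooth_invmx oU) => //; [exact: metric_unit|exact: metric_smooth].
Qed.

Lemma pd_metric_sym c i j v : U v -> pd c (entry g i j) v = pd c (entry g j i) v.
Proof. by move=> Uv; apply: (pd_ext _ oU) => // w Uw; exact: metric_sym. Qed.

Lemma connE c v : U v -> conn g c v = conn_low g c v *m invmx (g v).
Proof.
move=> Uv; apply/matrixP => a d; rewrite !mxE /christoffel mulr_sumr.
apply: eq_bigr => l _; rewrite mxE -[invmx (g v) l d]/(ginv g l d v) (ginv_sym d l Uv).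
by rewrite mulrCA mulrC.
Qed.

Lemma conn_lowE c v : U v -> conn g c v *m g v = conn_low g c v.
Proof. by move=> Uv; rewrite connE// mulmxKV// metric_unit. Qed.

Lemma smooth_conn c : smooth_mx_on U (conn g c).
Proof.
apply: (smooth_mx_ext oU (T := fun v => conn_low g c v *m invmx (g v))).
  by move=> w Uw; rewrite connE.
apply: (smooth_mx_mul oU); last exact: smooth_invg.
move=> a l; rewrite (_ : entry _ a l = fun v => 2^-1 * (pd c (entry g l a) v + pd a (entry g l c) v - pd l (entry g c a) v)).
  apply: (smoothM oU); first exact: smooth_cst.
  apply: (smoothB oU); last exact: (smooth_on_pd l (metric_smooth c a)).
  exact: (smoothD oU (smooth_on_pd c (metric_smooth l a)) (smooth_on_pd a (metric_smooth l c))).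
by apply/funext => v; rewrite /entry mxE.
Qed.

Lemma conn_torsion c a d v : U v -> conn g c v a d = conn g a v c d.
Proof.
move=> Uv; rewrite !mxE /christoffel; congr (_ * _); apply: eq_bigr => l _.
by rewrite (pd_metric_sym l c a Uv) [X in _ * (X - _)]addrC.
Qed.

Lemma row_conn c a v : U v -> row a (conn g c v) = row c (conn g a v).
Proof. by move=> Uv; apply/rowP => d; rewrite ![row _ _ _ _]mxE conn_torsion. Qed.

(** The equation nabla g = 0. The two summands are [conn_low] and its transpose, in whose sum only
    the derivative along [c] survives. *)
Lemma metric_compat c v : U v ->
  mxd c g v = conn g c v *m g v + g v *m (conn g c v)^T.
Proof.
move=> Uv; have -> : g v *m (conn g c v)^T = (conn_low g c v)^T.
  by rewrite -conn_lowE// trmx_mul metric_tr.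
rewrite conn_lowE//; apply/matrixP => a b; rewrite !mxE.
rewrite (pd_metric_sym c b a Uv) (pd_metric_sym a c b Uv) (pd_metric_sym b c a Uv).
move: (pd c _ v) (pd a _ v) (pd b _ v) => x y z; by field.
Qed.

Lemma conn_entryE c a d v : conn g c v a d = christoffel g d c a v.
Proof. by rewrite mxE. Qed.

Lemma ricci_curv v j k : ricci g v j k = \sum_i curv g i j v k i.
Proof.
rewrite mxE -big_split /=; apply: eq_bigr => i _.
rewrite /curv !mx_subE !mulmxE.
have E d c i' : mxd d (conn g c) v k i' = pd d (christoffel g i' c k) v.
  have E' : entry (conn g c) k i' = christoffel g i' c k.
    by apply/funext => w; rewrite /entry conn_entryE.
  exact: (etrans (mxdE _ _ _ _ _) (congr1 (fun f => pd d f v) E')).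
have {}E := congr2 (fun x y : R => x - y) (E i j i) (E j i i).
apply: (sub_sumE (esym E)) => l.
exact: (congr2 (fun x y : R => x - y)
  (etrans (mulrC _ _) (esym (congr2 *%R (conn_entryE _ _ _ _) (conn_entryE _ _ _ _))))
  (etrans (mulrC _ _) (esym (congr2 *%R (conn_entryE _ _ _ _) (conn_entryE _ _ _ _))))).
Qed.

Lemma curv_metric_skew d c v : U v ->
  curv g d c v *m g v + g v *m (curv g d c v)^T = 0.
Proof.
move=> Uv.
have sA c' : smooth_mx_on U (conn g c') := smooth_conn c'.
have sg := metric_smooth.
have E d' c' : mxd d' (mxd c' g) v =
   mxd d' (conn g c') v *m g v + conn g c' v *m (conn g d' v *m g v + g v *m (conn g d' v)^T)
   + ((conn g d' v *m g v + g v *m (conn g d' v)^T) *m (conn g c' v)^T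
      + g v *m (mxd d' (conn g c') v)^T).
  rewrite (mxd_ext oU d' (metric_compat c') Uv).
  have sAg := smooth_mx_mul oU (sA c') sg.
  have sAt := smooth_mx_tr (sA c').
  rewrite (mxdD d' sAg (smooth_mx_mul oU sg sAt) Uv).
  rewrite (mxd_mul oU d' (sA c') sg Uv) (mxd_mul oU d' sg sAt Uv).
  by rewrite mxd_tr !(metric_compat d' Uv).
have := mxd_comm oU d c sg Uv; rewrite !E => H.
exact: (skew_of_comm H).
Qed.

End Curvature.

Lemma trmx_entry (T : Type) m n (A : 'M[T]_(m, n)) i j : A^T i j = A j i.
Proof. by rewrite mxE. Qed.

Lemma sum_delta (R : pzSemiRingType) n (f : 'I_n -> R) b : \sum_a f a * (a == b)%:R = f b.
Proof.
by rewrite (bigD1 b)//= eqxx mulr1 big1 ?addr0// => a /negbTE ->; rewrite mulr0.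
Qed.

(** * Pointwise curvature algebra behind the Killing property *)

Section CurvatureAlgebra.
Variables (R : realFieldType) (n : nat).

(** The classical octahedron argument: four cyclic identities and the skew symmetries form a linear
    system in the components. *)
Lemma pair_symmetry (r : 'I_n -> 'I_n -> 'I_n -> 'I_n -> R) :
  (forall d c a e, r d c a e = - r c d a e) ->
  (forall d c a e, r d c a e = - r d c e a) ->
  (forall d c a e, r d c a e + r c a d e + r a d c e = 0) ->
  forall d c a e, r d c a e = r a e d c.
Proof.
move=> s1 s2 b d c a e.
have h1 := b d c a e; have h2 := b c a e d; have h3 := b a e d c; have h4 := b e d c a.
have t1 := s2 a e d c; have t2 := s2 e d a c; have t3 := s2 d a e c.
have t4 := s2 c a e d; have t5 := s2 a e c d; have t6 := s2 e c a d.
have t7 := s2 e d c a; have t8 := s2 d c e a; have t9 := s2 c e d a.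
have u1 := s1 d c a e; have u2 := s1 c a d e; have u3 := s1 a d c e.
have u4 := s1 c a d e; have u5 := s1 a e c d; have u6 := s1 e c a d.
have u7 := s1 a e d c; have u8 := s1 e d a c; have u9 := s1 d a e c.
have u10 := s1 e d c a; have u11 := s1 d c e a; have u12 := s1 c e d a.
have v1 := s2 d c a e; have v2 := s2 c a d e; have v3 := s2 a d c e.
have v4 := s1 c e a d; have v5 := s2 c e a d.
lra.
Qed.

Lemma skew_sum0 (M S : 'M[R]_n) : (forall i j, M i j = M j i) -> (forall i j, S i j = - S j i) ->
  \sum_i \sum_j M i j * S i j = 0.
Proof.
move=> sM aS; set x := LHS.
have : x = - x.
  rewrite {1}/x exchange_big /= -sumrN; apply: eq_bigr => i _.
  rewrite -sumrN; apply: eq_bigr => j _.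
  by rewrite sM aS mulrN.
by move=> h; lra.
Qed.

Variables (G Gi Y : 'M[R]_n) (F : 'I_n -> 'I_n -> 'M[R]_n) (Lam : R).
Variables (W : 'I_n -> 'I_n -> 'I_n -> 'I_n -> R) (h : 'I_n -> 'I_n -> R).
Hypotheses (n3 : (3 <= n)%N) (Gs : forall i j, G i j = G j i) (Gis : forall i j, Gi i j = Gi j i).
Hypotheses (GGi : G *m Gi = 1%:M) (GiG : Gi *m G = 1%:M).
Hypothesis Ya : forall i j, Y i j = - Y j i.
Hypothesis F1 : forall d c, F d c = - F c d.
Hypothesis F2 : forall d c, F d c *m G + G *m (F d c)^T = 0.
Hypothesis F3 : forall d c a e, F d c a e + F c a d e + F a d c e = 0.
Hypothesis Fric : forall j k, \sum_i F i j k i = Lam * G j k.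
Hypothesis W1 : forall d c a b, W d c a b = - W d c b a.
Hypothesis W2 : forall d c a b, W d c a b = - W d a c b.
(** The commutator of covariant derivatives of [Y], with the CKY equation inserted: [h d b] stands
    for nabla_d xi_b, and [W d c a b] for nabla_d z_{abc}. *)
Hypothesis Q : forall d c a b, - (F d c *m Y + Y *m (F d c)^T) a b =
  G a c * h d b - h d a * G b c - G a d * h c b + h c a * G b d + W d c a b - W c d a b.

Let r d c a e := (F d c *m G) a e.

Let Gid i j : \sum_k Gi i k * G k j = (i == j)%:R.
Proof.
by have := congr1 (fun M : 'M[R]_n => M i j) GiG; rewrite mulmxE [RHS]mxE.
Qed.

Lemma lowered_skew_first d c a e : r d c a e = - r c d a e.
Proof. by rewrite /r F1 mulNmx mxE. Qed.

Lemma lowered_skew_last d c a e : r d c a e = - r d c e a.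
Proof.
have E := congr1 (fun M : 'M[R]_n => M a e) (F2 d c).
rewrite mx_addE [RHS]mxE in E; move/eqP: E; rewrite addr_eq0 /r => /eqP ->; congr (- _).
rewrite /r !mulmxE; apply: eq_bigr => k _.
by rewrite trmx_entry mulrC Gs.
Qed.

Lemma lowered_bianchi d c a e : r d c a e + r c a d e + r a d c e = 0.
Proof.
rewrite /r !mulmxE -!big_split /= big1// => k _.
by rewrite -!mulrDl F3 mul0r.
Qed.

Let F_raise d c a e : F d c a e = \sum_f r d c a f * Gi f e.
Proof.
have E : F d c = (F d c *m G) *m Gi by rewrite -mulmxA GGi mulmx1.
by rewrite {1}E mulmxE.
Qed.

(** [Fric] contracts the first index with the last; the two skew symmetries turn the contraction
    over [c] and [a] into that one. *)
Lemma ricci_contraction d e : \sum_c \sum_a Gi c a * F d c a e = Lam * (d == e)%:R.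
Proof.
have h1 c : \sum_a Gi c a * F d c a e = \sum_f F c d f c * Gi f e.
  transitivity (\sum_a \sum_f Gi c a * (r d c a f * Gi f e)).
    by apply: eq_bigr => a _; rewrite F_raise mulr_sumr.
  rewrite exchange_big /=; apply: eq_bigr => f _.
  rewrite F_raise mulr_suml; apply: eq_bigr => a _.
  rewrite lowered_skew_last lowered_skew_first opprK [Gi c a]Gis.
  by rewrite mulrA; congr (_ * _); rewrite mulrC.
rewrite (eq_bigr _ (fun c _ => h1 c)) exchange_big /=.
transitivity (\sum_f Lam * (G d f * Gi f e)).
  by apply: eq_bigr => f _; rewrite -mulr_suml Fric mulrA.
rewrite -mulr_sumr -mulmxE GGi [in LHS]mxE//.
Qed.

(** This is where the Einstein condition enters. The action on the first index of [Y] contracts to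
    [Lam * Y d b]. The action on the second contracts the skew matrix [P], which is [Y] with raised
    indices, with [r d c b f]; exchanging [d] and [b] by pair symmetry transposes [P]. *)
Lemma curvature_contraction_skew d b :
  (\sum_c \sum_a Gi c a * (F d c *m Y + Y *m (F d c)^T) a b) =
  - (\sum_c \sum_a Gi c a * (F b c *m Y + Y *m (F b c)^T) a d).
Proof.
pose P := Gi *m Y *m Gi.
have Pa i j : P i j = - P j i.
  have Yt : Y^T = - Y by apply/matrixP => i' j'; rewrite !mxE.
  have Git : Gi^T = Gi by apply/matrixP => i' j'; rewrite !mxE.
  have Pt : P^T = - P by rewrite /P !trmx_mul Yt Git mulNmx mulmxN mulmxA.
  by have := congr1 (fun M : 'M[R]_n => M j i) Pt; rewrite !mxE.
have key d' b' : (\sum_c \sum_a Gi c a * (F d' c *m Y + Y *m (F d' c)^T) a b') =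
    Lam * Y d' b' + \sum_c \sum_f P c f * r d' c b' f.
  rewrite (eq_bigr (fun c => \sum_a Gi c a * (F d' c *m Y) a b' +
     \sum_a Gi c a * (Y *m (F d' c)^T) a b')); last first.
    by move=> c _; rewrite -big_split; apply: eq_bigr => a _; rewrite mx_addE mulrDr.
  rewrite big_split /=; congr (_ + _).
    transitivity (\sum_e (\sum_c \sum_a Gi c a * F d' c a e) * Y e b').
      transitivity (\sum_c \sum_e \sum_a Gi c a * F d' c a e * Y e b').
        apply: eq_bigr => c _; rewrite exchange_big; apply: eq_bigr => a _ /=.
        by rewrite mulmxE mulr_sumr; apply: eq_bigr => e _; rewrite mulrA.
      rewrite exchange_big; apply: eq_bigr => e _ /=.
      by rewrite mulr_suml; apply: eq_bigr => c _; rewrite mulr_suml.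
    rewrite (bigD1 d')//= ricci_contraction eqxx mulr1 big1 ?addr0// => e ed.
    by rewrite ricci_contraction eq_sym (negbTE ed) mulr0 mul0r.
  apply: eq_bigr => c _.
  transitivity (\sum_e (Gi *m Y) c e * F d' c b' e).
    transitivity (\sum_a \sum_e Gi c a * Y a e * F d' c b' e).
      apply: eq_bigr => a _; rewrite mulmxE mulr_sumr; apply: eq_bigr => e _.
      by rewrite trmx_entry mulrA.
    rewrite exchange_big; apply: eq_bigr => e _ /=.
    by rewrite mulmxE mulr_suml.
  transitivity (\sum_e \sum_f (Gi *m Y) c e * Gi e f * r d' c b' f).
    apply: eq_bigr => e _; rewrite F_raise mulr_sumr; apply: eq_bigr => f _.
    by rewrite [Gi f e]Gis -mulrA; congr (_ * _); rewrite mulrC.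
  rewrite exchange_big; apply: eq_bigr => f _ /=.
  by rewrite /P [(_ *m Gi) _ _]mulmxE mulr_suml.
rewrite !key opprD -mulrN -Ya; congr (_ + _).
rewrite -sumrN exchange_big /=; apply: eq_bigr => c _.
rewrite -sumrN; apply: eq_bigr => f _.
rewrite Pa mulNr (pair_symmetry lowered_skew_first lowered_skew_last lowered_bianchi d f b c)//.
Qed.

Lemma cky_contraction d b :
  - (\sum_c \sum_a Gi c a * (F d c *m Y + Y *m (F d c)^T) a b) =
  (n%:R - 2) * h d b + G d b * (\sum_c \sum_a Gi c a * h c a)
  - \sum_c \sum_a Gi c a * W c d a b.
Proof.
have GG : \sum_c \sum_a Gi c a * G a c = n%:R.
  rewrite (eq_bigr (fun=> 1)) ?sumr_const ?card_ord// => c _.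
  by rewrite Gid eqxx.
have e1 : \sum_c \sum_a Gi c a * (G a c * h d b) = n%:R * h d b.
  by rewrite -GG mulr_suml; apply: eq_bigr => c _; rewrite mulr_suml; apply: eq_bigr => a _; rewrite mulrA.
have e2 : \sum_c \sum_a Gi c a * (h d a * G b c) = h d b.
  rewrite exchange_big -[RHS](sum_delta (h d)); apply: eq_bigr => a _ /=.
  rewrite -Gid mulr_sumr; apply: eq_bigr => c _.
  by rewrite [Gi c a]Gis [G b c]Gs mulrCA.
have e3 : \sum_c \sum_a Gi c a * (G a d * h c b) = h d b.
  rewrite -[RHS](sum_delta (h^~ b)); apply: eq_bigr => c _.
  by rewrite -Gid mulrC mulr_suml; apply: eq_bigr => a _; rewrite mulrA.
have e4 : \sum_c \sum_a Gi c a * (h c a * G b d) = G d b * \sum_c \sum_a Gi c a * h c a.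
  rewrite mulrC mulr_suml; apply: eq_bigr => c _; rewrite mulr_suml; apply: eq_bigr => a _.
  by rewrite mulrA [G b d]Gs.
have e5 : \sum_c \sum_a Gi c a * W d c a b = 0.
  rewrite (eq_bigr (fun c => \sum_a Gi c a * (\matrix_(x, y) W d x y b) c a)).
    by apply: skew_sum0 => // i j; rewrite !mxE W2.
  by move=> c _; apply: eq_bigr => a _; rewrite mxE.
have E : - (\sum_c \sum_a Gi c a * (F d c *m Y + Y *m (F d c)^T) a b) =
   \sum_c \sum_a (Gi c a * (G a c * h d b) - Gi c a * (h d a * G b c)
     - Gi c a * (G a d * h c b) + Gi c a * (h c a * G b d) + Gi c a * W d c a b
     - Gi c a * W c d a b).
  rewrite -sumrN; apply: eq_bigr => c _; rewrite -sumrN; apply: eq_bigr => a _.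
  by rewrite -mulrN Q; move: (Gi c a) => x; ring.
rewrite E.
under eq_bigr do rewrite sumrB big_split big_split /= sumrB sumrB.
rewrite sumrB big_split big_split /= sumrB sumrB e1 e2 e3 e4 e5.
by move: (h d b) (\sum_c \sum_a Gi c a * W c d a b) (G d b * _) => x y z; ring.
Qed.

(** Symmetrizing [cky_contraction] in [d] and [b] removes the curvature by
    [curvature_contraction_skew] and the [W] term by antisymmetry ([V]), which leaves [S]. The trace
    of [S] is 4(n - 1) [tau], so the divergence [tau] vanishes, and the nonzero factor n - 2 can be
    cancelled in [S]. *)
Lemma killing_of_cky d b : h d b + h b d = 0.
Proof.
have [tau tauE] : {t : R | t = \sum_c \sum_a Gi c a * h c a} by eexists.
have V d' b' : \sum_c \sum_a Gi c a * W c d' a b' = - \sum_c \sum_a Gi c a * W c b' a d'.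
  rewrite -sumrN; apply: eq_bigr => c _; rewrite -sumrN; apply: eq_bigr => a _.
  by rewrite -mulrN; congr (_ * _); rewrite W2 W1 W2 opprK.
have S d' b' : (n%:R - 2) * (h d' b' + h b' d') + 2 * G d' b' * tau = 0.
  have := cky_contraction d' b'; have := cky_contraction b' d'.
  rewrite (curvature_contraction_skew d' b') (V d' b') (Gs b' d') -tauE.
  move: (\sum_c \sum_a Gi c a * (F b' c *m Y + Y *m (F b' c)^T) a d') (\sum_c \sum_a Gi c a * W _ _ _ _)
    (G d' b') (h d' b') (h b' d') (tau) (n%:R : R) => x1 x2 x3 x4 x5 x6 x7 k1 k2.
  have -> : (x7 - 2) * (x4 + x5) + 2 * x3 * x6 = ((x7 - 2) * x4 + x3 * x6 - (- x2)) + ((x7 - 2) * x5 + x3 * x6 - x2) by ring.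
  by rewrite -k1 -k2; ring.
have n2 : (n%:R - 2 : R) != 0.
  by rewrite gt_eqF// subr_gt0 ltr_nat.
have tau0 : tau = 0.
  have GG : \sum_c \sum_a Gi c a * G c a = n%:R.
    rewrite (eq_bigr (fun=> 1)) ?sumr_const ?card_ord// => c _.
    transitivity ((c == c)%:R : R); last by rewrite eqxx.
    by rewrite -Gid; apply: eq_bigr => a _; rewrite [G c a]Gs.
  have T : \sum_c \sum_a Gi c a * h a c = tau.
    by rewrite tauE exchange_big /=; apply: eq_bigr => c _; apply: eq_bigr => a _; rewrite [Gi a c]Gis.
  have : \sum_c \sum_a Gi c a * ((n%:R - 2) * (h c a + h a c) + 2 * G c a * tau) = 0.
    by rewrite big1// => c _; rewrite big1// => a _; rewrite S mulr0.
  rewrite (eq_bigr (fun c => (n%:R - 2) * (\sum_a Gi c a * h c a) +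
    (n%:R - 2) * (\sum_a Gi c a * h a c) + 2 * tau * (\sum_a Gi c a * G c a))); last first.
    move=> c _; rewrite !mulr_sumr -!big_split /=; apply: eq_bigr => a _.
    by move: (Gi c a) (h c a) (h a c) (G c a) => x1 x2 x3 x4; ring.
  rewrite !big_split /= -!mulr_sumr GG T -tauE => E.
  have : (n%:R - 1) * 4 * tau = 0 by rewrite -E; ring.
  move/eqP; rewrite !mulf_eq0 pnatr_eq0 /= orbF => /orP[|/eqP//].
  by rewrite gt_eqF// subr_gt0 ltr1n (leq_trans _ n3).
have := S d b; rewrite tau0 mulr0 addr0 => /eqP.
by rewrite mulf_eq0 (negbTE n2) => /eqP.
Qed.

End CurvatureAlgebra.

Lemma commutator_antisym (V : zmodType) (x y a b : V) :
  x - y - (a - b) = - (y - x - (b - a)).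
Proof. by rewrite !opprB addrC. Qed.

Section MatrixIdentities.
Variables (R : comNzRingType) (n : nat).

Lemma trmxB_aux m k (M N : 'M[R]_(m, k)) : (M - N)^T = M^T - N^T.
Proof. by apply/matrixP => i j; rewrite !mxE. Qed.

Lemma trmxD_aux m k (M N : 'M[R]_(m, k)) : (M + N)^T = M^T + N^T.
Proof. by apply/matrixP => i j; rewrite !mxE. Qed.

Lemma ricci_identity_alg (P X Y A B D E T : 'M[R]_n) :
  (P - (X *m T + B *m D) - (D *m B^T + T *m X^T) - A *m (E - B *m T - T *m B^T)
     - (E - B *m T - T *m B^T) *m A^T)
  - (P - (Y *m T + A *m E) - (E *m A^T + T *m Y^T) - B *m (D - A *m T - T *m A^T)
     - (D - A *m T - T *m A^T) *m B^T)
  = - ((X - Y - (A *m B - B *m A)) *m T + T *m (X - Y - (A *m B - B *m A))^T).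
Proof.
rewrite !trmxB_aux !trmx_mul !(mulmxBl, mulmxBr, mulmxDl, mulmxDr, mulmxN, mulNmx) !mulmxA.
move: (X *m T) (B *m D) (D *m B^T) (T *m X^T) (A *m E) (A *m B *m T) (A *m T *m B^T)
  (E *m A^T) (B *m T *m A^T) (T *m B^T *m A^T) (Y *m T) (T *m Y^T) (B *m A *m T)
  (T *m A^T *m B^T) => x1 x2 x3 x4 x5 x6 x7 x8 x9 x10 x11 x12 x13 x14.
apply/matrixP => i j; rewrite !mxE; ring.
Qed.

Lemma wedge_derivative_alg (gc x dx s : 'cV[R]_n) (A : 'M[R]_n) :
  (((A *m gc + s) *m x^T + gc *m dx^T) - (dx *m gc^T + x *m (A *m gc + s)^T))
  - A *m (gc *m x^T - x *m gc^T) - (gc *m x^T - x *m gc^T) *m A^T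
  = (s *m x^T - x *m s^T) + (gc *m (dx - A *m x)^T - (dx - A *m x) *m gc^T).
Proof.
rewrite !trmxB_aux !trmxD_aux !trmx_mul !(mulmxBl, mulmxBr, mulmxDl, mulmxDr, mulmxN, mulNmx) !mulmxA.
move: (A *m gc *m x^T) (s *m x^T) (gc *m dx^T) (dx *m gc^T) (x *m gc^T *m A^T)
  (x *m s^T) (A *m x *m gc^T) (gc *m x^T *m A^T) => x1 x2 x3 x4 x5 x6 x7 x8.
apply/matrixP => i j; rewrite !mxE; ring.
Qed.

End MatrixIdentities.

Section CurvatureIdentities.
Variables (R : realType) (n : nat) (U : set 'rV[R]_n) (g : 'rV[R]_n -> 'M[R]_n).
Hypotheses (oU : open U) (mg : metric_on U g).

Lemma curv_antisym d c v : curv g d c v = - curv g c d v.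
Proof. exact: commutator_antisym. Qed.

Lemma bianchi_alg (x1 x2 x3 y1 y2 y3 x1' x2' x3' y1' y2' y3' : R) :
  x1 = x1' -> x2 = x2' -> x3 = x3' -> y1 = y1' -> y2 = y2' -> y3 = y3' ->
  (x1 - x2 - (y1 - y2)) + (x2' - x3 - (y3 - y1')) + (x3' - x1' - (y2' - y3')) = 0.
Proof. move=> -> -> -> -> -> ->; ring. Qed.

Lemma mxd_conn_sym d c a e v : U v -> mxd d (conn g c) v a e = mxd d (conn g a) v c e.
Proof.
move=> Uv; have E : pd d (entry (conn g c) a e) v = pd d (entry (conn g a) c e) v.
  exact: (pd_ext d oU (fun w Uw => conn_torsion oU mg c a e Uw) Uv).
exact: (etrans (mxdE _ _ _ _ _) (etrans E (esym (mxdE _ _ _ _ _)))).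
Qed.

Lemma conn_mul_sym d a c e v : U v ->
  (conn g d v *m conn g c v) a e = (conn g a v *m conn g c v) d e.
Proof.
move=> Uv; apply: (etrans (mulmxE _ _ _ _)); apply: (etrans _ (esym (mulmxE _ _ _ _))).
apply: eq_bigr => l _; exact: (congr1 (fun x : R => x * conn g c v l e) (conn_torsion oU mg d a l Uv)).
Qed.

Lemma curv_entryE d c a e v : curv g d c v a e =
  mxd d (conn g c) v a e - mxd c (conn g d) v a e
  - ((conn g d v *m conn g c v) a e - (conn g c v *m conn g d v) a e).
Proof.
apply: (etrans (mx_subE _ _ _ _)).
exact: (congr2 (fun x y : R => x - y) (mx_subE _ _ _ _) (mx_subE _ _ _ _)).
Qed.

(** Because the connection is torsion-free, the six derivative terms and the six quadratic terms of
    the cyclic sum cancel in pairs. *)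
Lemma curv_bianchi d c a e v : U v ->
  curv g d c v a e + curv g c a v d e + curv g a d v c e = 0.
Proof.
move=> Uv.
have B := bianchi_alg (mxd_conn_sym d c a e Uv) (mxd_conn_sym c d a e Uv)
  (mxd_conn_sym a c d e Uv) (conn_mul_sym d a c e Uv) (conn_mul_sym c a d e Uv)
  (conn_mul_sym c d a e Uv).
apply: etrans B; apply: (congr2 +%R); last exact: curv_entryE.
apply: (congr2 +%R); exact: curv_entryE.
Qed.

(** * The Killing field of a CKY 2-form *)

Section TwoTensor.
Variable T : 'rV[R]_n -> 'M[R]_n.
Hypothesis sT : smooth_mx_on U T.

Definition nab (T : 'rV[R]_n -> 'M[R]_n) c v : 'M[R]_n :=
  mxd c T v - conn g c v *m T v - T v *m (conn g c v)^T.

Lemma nabla2E c a b v : nabla2 g T c a b v = nab T c v a b.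
Proof.
rewrite /nab !mx_subE !mulmxE mxdE /nabla2; congr (_ - _ - _).
  by apply: eq_bigr => d _; rewrite conn_entryE.
by apply: eq_bigr => d _; rewrite trmx_entry conn_entryE mulrC.
Qed.

(** The index [c] is treated as a mere label: its Christoffel term is left out. Being symmetric in
    [d] and [c], that term would cancel in the commutator anyway. *)
Definition dnab (N : 'I_n -> 'rV[R]_n -> 'M[R]_n) d c v : 'M[R]_n :=
  mxd d (N c) v - conn g d v *m N c v - N c v *m (conn g d v)^T.

Lemma smooth_nab c : smooth_mx_on U (nab T c).
Proof.
have sA := smooth_conn oU mg c.
apply: (smooth_mx_sub oU); last exact: (smooth_mx_mul oU sT (smooth_mx_tr sA)).
exact: (smooth_mx_sub oU (smooth_mx_mxd c sT) (smooth_mx_mul oU sA sT)).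
Qed.

Lemma ricci_identity d c v : U v ->
  dnab (nab T) d c v - dnab (nab T) c d v =
  - (curv g d c v *m T v + T v *m (curv g d c v)^T).
Proof.
move=> Uv.
have E d' c' : dnab (nab T) d' c' v =
  mxd d' (mxd c' T) v - (mxd d' (conn g c') v *m T v + conn g c' v *m mxd d' T v)
    - (mxd d' T v *m (conn g c' v)^T + T v *m (mxd d' (conn g c') v)^T)
    - conn g d' v *m nab T c' v - nab T c' v *m (conn g d' v)^T.
  have sA := smooth_conn oU mg c'.
  have sAt := smooth_mx_tr sA.
  have sAT := smooth_mx_mul oU sA sT.
  have sTA := smooth_mx_mul oU sT sAt.
  rewrite /dnab {1}/nab.
  rewrite (mxdB d' (smooth_mx_sub oU (smooth_mx_mxd c' sT) sAT) sTA Uv).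
  rewrite (mxdB d' (smooth_mx_mxd c' sT) sAT Uv).
  by rewrite (mxd_mul oU d' sA sT Uv) (mxd_mul oU d' sT sAt Uv) mxd_tr.
rewrite !E (mxd_comm oU c d sT Uv).
exact: ricci_identity_alg.
Qed.

End TwoTensor.

End CurvatureIdentities.

Section KillingField.
Variables (R : realType) (n : nat) (U : set 'rV[R]_n) (g Y : 'rV[R]_n -> 'M[R]_n) (Lam : R).
Hypotheses (n3 : (3 <= n)%N) (oU : open U) (mg : metric_on U g).
Hypotheses (sY : smooth_mx_on U Y) (Yskew : forall v, U v -> (Y v)^T = - Y v).
Hypothesis ckyY : cky_eq_on U g Y.
Hypothesis einst : forall v, U v -> ricci g v = Lam *: g v.

Definition cky_cov v : 'cV[R]_n := \col_a cky_form g Y a v.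

Lemma smooth_cky_cov : smooth_mx_on U cky_cov.
Proof.
move=> a j; have -> : entry cky_cov a j = fun v => (n%:R - 1)^-1 *
  \sum_(b < n) \sum_(c < n) entry (fun w => invmx (g w)) b c v * entry (nab g Y c) b a v.
  apply/funext => v; rewrite /entry mxE /cky_form; congr (_ * _).
  by apply: eq_bigr => b _; apply: eq_bigr => c _; rewrite nabla2E.
apply: (smoothM oU); first exact: smooth_cst.
apply: (smooth_sum oU) => b _; apply: (smooth_sum oU) => c _.
exact: (smoothM oU (smooth_invg oU mg b c) (smooth_nab oU mg sY c b a)).
Qed.

Definition cov_d d v : 'cV[R]_n := mxd d cky_cov v - conn g d v *m cky_cov v.

Let colg c w : 'cV[R]_n := col c (g w).
Let N0 c w : 'M[R]_n := colg c w *m (cky_cov w)^T - cky_cov w *m (colg c w)^T.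
(** The remainder z of the CKY equation, defined by subtraction rather than taken from the pointwise
    existence statement, so that it is smooth and can be differentiated. *)
Let Zm c w : 'M[R]_n := nab g Y c w - N0 c w.

Let scolg c : smooth_mx_on U (colg c).
Proof.
move=> i j; have -> : entry (colg c) i j = entry g i c.
  by apply/funext => w; rewrite /entry mxE.
exact: (metric_smooth mg).
Qed.

Let sN0 c : smooth_mx_on U (N0 c).
Proof.
apply: (smooth_mx_sub oU).
  exact: (smooth_mx_mul oU (scolg c) (smooth_mx_tr smooth_cky_cov)).
exact: (smooth_mx_mul oU smooth_cky_cov (smooth_mx_tr (scolg c))).
Qed.

Let sZm c : smooth_mx_on U (Zm c).
Proof. exact: (smooth_mx_sub oU (smooth_nab oU mg sY c) (sN0 c)). Qed.

Let outerE (x y : 'cV[R]_n) a b : (x *m y^T) a b = x a 0 * y b 0.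
Proof. by rewrite mulmxE big_ord1 trmx_entry. Qed.

Lemma remainder_antisym c a b v : U v ->
  Zm c v a b = - Zm c v b a /\ Zm c v a b = - Zm a v c b.
Proof.
move=> Uv; have [z [za zE]] := ckyY Uv.
have E c' a' b' : Zm c' v a' b' = z a' b' c'.
  have N0E : N0 c' v a' b' = g v c' a' * cky_form g Y b' v - g v c' b' * cky_form g Y a' v.
    apply: (etrans (mx_subE _ _ _ _)); rewrite (metric_sym mg c' a' Uv) (metric_sym mg c' b' Uv).
    apply: (congr2 (fun x y : R => x - y)); apply: (etrans (outerE _ _ _ _)).
      by congr (_ * _); rewrite mxE.
    by rewrite mulrC; congr (_ * _); rewrite mxE.
  have NE := etrans (esym (nabla2E g Y c' a' b' v)) (zE a' b' c').
  apply: (etrans (mx_subE _ _ _ _)); rewrite NE N0E.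
  by move: (g v c' a' * _) (g v c' b' * _) (z a' b' c') => x1 x2 x3; ring.
rewrite !E; have [h1 _] := za a b c; split=> //.
by rewrite h1 (za b a c).2 (za b c a).1 !opprK.
Qed.

(** The full covariant derivative of z. Unlike in [dnab], the index [c] gets its Christoffel term,
    since [W] has to inherit the antisymmetry between [c] and [a]. *)
Let W d c a b v := dnab g Zm d c v a b - \sum_m conn g d v c m * Zm m v a b.

Let WE d c a b v : W d c a b v = pd d (entry (Zm c) a b) v
  - \sum_h conn g d v a h * Zm c v h b - \sum_h Zm c v a h * (conn g d v)^T h b
  - \sum_m conn g d v c m * Zm m v a b.
Proof.
apply: (congr2 (fun x y : R => x - y)) => //; apply: (etrans (mx_subE _ _ _ _)).
apply: (congr2 (fun x y : R => x - y)); last exact: mulmxE.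
apply: (etrans (mx_subE _ _ _ _)).
by apply: (congr2 (fun x y : R => x - y)); [exact: mxdE|exact: mulmxE].
Qed.

Let W1 d c a b v : U v -> W d c a b v = - W d c b a v.
Proof.
move=> Uv; have Z c' a' b' := (@remainder_antisym c' a' b' v Uv).1.
rewrite !WE.
have -> : pd d (entry (Zm c) a b) v = - pd d (entry (Zm c) b a) v.
  rewrite -(pdN (smooth_on_derivable (sZm c b a) Uv)).
  apply: (pd_ext _ oU) => // w Uw; exact: (remainder_antisym c a b Uw).1.
have -> : \sum_h conn g d v a h * Zm c v h b = - \sum_h Zm c v b h * (conn g d v)^T h a.
  by rewrite -sumrN; apply: eq_bigr => h _; rewrite Z mulrN trmx_entry mulrC.
have -> : \sum_h Zm c v a h * (conn g d v)^T h b = - \sum_h conn g d v b h * Zm c v h a.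
  by rewrite -sumrN; apply: eq_bigr => h _; rewrite Z mulNr trmx_entry mulrC.
have -> : \sum_m conn g d v c m * Zm m v a b = - \sum_m conn g d v c m * Zm m v b a.
  by rewrite -sumrN; apply: eq_bigr => h _; rewrite Z mulrN.
move: (pd d _ v) (\sum_m _) (\sum_m _) (\sum_m _) => x1 x2 x3 x4; ring.
Qed.

Let W2 d c a b v : U v -> W d c a b v = - W d a c b v.
Proof.
move=> Uv; have Z c' a' b' := (@remainder_antisym c' a' b' v Uv).2.
rewrite !WE.
have -> : pd d (entry (Zm c) a b) v = - pd d (entry (Zm a) c b) v.
  rewrite -(pdN (smooth_on_derivable (sZm a c b) Uv)).
  apply: (pd_ext _ oU) => // w Uw; exact: (remainder_antisym c a b Uw).2.
have -> : \sum_h conn g d v a h * Zm c v h b = - \sum_m conn g d v a m * Zm m v c b.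
  by rewrite -sumrN; apply: eq_bigr => h _; rewrite Z mulrN.
have -> : \sum_m conn g d v c m * Zm m v a b = - \sum_h conn g d v c h * Zm a v h b.
  by rewrite -sumrN; apply: eq_bigr => h _; rewrite Z mulrN.
have -> : \sum_h Zm c v a h * (conn g d v)^T h b = - \sum_h Zm a v c h * (conn g d v)^T h b.
  by rewrite -sumrN; apply: eq_bigr => h _; rewrite Z mulNr.
move: (pd d _ v) (\sum_m _) (\sum_m _) (\sum_m _) => x1 x2 x3 x4; ring.
Qed.

(** The Christoffel term that belongs to the column index [c] of the metric. It is symmetric in [d]
    and [c] and hence invisible in the commutator. *)
Let sd d c v := g v *m (row c (conn g d v))^T.

Let dN0 d c v : U v -> dnab g N0 d c v =
  (sd d c v *m (cky_cov v)^T - cky_cov v *m (sd d c v)^T)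
  + (colg c v *m (cov_d d v)^T - cov_d d v *m (colg c v)^T).
Proof.
move=> Uv; have sx := smooth_cky_cov; have sc := scolg c.
have stx := smooth_mx_tr sx; have stc := smooth_mx_tr sc.
have dcol : mxd d (colg c) v = conn g d v *m colg c v + sd d c v.
  have -> : mxd d (colg c) v = col c (mxd d g v).
    apply/colP => i; rewrite mxdE [RHS]mxE mxdE; congr (pd d _ v).
    by apply/funext => w; rewrite /entry mxE.
  rewrite (metric_compat oU mg d Uv) /sd /colg.
  apply/colP => i; rewrite [LHS]mxE !mx_addE !mulmxE; congr (_ + _).
    by apply: eq_bigr => l _; congr (_ * _); rewrite [RHS]mxE.
  by apply: eq_bigr => l _; congr (_ * _); rewrite !trmx_entry [RHS]mxE.
rewrite /dnab {1}/N0 (mxdB d (smooth_mx_mul oU sc stx) (smooth_mx_mul oU sx stc) Uv).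
rewrite (mxd_mul oU d sc stx Uv) (mxd_mul oU d sx stc Uv) !mxd_tr dcol.
exact: wedge_derivative_alg.
Qed.

Let sd_sym d c v : U v -> sd d c v = sd c d v.
Proof. by move=> Uv; rewrite /sd (row_conn oU mg). Qed.

Let dnabZ d c v : U v -> dnab g (nab g Y) d c v = dnab g N0 d c v + dnab g Zm d c v.
Proof.
move=> Uv; rewrite /dnab.
have E w : nab g Y c w = N0 c w + Zm c w by rewrite /Zm addrC subrK.
have -> : mxd d (nab g Y c) v = mxd d (N0 c) v + mxd d (Zm c) v.
  rewrite -(mxdD d (sN0 c) (sZm c) Uv); congr (mxd d _ v).
  by apply/funext => w; exact: E.
rewrite E mulmxDr mulmxDl.
move: (mxd d _ v) (mxd d _ v) (conn g d v *m _) (conn g d v *m _) (_ *m (conn g d v)^T) (_ *m (conn g d v)^T) => x1 x2 x3 x4 x5 x6.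
apply/matrixP => i j; rewrite !mxE; ring.
Qed.

Let dnab_nabE a b d c v : U v -> dnab g (nab g Y) d c v a b =
  (sd d c v *m (cky_cov v)^T - cky_cov v *m (sd d c v)^T) a b
  + (g v a c * cov_d d v b 0 - cov_d d v a 0 * g v b c) + dnab g Zm d c v a b.
Proof.
move=> Uv; have cE i j : colg i v j 0 = g v j i by rewrite /colg mxE.
have E1 := congr1 (fun M : 'M[R]_n => M a b) (dnabZ d c Uv).
have E2 := congr1 (fun M : 'M[R]_n => M a b) (dN0 d c Uv).
apply: (etrans E1); apply: (etrans (mx_addE _ _ _ _)).
apply: (congr2 +%R) => //; apply: (etrans E2); apply: (etrans (mx_addE _ _ _ _)).
apply: (congr2 +%R) => //; apply: (etrans (mx_subE _ _ _ _)).
apply: (congr2 (fun x y : R => x - y)); apply: (etrans (outerE _ _ _ _)).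
  by rewrite cE.
by rewrite cE.
Qed.

Lemma cky_q_alg (s p1 q1 p2 q2 k1 k2 m : R) :
  (s + (p1 - q1) + k1) - (s + (p2 - q2) + k2) =
  p1 - q1 - p2 + q2 + (k1 - m) - (k2 - m).
Proof. ring. Qed.

Theorem cky_killing d b v : U v -> cov_d d v b 0 + cov_d b v d 0 = 0.
Proof.
move=> Uv.
have gu := metric_unit mg Uv.
apply: (@killing_of_cky _ _ (g v) (invmx (g v)) (Y v) (fun d c => curv g d c v) Lam
  (fun d c a b => W d c a b v) (fun d b => cov_d d v b 0) n3).
- by move=> i j; exact: (metric_sym mg i j Uv).
- by move=> i j; exact: (ginv_sym mg i j Uv).
- by rewrite mulmxV.
- by rewrite mulVmx.
- by move=> i j; have := congr1 (fun M : 'M[R]_n => M j i) (Yskew Uv); rewrite !mxE.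
- by move=> d' c; exact: curv_antisym.
- by move=> d' c; exact: (curv_metric_skew oU mg).
- by move=> *; exact: (curv_bianchi oU mg).
- move=> j k; rewrite -ricci_curv einst// mxE.
  by [].
- by move=> *; exact: W1.
- by move=> *; exact: W2.
- move=> d' c a b'.
  have H := congr1 (fun M : 'M[R]_n => M a b') (ricci_identity oU mg sY d' c Uv).
  have oppE : (- (curv g d' c v *m Y v + Y v *m (curv g d' c v)^T)) a b' =
    - (curv g d' c v *m Y v + Y v *m (curv g d' c v)^T) a b' by rewrite mxE.
  apply: (etrans (esym (etrans H oppE))).
  have E := dnab_nabE a b' d' c Uv; have E' := dnab_nabE a b' c d' Uv.
  rewrite (sd_sym c d' Uv) in E'.
  apply: (etrans (mx_subE _ _ _ _)); apply: (etrans (congr2 (fun x y : R => x - y) E E')).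
  rewrite /W.
  have -> : \sum_m conn g c v d' m * Zm m v a b' = \sum_m conn g d' v c m * Zm m v a b'.
    by apply: eq_bigr => m _; rewrite (conn_torsion oU mg c d' m Uv).
  exact: cky_q_alg.
Qed.

End KillingField.

(** * Conformal change of the metric *)

Section LieDerivative.
Variables (R : realType) (n : nat) (U : set 'rV[R]_n) (g : 'rV[R]_n -> 'M[R]_n).
Hypotheses (oU : open U) (mg : metric_on U g).
Variables (X : 'rV[R]_n -> 'rV[R]_n) (x : 'rV[R]_n -> 'cV[R]_n).
Hypotheses (sX : smooth_mx_on U X) (xE : forall v, U v -> x v = g v *m (X v)^T).

Definition cov_form (x : 'rV[R]_n -> 'cV[R]_n) d v : 'cV[R]_n :=
  mxd d x v - conn g d v *m x v.

Lemma cov_formE a b v : U v -> cov_form x a v b 0 = \sum_c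
  (pd a (entry g b c) v * X v 0 c + g v b c * pd a (entry X 0 c) v
   - 2^-1 * (pd a (entry g b c) v + pd b (entry g a c) v - pd c (entry g a b) v) * X v 0 c).
Proof.
move=> Uv.
have E1 : mxd a x v b 0 = \sum_c (pd a (entry g b c) v * X v 0 c + g v b c * pd a (entry X 0 c) v).
  have := mxd_ext oU a xE Uv.
  rewrite (mxd_mul oU a (metric_smooth mg) (smooth_mx_tr sX) Uv) mxd_tr => ->.
  apply: (etrans (mx_addE _ _ _ _)).
  apply: (etrans (congr2 +%R (mulmxE _ _ _ _) (mulmxE _ _ _ _))).
  rewrite -big_split; apply: eq_bigr => c _.
  apply: (congr2 +%R); apply: (congr2 *%R) => //.
  - exact: mxdE.
  - exact: trmx_entry.
  - exact: (etrans (trmx_entry _ _ _) (mxdE _ _ _ _ _)).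
have E2 : (conn g a v *m x v) b 0 = \sum_c 2^-1 *
   (pd a (entry g b c) v + pd b (entry g a c) v - pd c (entry g a b) v) * X v 0 c.
  rewrite (xE Uv) mulmxA (conn_lowE mg a Uv).
  apply: (etrans (mulmxE _ _ _ _)); apply: eq_bigr => c _.
  apply: (congr2 *%R); last exact: trmx_entry.
  rewrite mxE (pd_metric_sym oU mg a c b Uv) (pd_metric_sym oU mg b c a Uv).
  by [].
rewrite sumrB -E1 -E2; exact: mx_subE.
Qed.

Lemma lie2_metric v a b : U v -> lie2 X g v a b = cov_form x a v b 0 + cov_form x b v a 0.
Proof.
move=> Uv; rewrite (cov_formE a b Uv) (cov_formE b a Uv) -big_split.
apply: (etrans (mxE _ _ _ _)); apply: eq_bigr => c _.
have -> : g v c b = g v b c := metric_sym mg c b Uv.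
rewrite (pd_metric_sym oU mg c b a Uv) /=.
move: (pd a (entry g b c) v) (pd b (entry g a c) v) (pd c (entry g a b) v) (X v 0 c)
  (g v b c) (g v a c) (pd a (entry X 0 c) v) (pd b (entry X 0 c) v) => x1 x2 x3 x4 x5 x6 x7 x8.
by field.
Qed.

End LieDerivative.

Section ConformalAlgebra.
Variables (R : comNzRingType) (n : nat).

Lemma commutator_shift (A B Xi Xj : 'M[R]_n) (a b : R) :
  (A + (a *: 1%:M + Xi)) *m (B + (b *: 1%:M + Xj))
  - (B + (b *: 1%:M + Xj)) *m (A + (a *: 1%:M + Xi)) =
  (A *m B - B *m A) + (A *m Xj - Xj *m A) - (B *m Xi - Xi *m B) + (Xi *m Xj - Xj *m Xi).
Proof.
rewrite !scalemx1 !(mulmxDl, mulmxDr) !mul_scalar_mx !mul_mx_scalar scale_scalar_mx scale_scalar_mx.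
rewrite [b * a]mulrC.
move: (A *m B) (B *m A) (A *m Xj) (Xj *m A) (B *m Xi) (Xi *m B) (Xi *m Xj) (Xj *m Xi)
  (a *: B) (b *: A) (a *: Xj) (b *: Xi) ((a * b)%:M) => x1 x2 x3 x4 x5 x6 x7 x8 x9 x10 x11 x12 x13.
apply/matrixP => i j; rewrite !mxE; ring.
Qed.

(** Expands the curvature of a connection shifted by a scalar plus terms of rank one. The scalar
    parts commute with everything, and the terms in [uij] and [s] are common to both orders of
    differentiation. *)
Lemma conf_curv_alg (Xm Ym A B : 'M[R]_n) (uij ui uj : R) (U0 dUi dUj gi gj s : 'cV[R]_n)
    (di dj P dPi dPj Qi Qj : 'rV[R]_n) :
  dj *m A = di *m B -> dPi + P *m A = Qi -> dPj + P *m B = Qj ->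
  (Xm + (uij *: 1%:M + dUi *m dj - ((A *m gj + s) *m P + gj *m dPi)))
  - (Ym + (uij *: 1%:M + dUj *m di - ((B *m gi + s) *m P + gi *m dPj)))
  - ((A + (ui *: 1%:M + (U0 *m di - gi *m P))) *m (B + (uj *: 1%:M + (U0 *m dj - gj *m P)))
     - (B + (uj *: 1%:M + (U0 *m dj - gj *m P))) *m (A + (ui *: 1%:M + (U0 *m di - gi *m P)))) =
  (Xm - Ym - (A *m B - B *m A)) +
  ((dUi - A *m U0) *m dj - (dUj - B *m U0) *m di - gj *m Qi + gi *m Qj
   - ((U0 *m di - gi *m P) *m (U0 *m dj - gj *m P) - (U0 *m dj - gj *m P) *m (U0 *m di - gi *m P))).
Proof.
move=> h <- <-; rewrite commutator_shift.
move: ((U0 *m di - gi *m P) *m _ - _) => K.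
have hU : U0 *m dj *m A = U0 *m di *m B by rewrite -!mulmxA h.
rewrite !(mulmxBl, mulmxBr, mulmxDl, mulmxDr, mulmxN, mulNmx) !mulmxA hU.
move: (A *m B) (B *m A) (dUi *m dj) (dUj *m di) (A *m gj *m P) (B *m gi *m P) (s *m P)
  (gj *m dPi) (gi *m dPj) (A *m U0 *m dj) (U0 *m di *m B) (B *m U0 *m di) (gj *m P *m A)
  (gi *m P *m B) (uij *: 1%:M) => x1 x2 x3 x4 x5 x6 x7 x8 x9 x10 x11 x12 x13 x14 x15.
apply/matrixP => i j; rewrite !mxE; ring.
Qed.

(** To be read with [u] the differential of the conformal exponent, [P] its gradient, [H] its
    Hessian, [Qf] the Hessian with one index raised, [N] the squared norm and [tr] the Laplacian. *)
Lemma conf_trace (G : 'M[R]_n) (u P : 'I_n -> R) (H Qf : 'I_n -> 'I_n -> R) (N tr : R) j k :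
  (forall a b, G a b = G b a) ->
  (forall a, \sum_i G a i * P i = u a) -> \sum_l P l * u l = N ->
  \sum_i G k i * Qf j i = H j k -> \sum_i Qf i i = tr ->
  let X c a b := u a * (b == c)%:R - G a c * P b in
  \sum_i (H i k * (i == j)%:R - H j k - G k j * Qf i i + G k i * Qf j i
     - (\sum_l X i k l * X j l i - \sum_l X j k l * X i l i)) =
  - (n%:R - 2) * (H j k - u j * u k) - (tr + (n%:R - 2) * N) * G j k.
Proof.
move=> Gs GP PN GQ trE X.
have eX1 : \sum_i \sum_l X i k l * X j l i = u j * u k - N * G k j.
  have e i : \sum_l X i k l * X j l i =
      u k * u i * (i == j)%:R - u k * (G j i * P i) - G k i * (i == j)%:R * N + u j * (G k i * P i).
    transitivity (\sum_l (u k * u l * (i == j)%:R * (l == i)%:R - u k * (G l j * P i) * (l == i)%:R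
       - G k i * (i == j)%:R * (P l * u l) + G k i * P i * (G j l * P l))).
      by apply: eq_bigr => l _; rewrite /X (Gs j l); ring.
    rewrite big_split !sumrB /= -!mulr_sumr PN GP.
    have -> : \sum_l u k * u l * (i == j)%:R * (l == i)%:R = u k * u i * (i == j)%:R.
      exact: (sum_delta (fun l => u k * u l * (i == j)%:R) i).
    have -> : \sum_l u k * (G l j * P i) * (l == i)%:R = u k * (G i j * P i).
      exact: (sum_delta (fun l => u k * (G l j * P i)) i).
    by rewrite (Gs i j); ring.
  rewrite (eq_bigr _ (fun i _ => e i)) big_split !sumrB /= -!mulr_sumr -mulr_suml !GP.
  rewrite (sum_delta (fun i => u k * u i) j) (sum_delta (fun i => G k i) j); ring.
have eX2 : \sum_i \sum_l X j k l * X i l i = (n%:R - 1) * (u j * u k - N * G k j).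
  rewrite exchange_big /=.
  have e l : \sum_i X j k l * X i l i = X j k l * ((n%:R - 1) * u l).
    rewrite -mulr_sumr; congr (_ * _); rewrite /X sumrB GP.
    have -> : \sum_(i < n) u l * (i == i)%:R = u l *+ n.
      by rewrite -[in RHS](card_ord n) -sumr_const; apply: eq_bigr => i _; rewrite eqxx mulr1.
    by rewrite -[u l *+ n]mulr_natl mulrBl mul1r.
  rewrite (eq_bigr _ (fun l _ => e l)).
  transitivity (\sum_l ((n%:R - 1) * u k * u l * (l == j)%:R - (n%:R - 1) * G k j * (P l * u l))).
    by apply: eq_bigr => l _; rewrite /X; ring.
  rewrite sumrB -!mulr_sumr PN (sum_delta (fun l => (n%:R - 1) * u k * u l) j); ring.
rewrite sumrB big_split /= !sumrB eX1 eX2 (sum_delta (fun i => H i k) j) GQ -mulr_sumr trE.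
by rewrite sumr_const card_ord -[H j k *+ n]mulr_natl (Gs j k); ring.
Qed.

End ConformalAlgebra.

Section Conformal.
Variables (R : realType) (n : nat) (U : set 'rV[R]_n) (g : 'rV[R]_n -> 'M[R]_n).
Variable u : 'rV[R]_n -> R.
Hypotheses (oU : open U) (mg : metric_on U g) (su : smooth_on U u).

Let E v := expR (2 * u v).

Lemma smooth_conf_factor : smooth_on U E.
Proof. exact: (smooth_expR oU (smoothM oU (smooth_cst _) su)). Qed.

Lemma pd_conf_factor c v : U v -> pd c E v = E v * (2 * pd c u v).
Proof.
move=> Uv.
have d2 : derivable (fun w => 2 * u w) v (delta_mx 0 c).
  exact: (smooth_on_derivable (smoothM oU (smooth_cst (W := U) 2) su) Uv).
have [_ ->] := pd_comp1 d2 (is_derive_expR (2 * u v)).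
by congr (_ * _); exact: (pdZ (smooth_on_derivable su Uv)).
Qed.

Lemma conf_factor_gt0 v : 0 < E v. Proof. exact: expR_gt0. Qed.

Lemma conf_metric : metric_on U (conf g u).
Proof.
split; first exact: (smooth_mx_scale oU smooth_conf_factor (metric_smooth mg)).
move=> v Uv; split.
  by rewrite /conf; apply/matrixP => i j; rewrite !mxE; congr (_ * _); exact: (metric_sym mg j i Uv).
rewrite /conf unitmxZ; first exact: (metric_unit mg Uv).
by rewrite unitfE gt_eqF// conf_factor_gt0.
Qed.

Lemma pd_conf c a b v : U v -> pd c (entry (conf g u) a b) v =
  E v * (2 * pd c u v * g v a b + pd c (entry g a b) v).
Proof.
move=> Uv.
have -> : entry (conf g u) a b = fun w => E w * entry g a b w by exact: entry_scale.
rewrite (pdM (smooth_on_derivable smooth_conf_factor Uv)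
  (smooth_on_derivable (metric_smooth mg a b) Uv)) pd_conf_factor// mulrDr /entry.
by rewrite !mulrA.
Qed.

Lemma lie2_conf (X : 'rV[R]_n -> 'rV[R]_n) v a b : U v ->
  lie2 X (conf g u) v a b = E v * (lie2 X g v a b + 2 * vec_app X u v * g v a b).
Proof.
move=> Uv; rewrite [in LHS]mxE [lie2 X g v a b]mxE /vec_app mulrDr.
rewrite [2 * _ * _]mulrAC [2 * _ * _]mulrC !mulr_suml !mulr_sumr -big_split; apply: eq_bigr => c _.
rewrite pd_conf// !mxE -/(E v) /=.
move: (E v) (pd c u v) (pd c (entry g a b) v) (X v 0 c) (g v a b) (g v c b) (g v a c)
  (pd a _ v) (pd b _ v) => x1 x2 x3 x4 x5 x6 x7 x8 x9; ring.
Qed.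

Definition grad_cov v : 'cV[R]_n := \col_a pd a u v.

Lemma smooth_grad_cov : smooth_mx_on U grad_cov.
Proof.
move=> a j; have -> : entry grad_cov a j = pd a u by apply/funext => w; rewrite /entry mxE.
exact: smooth_on_pd.
Qed.

Let P v : 'rV[R]_n := (grad_cov v)^T *m invmx (g v).
(** The difference of the two Levi-Civita connections, with entry u_c delta^b_a + u_a delta^b_c -
    g_{ac} u^b at [(a, b)]. *)
Let C c v : 'M[R]_n := pd c u v *: 1%:M + grad_cov v *m delta_mx 0 c - col c (g v) *m P v.

Lemma conn_conf c v : U v -> conn (conf g u) c v = conn g c v + C c v.
Proof.
move=> Uv; rewrite (connE conf_metric c Uv).
have Eu : E v \is a GRing.unit by rewrite unitfE gt_eqF// conf_factor_gt0.
have -> : invmx (conf g u v) = (E v)^-1 *: invmx (g v).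
  by rewrite /conf invmxZ// unitmxZ// (metric_unit mg Uv).
have -> : conn_low (conf g u) c v = E v *: (conn_low g c v + pd c u v *: g v
   + grad_cov v *m row c (g v) - col c (g v) *m (grad_cov v)^T).
  apply/matrixP => a l; rewrite [LHS]mxE !pd_conf//.
  have outE (x : 'cV[R]_n) (y : 'rV[R]_n) : (x *m y) a l = x a 0 * y 0 l.
    by rewrite mulmxE big_ord1.
  rewrite [RHS]mxE mx_subE 2!mx_addE !outE ![(_ *: g v) _ _]mxE [conn_low g c v a l]mxE.
  rewrite ![grad_cov v _ _]mxE ![row _ _ _ _]mxE ![col _ _ _ _]mxE trmx_entry ![grad_cov v _ _]mxE.
  rewrite (metric_sym mg l a Uv) (metric_sym mg l c Uv) (metric_sym mg a c Uv).
  move: (E v) (pd c u v) (pd a u v) (pd l u v) (g v a l) (g v c l) (g v c a)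
    (pd c _ v) (pd a _ v) (pd l _ v) => x1 x2 x3 x4 x5 x6 x7 x8 x9 x10.
  by field.
rewrite -scalemxAl -scalemxAr scalerA mulrV// scale1r.
rewrite !(mulmxBl, mulmxDl) -(connE mg c Uv) /C -scalemxAl mulmxV ?(metric_unit mg Uv)//.
have -> : grad_cov v *m row c (g v) *m invmx (g v) = grad_cov v *m delta_mx 0 c.
  by rewrite -mulmxA -row_mul mulmxV ?(metric_unit mg Uv)// row1.
by rewrite /P mulmxA -!addrA.
Qed.

Let s i j v := g v *m (row j (conn g i v))^T.
Let H i v : 'cV[R]_n := mxd i grad_cov v - conn g i v *m grad_cov v.

Let scol c : smooth_mx_on U (fun w => col c (g w)).
Proof.
move=> i j; have -> : entry (fun w => col c (g w)) i j = entry g i c.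
  by apply/funext => w; rewrite /entry mxE.
exact: (metric_smooth mg).
Qed.

Let sP : smooth_mx_on U P.
Proof. exact: (smooth_mx_mul oU (smooth_mx_tr smooth_grad_cov) (smooth_invg oU mg)). Qed.

Lemma mxd_col_metric d c v : U v ->
  mxd d (fun w => col c (g w)) v = conn g d v *m col c (g v) + s d c v.
Proof.
move=> Uv; have -> : mxd d (fun w => col c (g w)) v = col c (mxd d g v).
  apply/colP => i; rewrite mxdE [RHS]mxE mxdE; congr (pd d _ v).
  by apply/funext => w; rewrite /entry mxE.
rewrite (metric_compat oU mg d Uv) /s.
apply/colP => i; rewrite [LHS]mxE !mx_addE !mulmxE; congr (_ + _).
  by apply: eq_bigr => l _; congr (_ * _); rewrite [RHS]mxE.
by apply: eq_bigr => l _; congr (_ * _); rewrite !trmx_entry [RHS]mxE.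
Qed.

(** Raising an index commutes with covariant differentiation. Differentiating [P *m g = grad_cov^T]
    avoids the derivative of the inverse metric. *)
Lemma mxd_P i v : U v -> mxd i P v + P v *m conn g i v = (H i v)^T *m invmx (g v).
Proof.
move=> Uv; have gu := metric_unit mg Uv.
have Pg w : U w -> P w *m g w = (grad_cov w)^T.
  by move=> Uw; rewrite /P mulmxKV// (metric_unit mg Uw).
have D := mxd_ext oU i Pg Uv.
rewrite (mxd_mul oU i sP (metric_smooth mg) Uv) mxd_tr (metric_compat oU mg i Uv) in D.
apply: (canRL (mulmxK gu)).
rewrite /H trmxB_aux -D trmx_mul -(Pg v Uv) mulmxDl mulmxDr !mulmxA.
by rewrite addrA addrK.
Qed.

Let dC i j v : U v -> mxd i (C j) v = pd i (pd j u) v *: 1%:M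
  + mxd i grad_cov v *m delta_mx 0 j
  - ((conn g i v *m col j (g v) + s i j v) *m P v + col j (g v) *m mxd i P v).
Proof.
move=> Uv.
have s1 : smooth_mx_on U (fun w => pd j u w *: (1%:M : 'M[R]_n)).
  exact: (smooth_mx_scale oU (smooth_on_pd j su) (@smooth_mx_cst _ _ _ _ _ _)).
have sd0 : smooth_mx_on U (fun=> delta_mx 0 j : 'rV[R]_n) by exact: smooth_mx_cst.
have s2 := smooth_mx_mul oU smooth_grad_cov sd0.
have s3 := smooth_mx_mul oU (scol j) sP.
rewrite /C (mxdB i (smooth_mx_add oU s1 s2) s3 Uv) (mxdD i s1 s2 Uv).
rewrite (mxd_scale i (smooth_on_pd j su) (@smooth_mx_cst _ _ _ _ _ _) Uv) mxd_cst scaler0 addr0.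
rewrite (mxd_mul oU i smooth_grad_cov sd0 Uv) mxd_cst mulmx0 addr0.
by rewrite (mxd_mul oU i (scol j) sP Uv) mxd_col_metric.
Qed.

Let X c v : 'M[R]_n := grad_cov v *m delta_mx 0 c - col c (g v) *m P v.

Lemma curv_conf i j v : U v -> curv (conf g u) i j v = curv g i j v +
  (H i v *m delta_mx 0 j - H j v *m delta_mx 0 i
   - col j (g v) *m ((H i v)^T *m invmx (g v)) + col i (g v) *m ((H j v)^T *m invmx (g v))
   - (X i v *m X j v - X j v *m X i v)).
Proof.
move=> Uv.
have sC c : smooth_mx_on U (C c).
  have sA := smooth_conn oU conf_metric c; have sB := smooth_conn oU mg c.
  apply: (smooth_mx_ext oU _ (smooth_mx_sub oU sA sB)) => w Uw.
  by rewrite conn_conf// addrC addKr.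
have dA a b : mxd a (conn (conf g u) b) v = mxd a (conn g b) v + mxd a (C b) v.
  rewrite -(mxdD a (smooth_conn oU mg b) (sC b) Uv).
  by apply: (mxd_ext oU) => // w Uw; exact: conn_conf.
have CE c : C c v = pd c u v *: 1%:M + X c v by rewrite /C -addrA.
rewrite /curv !dA !dC// !conn_conf// !CE (smooth_pd_comm oU j i su Uv).
have -> : s j i v = s i j v by rewrite /s (row_conn oU mg).
apply: conf_curv_alg (mxd_P i Uv) (mxd_P j Uv).
by rewrite -!rowE (row_conn oU mg).
Qed.

Lemma hess_entryE a b v : hess g u v a b = H a v b 0.
Proof.
rewrite mxE; apply/esym; apply: (etrans (mx_subE _ _ _ _)).
have e : entry grad_cov b 0 = pd b u by apply/funext => w; rewrite /entry mxE.
apply: (congr2 (fun x y : R => x - y)).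
  exact: (etrans (mxdE _ _ _ _ _) (congr1 (fun f => pd a f v) e)).
apply: (etrans (mulmxE _ _ _ _)); apply: eq_bigr => k _.
by apply: (congr2 *%R); [exact: conn_entryE|rewrite mxE].
Qed.

Lemma ricci_conf j k v : U v -> ricci (conf g u) v j k = ricci g v j k
  - (n%:R - 2) * (hess g u v j k - pd j u v * pd k u v)
  - (laplacian g u v + (n%:R - 2) * norm2_grad g u v) * g v j k.
Proof.
move=> Uv.
have gu := metric_unit mg Uv.
have gis a b : invmx (g v) a b = invmx (g v) b a by exact: (ginv_sym mg a b Uv).
have PE a : P v 0 a = \sum_b pd b u v * invmx (g v) b a.
  by apply: (etrans (mulmxE _ _ _ _)); apply: eq_bigr => b _; rewrite trmx_entry mxE.
have QE a b : ((H a v)^T *m invmx (g v)) 0 b = \sum_l hess g u v a l * invmx (g v) l b.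
  apply: (etrans (mulmxE _ _ _ _)); apply: eq_bigr => l _.
  by rewrite trmx_entry hess_entryE.
have outE (x : 'cV[R]_n) (y : 'rV[R]_n) a b : (x *m y) a b = x a 0 * y 0 b.
  by rewrite mulmxE big_ord1.
have dE (a b : 'I_n) : (delta_mx 0 a : 'rV[R]_n) 0 b = (b == a)%:R by rewrite mxE eqxx.
have XE c a b : X c v a b = pd a u v * (b == c)%:R - g v a c * P v 0 b.
  apply: (etrans (mx_subE _ _ _ _)); apply: (congr2 (fun x y : R => x - y)).
    by rewrite outE dE mxE.
  by rewrite outE mxE.
rewrite !ricci_curv.
have step i : curv (conf g u) i j v k i = curv g i j v k i +
   (hess g u v i k * (i == j)%:R - hess g u v j k
    - g v k j * ((H i v)^T *m invmx (g v)) 0 i + g v k i * ((H j v)^T *m invmx (g v)) 0 i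
    - (\sum_l (pd k u v * (l == i)%:R - g v k i * P v 0 l) * (pd l u v * (i == j)%:R - g v l j * P v 0 i)
     - \sum_l (pd k u v * (l == j)%:R - g v k j * P v 0 l) * (pd l u v * (i == i)%:R - g v l i * P v 0 i))).
  rewrite (curv_conf i j Uv); apply: (etrans (mx_addE _ _ _ _)); congr (_ + _).
  apply: (etrans (mx_subE _ _ _ _)); apply: (congr2 (fun x y : R => x - y)); last first.
    apply: (etrans (mx_subE _ _ _ _)); apply: (congr2 (fun x y : R => x - y)).
      by apply: (etrans (mulmxE _ _ _ _)); apply: eq_bigr => l _; rewrite !XE.
    by apply: (etrans (mulmxE _ _ _ _)); apply: eq_bigr => l _; rewrite !XE.
  apply: (etrans (mx_addE _ _ _ _)); congr (_ + _); last by rewrite outE mxE.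
  apply: (etrans (mx_subE _ _ _ _)); congr (_ - _); last by rewrite outE mxE.
  apply: (etrans (mx_subE _ _ _ _)); congr (_ - _).
    by rewrite outE dE hess_entryE.
  apply: (etrans (outE _ _ _ _)); apply: (etrans (congr2 *%R (esym (hess_entryE _ _ _)) (dE _ _))).
  by apply: (etrans (congr1 (fun b : bool => _ * b%:R) (eqxx i))); exact: mulr1.
apply: (etrans (eq_bigr _ (fun i _ => step i))); apply: (etrans (big_split _ _ _ _ _)).
apply/esym; apply: (etrans (esym (addrA _ _ _))); apply/esym.
apply: (congr1 (fun y => _ + y)).
have T := @conf_trace R n (g v) (fun a => pd a u v) (fun a => P v 0 a)
  (fun a b => hess g u v a b) (fun a b => ((H a v)^T *m invmx (g v)) 0 b)
  (norm2_grad g u v) (laplacian g u v) j k.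
apply: etrans (T _ _ _ _ _) _.
- by move=> a b; exact: (metric_sym mg a b Uv).
- move=> a; have : P v *m g v = (grad_cov v)^T by rewrite /P mulmxKV.
  move=> /(congr1 (fun M : 'rV[R]_n => M 0 a)); rewrite trmx_entry [RHS]mxE => <-.
  apply/esym; apply: (etrans (mulmxE _ _ _ _)); apply: eq_bigr => l _.
  by rewrite mulrC; congr (_ * _); exact: (metric_sym mg l a Uv).
- rewrite /norm2_grad exchange_big; apply: eq_bigr => b _ /=.
  rewrite PE mulr_suml; apply: eq_bigr => a _.
  by rewrite /ginv [pd a u v * _]mulrC.
- have : (H j v)^T *m invmx (g v) *m g v = (H j v)^T by rewrite mulmxKV.
  move=> /(congr1 (fun M : 'rV[R]_n => M 0 k)); rewrite trmx_entry -hess_entryE => <-.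
  apply/esym; apply: (etrans (mulmxE _ _ _ _)); apply: eq_bigr => l _.
  by rewrite mulrC; congr (_ * _); exact: (metric_sym mg l k Uv).
- rewrite /laplacian; apply: eq_bigr => i _; rewrite QE; apply: eq_bigr => l _.
  by rewrite mulrC gis.
- by rewrite mulNr.
Qed.

End Conformal.

(** * Parallel gradients *)

Section SolitonOnChart.
Variables (R : realType) (n : nat) (U : set 'rV[R]_n) (g Y : 'rV[R]_n -> 'M[R]_n).
Variables (u phi : 'rV[R]_n -> R) (lam Lam : R).
Hypotheses (n3 : (3 <= n)%N) (oU : open U) (mg : metric_on U g) (su : smooth_on U u).
Hypotheses (sY : smooth_mx_on U Y) (Yskew : forall v, U v -> (Y v)^T = - Y v).
Hypotheses (ckyY : cky_eq_on U g Y) (rs : rs_eq_on U g u Y lam).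
Hypothesis einst : forall v, U v -> ricci g v = Lam *: g v.
Hypothesis K0 : forall v, U v -> rs_K g u Y lam Lam v = 0.
Hypothesis phiE : forall v, phi v = expR (- u v).

Let n2 : (n%:R - 2 : R) != 0.
Proof. by rewrite gt_eqF// subr_gt0 ltr_nat. Qed.

Lemma cky_covE v : U v -> cky_cov g Y v = g v *m (cky_vec g Y v)^T.
Proof.
move=> Uv; have -> : (cky_vec g Y v)^T = invmx (g v) *m cky_cov g Y v.
  apply/colP => a; rewrite trmx_entry mxE; apply/esym; apply: (etrans (mulmxE _ _ _ _)).
  by apply: eq_bigr => b _; congr (_ * _); rewrite mxE.
by rewrite mulKVmx// (metric_unit mg Uv).
Qed.

Lemma smooth_cky_vec : smooth_mx_on U (cky_vec g Y).
Proof.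
apply: (smooth_mx_ext oU (T := fun v => (invmx (g v) *m cky_cov g Y v)^T)).
  by move=> w Uw; rewrite (cky_covE Uw) mulKmx ?trmxK// (metric_unit mg Uw).
apply: smooth_mx_tr; apply: (smooth_mx_mul oU); first exact: (smooth_invg oU mg).
exact: (smooth_cky_cov oU mg sY).
Qed.

Lemma lie2_cky_vec v a b : U v -> lie2 (cky_vec g Y) g v a b = 0.
Proof.
move=> Uv; rewrite (lie2_metric oU mg smooth_cky_vec cky_covE a b Uv).
exact: (cky_killing n3 oU mg sY Yskew ckyY einst a b Uv).
Qed.

(** As xi is Killing for [g], the Lie derivative of the conformal metric is 2 xi(u) times that
    metric, and the structure equation becomes an Einstein-type equation with factor [rs_c],
    possibly still depending on the point. *)
Lemma ricci_conf_rs v a b : U v ->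
  ricci (conf g u) v a b = rs_c g u Y lam v * (expR (2 * u v) * g v a b).
Proof.
move=> Uv; have H := congr1 (fun M : 'M[R]_n => M a b) (rs Uv).
have E1 : (ricci (conf g u) v + 2^-1 *: lie2 (cky_vec g Y) (conf g u) v) a b =
   ricci (conf g u) v a b + 2^-1 * lie2 (cky_vec g Y) (conf g u) v a b.
  by apply: (etrans (mx_addE _ _ _ _)); congr (_ + _); rewrite mxE.
have E2 : (lam *: conf g u v) a b = lam * (expR (2 * u v) * g v a b).
  by rewrite mxE; congr (_ * _); rewrite mxE.
have := etrans (esym E1) (etrans H E2).
rewrite (lie2_conf oU mg su) // lie2_cky_vec // add0r /rs_c.
move: (ricci _ _ _ _) (expR _) (vec_app _ _ _) (g v a b) => x1 x2 x3 x4 H2.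
have -> : x1 = (x1 + 2^-1 * (x2 * (2 * x3 * x4))) - x2 * (x3 * x4) by field.
by rewrite H2; ring.
Qed.

(** The condition K = 0 says exactly that the multiples of [g v a b] cancel in the comparison of
    [ricci_conf] with [ricci_conf_rs]; what remains carries the nonzero factor n - 2. *)
Lemma hess_u v a b : U v -> hess g u v a b = pd a u v * pd b u v.
Proof.
move=> Uv; have := ricci_conf_rs a b Uv; rewrite (ricci_conf oU mg su a b Uv) (einst Uv).
have -> : (Lam *: g v) a b = Lam * g v a b by rewrite mxE.
have : Lam = laplacian g u v + (n%:R - 2) * norm2_grad g u v + rs_c g u Y lam v * expR (2 * u v).
  have := K0 Uv; rewrite /rs_K /rs_G => /eqP.
  by rewrite mulf_eq0 invr_eq0 (negbTE n2) orbF subr_eq0 => /eqP.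
move: (laplacian _ _ _) (norm2_grad _ _ _) (rs_c _ _ _ _ _) (expR _) (hess _ _ _ _ _) (pd a u v) (pd b u v)
  (g v a b) => x1 x2 x3 x4 x5 x6 x7 x8 LE H.
apply/eqP; rewrite -subr_eq0; apply/eqP; apply: (mulfI n2); rewrite mulr0.
have -> : (n%:R - 2) * (x5 - x6 * x7) = Lam * x8 - (x1 + (n%:R - 2) * x2) * x8 - (Lam * x8 - (n%:R - 2) * (x5 - x6 * x7) - (x1 + (n%:R - 2) * x2) * x8) by ring.
rewrite H LE; ring.
Qed.

Lemma smooth_phi : smooth_on U phi.
Proof.
apply: (smooth_on_ext oU (f := fun v => expR (- u v))); first by move=> w _; rewrite phiE.
exact/(smooth_expR oU)/(smoothN oU).
Qed.

Lemma pd_phi a v : U v -> pd a phi v = - (phi v * pd a u v).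
Proof.
move=> Uv; have -> : phi = fun w => expR (- u w) by apply/funext => w; rewrite phiE.
have dN : derivable (fun w => - u w) v (delta_mx 0 a).
  exact: (smooth_on_derivable (smoothN oU su) Uv).
have [_ ->] := pd_comp1 dN (is_derive_expR (- u v)).
by rewrite (pdN (smooth_on_derivable su Uv)) mulrN.
Qed.

Lemma hess_phi v : U v -> hess g phi v = 0.
Proof.
move=> Uv; apply/matrixP => a b; rewrite [RHS]mxE.
have HE : hess g u v a b = pd a (pd b u) v - \sum_k christoffel g k a b v * pd k u v.
  by rewrite mxE.
have := hess_u a b Uv; rewrite HE => H.
rewrite mxE.
have -> : pd a (pd b phi) v = - (pd a phi v * pd b u v + phi v * pd a (pd b u) v).
  have E w : U w -> pd b phi w = - (phi w * pd b u w) by exact: pd_phi.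
  have sp := smooth_phi; have sb := smooth_on_pd b su.
  rewrite (pd_ext a oU E Uv) (pdN (smooth_on_derivable (smoothM oU sp sb) Uv)).
  by rewrite (pdM (smooth_on_derivable sp Uv) (smooth_on_derivable sb Uv)).
have -> : \sum_k christoffel g k a b v * pd k phi v =
   - (phi v * \sum_k christoffel g k a b v * pd k u v).
  rewrite mulr_sumr -sumrN; apply: eq_bigr => k _; rewrite pd_phi// mulrN.
  by rewrite mulrCA.
rewrite pd_phi//; move: H.
move: (pd a (pd b u) v) (\sum_k _) (pd a u v) (pd b u v) (phi v) => x1 x2 x3 x4 x5 H.
have -> : - (- (x5 * x3) * x4 + x5 * x1) - - (x5 * x2) = x5 * (x3 * x4 - (x1 - x2)) by ring.
by rewrite H subrr mulr0.
Qed.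

Lemma norm2_grad_phi v : U v -> norm2_grad g phi v = phi v ^+ 2 * norm2_grad g u v.
Proof.
move=> Uv; rewrite /norm2_grad mulr_sumr; apply: eq_bigr => i _.
rewrite mulr_sumr; apply: eq_bigr => j _; rewrite !pd_phi// !mulrN mulNr opprK.
move: (ginv _ _ _ _) (phi v) (pd i u v) (pd j u v) => x1 x2 x3 x4; ring.
Qed.

(** The trace of [hess_u] makes the Laplacian of u equal to its squared gradient norm, so K = 0 and
    [Lam = 0] read (n - 1)|grad u|^2 + c e^{2u} = 0; multiplying by phi^2 gives the formula. *)
Lemma rs_c_phi v : Lam = 0 -> U v ->
  rs_c g u Y lam v = - ((n%:R - 1) * norm2_grad g phi v).
Proof.
move=> L0 Uv; rewrite norm2_grad_phi//.
have lapE : laplacian g u v = norm2_grad g u v.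
  apply: eq_bigr => i _; apply: eq_bigr => j _; rewrite hess_u//.
  by rewrite mulrA.
have := K0 Uv; rewrite /rs_K /rs_G L0 lapE => /eqP.
rewrite mulf_eq0 invr_eq0 (negbTE n2) orbF sub0r oppr_eq0 => /eqP.
have eE : phi v ^+ 2 * expR (2 * u v) = 1.
  rewrite phiE expr2 -!expRD (_ : _ + _ = 0) ?expR0//.
  by move: (u v) => x; ring.
have E0 : expR (2 * u v) != 0 by rewrite gt_eqF// expR_gt0.
move: eE E0; move: (phi v) (expR _) (norm2_grad _ _ _) (rs_c _ _ _ _ _) => x1 x2 x3 x4 eE E0 H.
apply: (mulIf E0).
have -> : - ((n%:R - 1) * (x1 ^+ 2 * x3)) * x2 = - ((n%:R - 1) * x3) * (x1 ^+ 2 * x2) by ring.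
rewrite eE mulr1; apply/eqP; rewrite -subr_eq0; apply/eqP; rewrite -[RHS]H; ring.
Qed.

End SolitonOnChart.

Lemma commutator_kernel (R : pzRingType) n (X Y A B : 'M[R]_n) (p : 'cV[R]_n) :
  X *m p + B *m (A *m p) = Y *m p + A *m (B *m p) ->
  (X - Y - (A *m B - B *m A)) *m p = 0.
Proof.
rewrite !mulmxBl -!mulmxA.
move: (X *m p) (Y *m p) (A *m (B *m p)) (B *m (A *m p)) => x1 x2 x3 x4 H.
have -> : x1 = x2 + (x3 - x4) by rewrite addrA -H addrK.
by rewrite [x2 + _]addrC addrK subrr.
Qed.

(** * Curvature and norm of a parallel gradient *)

Section ParallelGradient.
Variables (R : realType) (n : nat) (U : set 'rV[R]_n) (g : 'rV[R]_n -> 'M[R]_n).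
Variables (f : 'rV[R]_n -> R).
Hypotheses (oU : open U) (mg : metric_on U g) (sf : smooth_on U f).
Hypothesis hf : forall v, U v -> hess g f v = 0.

Let p v : 'cV[R]_n := grad_cov f v.
Let P v : 'rV[R]_n := (grad_cov f v)^T *m invmx (g v).

Let sp : smooth_mx_on U p. Proof. exact: smooth_grad_cov. Qed.
Let sP : smooth_mx_on U P.
Proof. exact: (smooth_mx_mul oU (smooth_mx_tr sp) (smooth_invg oU mg)). Qed.

Lemma mxd_grad i v : U v -> mxd i p v = conn g i v *m p v.
Proof.
move=> Uv; apply/eqP; rewrite -subr_eq0; apply/eqP/colP => k.
by rewrite -(hess_entryE g f i k v) hf// !mxE.
Qed.

Lemma mxd_grad_vec i v : U v -> mxd i P v = - (P v *m conn g i v).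
Proof.
move=> Uv; apply/eqP; rewrite -addr_eq0; apply/eqP.
apply: (etrans (mxd_P oU mg sf i Uv)).
by rewrite (mxd_grad i Uv) subrr trmx0 mul0mx.
Qed.

Lemma curv_grad i j v : U v -> curv g i j v *m p v = 0.
Proof.
move=> Uv.
have E a b : mxd a (mxd b p) v = mxd a (conn g b) v *m p v + conn g b v *m (conn g a v *m p v).
  rewrite (mxd_ext oU a (fun w Uw => mxd_grad b Uw) Uv).
  by rewrite (mxd_mul oU a (smooth_conn oU mg b) sp Uv) mxd_grad.
exact: commutator_kernel (etrans (esym (E i j)) (etrans (mxd_comm oU i j sp Uv) (E j i))).
Qed.

Let grad_vec_metric v : U v -> P v *m g v = (p v)^T.
Proof. by move=> Uv; rewrite /P mulmxKV// (metric_unit mg Uv). Qed.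

(** The skewness of the curvature with respect to the metric transfers [curv_grad] to the other
    side, where the Ricci contraction needs it. *)
Lemma grad_vec_curv i j v : U v -> P v *m curv g i j v = 0.
Proof.
move=> Uv; apply: (can_inj (@trmxK _ _ _)); rewrite trmx0 trmx_mul.
have pE : p v = g v *m (P v)^T.
  by apply: (can_inj (@trmxK _ _ _)); rewrite trmx_mul trmxK (metric_tr mg Uv) grad_vec_metric.
have := congr1 (mulmx^~ (P v)^T) (curv_metric_skew oU mg i j Uv).
rewrite mul0mx mulmxDl -!mulmxA -pE (curv_grad i j Uv) add0r.
move/(congr1 (mulmx (invmx (g v)))); rewrite mulKmx ?(metric_unit mg Uv)// mulmx0.
exact.
Qed.

Lemma ricci_grad j v : U v -> \sum_k ricci g v j k * P v 0 k = 0.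
Proof.
move=> Uv.
transitivity (\sum_i (P v *m curv g i j v) 0 i); last first.
  by apply: big1 => i _; rewrite (grad_vec_curv i j Uv) mxE.
transitivity (\sum_k \sum_i P v 0 k * curv g i j v k i).
  by apply: eq_bigr => k _; rewrite (ricci_curv g v j k) mulrC mulr_sumr.
by rewrite exchange_big; apply: eq_bigr => i _; rewrite mulmxE.
Qed.

Lemma einstein_flat Lam i v : U v -> ricci g v = Lam *: g v -> pd i f v != 0 -> Lam = 0.
Proof.
move=> Uv rE fi; have := ricci_grad i Uv; rewrite rE.
have -> : \sum_k (Lam *: g v) i k * P v 0 k = Lam * pd i f v.
  have := congr1 (fun M : 'rV[R]_n => M 0 i) (grad_vec_metric Uv).
  rewrite trmx_entry [X in _ = X -> _]mxE mulmxE => <-.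
  rewrite mulr_sumr; apply: eq_bigr => k _; rewrite mxE (metric_sym mg i k Uv) -mulrA.
  by rewrite [g v k i * _]mulrC.
by move/eqP; rewrite mulf_eq0 (negbTE fi) orbF => /eqP.
Qed.

Lemma norm2_gradE v : norm2_grad g f v = (P v *m p v) 0 0.
Proof.
rewrite mulmxE /norm2_grad exchange_big; apply: eq_bigr => j _ /=.
rewrite [p v j 0]mxE mulmxE mulr_suml; apply: eq_bigr => i _.
by rewrite trmx_entry [grad_cov f v i 0]mxE [_ * pd i f v]mulrC.
Qed.

Lemma pd_norm2_grad a v : U v -> pd a (norm2_grad g f) v = 0.
Proof.
move=> Uv; have -> : norm2_grad g f = entry (fun w => P w *m p w) 0 0.
  by apply/funext => w; exact: norm2_gradE.
have := congr1 (fun M : 'M[R]_1 => M 0 0) (mxd_mul oU a sP sp Uv).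
rewrite (mxd_grad_vec a Uv) (mxd_grad a Uv) mulNmx mulmxA addNr mxdE => ->.
by rewrite mxE.
Qed.

Lemma nabla_grad_vec i j v : U v -> nabla_vec g P i j v = 0.
Proof.
move=> Uv; have := congr1 (fun M : 'rV[R]_n => M 0 j) (mxd_grad_vec i Uv).
rewrite mxdE /nabla_vec => ->; rewrite mxE mulmxE addrC.
apply/eqP; rewrite subr_eq0; apply/eqP/eq_bigr => k _.
by rewrite conn_entryE mulrC.
Qed.

Lemma smooth_grad_vec : smooth_mx_on U P. Proof. exact: sP. Qed.

End ParallelGradient.

Lemma pow2_small (R : realType) (x B : R) : 0 <= B ->
  (forall m : nat, `|x| <= B / 2 ^+ m) -> x = 0.
Proof.
move=> B0 H; apply/eqP; apply/negPn/negP => x0.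
have nx0 : 0 < `|x| by rewrite normr_gt0.
have [m hm] : exists m : nat, B / `|x| < m%:R.
  by exists (Num.bound (B / `|x|)); apply: archi_boundP; rewrite divr_ge0.
have p0 : 0 < 2 ^+ m :> R by rewrite exprn_gt0.
have := H m; rewrite ler_pdivlMr// => h1.
move: hm; rewrite ltr_pdivrMr// => h2.
have h3 : m%:R <= 2 ^+ m :> R by rewrite -natrX ler_nat ltnW// ltn_expl.
have h4 : m%:R * `|x| <= `|x| * 2 ^+ m by rewrite mulrC ler_wpM2l.
by have := lt_le_trans (lt_le_trans h2 h4) h1; rewrite ltxx.
Qed.

(** * Local uniqueness for parallel sections *)

Section LocalUniqueness.
Variables (R : realType) (n : nat) (U : set 'rV[R]_n).
Hypothesis oU : open U.

Lemma smooth_mx_bounded m k (T : 'rV[R]_n -> 'M[R]_(m, k)) p r :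
  smooth_mx_on U T -> (forall v, `|v - p| <= r -> U v) ->
  exists2 B : R, 0 < B & forall v, `|v - p| <= r -> forall i j, `|T v i j| <= B.
Proof.
move=> sT rU.
(* One smooth function dominating all squared entries, so that a single compactness argument bounds
   them together. *)
pose F v := \sum_i \sum_j entry T i j v * entry T i j v.
have sF : smooth_on U F.
  apply: (smooth_sum oU) => i _; apply: (smooth_sum oU) => j _.
  exact: (smoothM oU (sT i j) (sT i j)).
have [B B0 hB] := @compact_bounded_fun R n F p r
  (fun v hv => smooth_on_continuous sF (rU v hv)).
exists (1 + B); first by rewrite addr_gt0.
move=> v hv i j.
have h1 : T v i j * T v i j <= F v.
  rewrite /F (bigD1 i)//= (bigD1 j)//= -addrA lerDl addr_ge0//.
    by apply: sumr_ge0 => l _; rewrite /entry -expr2 sqr_ge0.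
  by apply: sumr_ge0 => l _; apply: sumr_ge0 => l' _; rewrite /entry -expr2 sqr_ge0.
have h2 := le_trans h1 (le_trans (ler_norm _) (hB v hv)).
move: (T v i j) h2 => x; rewrite -expr2 -(real_normK (num_real x)) => h2.
have := sqr_ge0 (`|x| - 1); move: (`|x|) (normr_ge0 x) h2 => y y0; clear; nra.
Qed.

Lemma pd0_constant f v0 d : smooth_on U f -> cube v0 d `<=` U ->
  (forall v i, U v -> pd i f v = 0) -> forall v, cube v0 d v -> f v = f v0.
Proof.
move=> sf dU f0 v vd.
have := @C1_increment R n f (fun=> 0) v0 (v - v0) 0 (lexx _).
rewrite subrK mulr0 mul0r big1 ?subr0 => [H|i _]; last by rewrite mul0r.
apply/eqP; rewrite -subr_eq0 -normr_le0; apply: H => w wv i.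
have Uw : U w by apply: dU; exact: le_lt_trans wv vd.
by rewrite f0// subrr normr0; split=> //; exact: (smooth_on_derivable sf Uw).
Qed.

(* The linear system dp_i = A_i p contracts the sup norm on small cubes. *)
Lemma parallel_vanish m (p : 'rV[R]_n -> 'cV[R]_m) (A : 'I_n -> 'rV[R]_n -> 'M[R]_m) v0 :
  smooth_mx_on U p -> (forall i, smooth_mx_on U (A i)) ->
  (forall v i, U v -> mxd i p v = A i v *m p v) -> U v0 -> p v0 = 0 ->
  exists2 d : R, 0 < d & cube v0 d `<=` U /\ forall v, cube v0 d v -> p v = 0.
Proof.
move=> sp sA pE Uv0 p0.
have [r' r'0 hr'] := open_cube_subset oU Uv0.
pose r := r' / 2.
have r0 : 0 < r by rewrite divr_gt0.
have rU v : `|v - v0| <= r -> U v.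
  move=> h; apply: hr'; apply: le_lt_trans h _.
  by rewrite /r ltr_pdivrMr// ltr_pMr// ltr1n.
have [B B0 hB] := smooth_mx_bounded sp rU.
have [C C0 hC] : exists2 C : R, 0 < C & forall i v, `|v - v0| <= r -> forall a b, `|A i v a b| <= C.
  have /choice [Cf HC] : forall i, exists C : R, 0 < C /\ forall v, `|v - v0| <= r -> forall a b, `|A i v a b| <= C.
    by move=> i; have [C C0 hC] := smooth_mx_bounded (sA i) rU; exists C.
  exists (1 + \sum_i Cf i).
    by rewrite ltr_pwDl// sumr_ge0// => i _; exact: ltW (HC i).1.
  move=> i v hv a b; apply: (le_trans ((HC i).2 v hv a b)).
  rewrite (bigD1 i)//= addrCA lerDl addr_ge0// sumr_ge0// => l _; exact: ltW (HC l).1.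
pose c := n%:R * (m%:R * C) + 1.
have c0 : 0 < c by rewrite ltr_wpDl// !mulr_ge0// ltW.
pose d := Num.min r (1 / (2 * c)).
have d0 : 0 < d by rewrite lt_min r0 divr_gt0// mulr_gt0.
have dr v : cube v0 d v -> `|v - v0| <= r.
  by move=> h; apply/ltW; apply: lt_le_trans h _; rewrite ge_min lexx.
exists d => //; split; first by move=> v /dr /rU.
have step b : 0 <= b -> (forall v, cube v0 d v -> forall k, `|p v k 0| <= b) ->
    forall v, cube v0 d v -> forall k, `|p v k 0| <= b / 2.
  move=> b0 hb v vd k.
  have := @C1_increment R n (entry p k 0) (fun=> 0) v0 (v - v0) (m%:R * C * b).
  rewrite subrK [X in _ - _ - X]big1 ?subr0 => [H|i _]; last by rewrite mul0r.
  have e0 : entry p k 0 v0 = 0 by rewrite /entry p0 mxE.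
  rewrite e0 subr0 in H.
  have mC : 0 <= m%:R * C * b by rewrite !mulr_ge0// ltW.
  apply: (le_trans (H mC _)).
    move=> w wv i; have wd : cube v0 d w by exact: le_lt_trans wv vd.
    have Uw := rU _ (dr _ wd); split; first exact: (smooth_on_derivable (sp k 0) Uw).
    rewrite subr0 -(mxdE i p w k 0) (pE w i Uw) mulmxE.
    apply: (le_trans (ler_norm_sum _ _ _)).
    apply: (@le_trans _ _ (\sum_(h < m) C * b)); last first.
      by rewrite sumr_const card_ord -[leLHS]mulr_natl mulrA.
    by apply: ler_sum => h _; rewrite normrM ler_pM// ?hC ?hb// dr.
  have hd : `|v - v0| <= 1 / (2 * c).
    by apply/ltW; apply: (lt_le_trans vd); rewrite ge_min lexx orbT.
  apply: (@le_trans _ _ (c * b * (1 / (2 * c)))).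
    apply: ler_pM => //; first by rewrite mulr_ge0.
    by rewrite /c mulrDl mul1r [n%:R * (_ * b)]mulrA lerDl.
  have : c * b * (1 / (2 * c)) = b / 2 by field; rewrite gt_eqF.
  by move=> ->.
have pw k : forall v, cube v0 d v -> forall j, `|p v j 0| <= B / 2 ^+ k.
  elim: k => [|k IH] v vd j; first by rewrite expr0 divr1; exact: hB (dr _ vd) j 0.
  have B2 : 0 <= B / 2 ^+ k by rewrite divr_ge0 ?exprn_ge0// ltW.
  by have := step _ B2 IH v vd j; rewrite exprSr invfM mulrA.
move=> v vd; apply/colP => j; rewrite [RHS]mxE.
by apply: (@pow2_small R _ B (ltW B0)) => k; exact: pw.
Qed.

End LocalUniqueness.

(** * Passing between charts, and propagation over a connected manifold *)

Section OnManifold.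
Variables (R : realType) (n : nat) (M : manifold R n).
Implicit Types x y : chart R n M.

Lemma atlas_smooth x : atlas x -> smooth_chart x.
Proof. by move=> ax y ay; exact: atlas_compatible. Qed.

Lemma open_cfun_preimage x (A : set 'rV[R]_n) : open A -> open (cdom x `&` cfun x @^-1` A).
Proof.
move=> oA; rewrite openE => p [dp Ap].
apply: filterI; first by apply: open_nbhs_nbhs; split=> //; exact: open_cdom.
by apply: (cfun_continuous dp); apply: open_nbhs_nbhs.
Qed.

Lemma open_cinv_preimage x (A : set M) : open A -> open (cimg x `&` cinv x @^-1` A).
Proof.
move=> oA; rewrite openE => v [dv Av].
apply: filterI; first by apply: open_nbhs_nbhs; split=> //; exact: open_cimg.
by apply: (cinv_continuous dv); apply: open_nbhs_nbhs.
Qed.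

Lemma open_overlap x y : open (overlap x y).
Proof. by apply: open_cinv_preimage; exact: open_cdom. Qed.

Lemma transition_cimg x y v : overlap x y v -> cimg y (transition x y v).
Proof. by move=> [_ h]; exact: cfun_cimg. Qed.

Lemma overlap_cfun x y p : cdom x p -> cdom y p -> overlap x y (cfun x p).
Proof. by move=> dx dy; split; [exact: cfun_cimg|rewrite /= cfunK]. Qed.

Lemma transition_cfun x y p : cdom x p -> transition x y (cfun x p) = cfun y p.
Proof. by move=> dx; rewrite /transition /= cfunK. Qed.

Lemma loc_transition (T : Type) (f : M -> T) x y v : overlap x y v ->
  f (cinv x v) = f (cinv y (transition x y v)).
Proof. by move=> [_ h]; rewrite /transition /= cfunK. Qed.

Lemma grad_cov_transition (f : M -> R) x y v : compatible x y ->
  smooth_on (cimg y) (loc f y) -> overlap x y v ->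
  grad_cov (loc f x) v = jac x y v *m grad_cov (loc f y) (transition x y v).
Proof.
move=> [cxy _] sf ov; apply/colP => i; rewrite mxE mulmxE.
have E w : overlap x y w -> loc f x w = (loc f y \o transition x y) w.
  by move=> ow; exact: loc_transition.
rewrite (pd_ext i (@open_overlap x y) E ov).
rewrite (pd_comp_smooth i (@open_cimg _ _ _ y) (@transition_cimg x y)
  (fun j => cxy 0 j) sf ov).
by apply: eq_bigr => j _; rewrite mulrC !mxE.
Qed.

Variable g : comp2 M.
Hypothesis mg : metric g.

(** Invertibility is read off the transformation law of the metric: the nondegenerate [g x v] has
    the Jacobian as a factor. *)
Lemma jac_unit x y v : smooth_chart x -> smooth_chart y -> overlap x y v ->
  jac x y v \in unitmx.
Proof.
move=> sx sy ov; have := metric_unit (mg.2 x sx) ov.1.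
rewrite (mg.1.2 x y sx sy v ov) !unitmx_mul unitmx_tr => /andP[/andP[]].
by [].
Qed.

Lemma norm2_grad_transition (f : M -> R) x y v : smooth_chart x -> smooth_chart y ->
  compatible x y -> smooth_on (cimg y) (loc f y) -> overlap x y v ->
  norm2_grad (g x) (loc f x) v = norm2_grad (g y) (loc f y) (transition x y v).
Proof.
move=> sx sy cxy sf ov; rewrite !norm2_gradE.
rewrite (grad_cov_transition cxy sf ov) (mg.1.2 x y sx sy v ov).
have Ju := jac_unit sx sy ov.
have hu := metric_unit (mg.2 y sy) (transition_cimg ov).
move: Ju hu; move: (jac x y v) (g y _) (grad_cov (loc f y) _) => J h q Ju hu.
have JT : J^T \in unitmx by rewrite unitmx_tr.
congr (_ 0 0).
have -> : (J *m q)^T *m invmx (J *m h *m J^T) = q^T *m invmx h *m invmx J.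
  apply: (canLR (mulmxK _)); first by rewrite !unitmx_mul Ju hu.
  by rewrite !mulmxA mulmxKV// mulmxKV// trmx_mul.
by rewrite !mulmxA mulmxKV.
Qed.

(** Invariance under transitions turns [T] into a subset [Q] of [M]; local constancy makes both [Q]
    and its complement open. It is used for the zeros of dphi and for the level of its norm. *)
Lemma chart_property_global (T : chart R n M -> 'rV[R]_n -> Prop) :
  connected [set: M] ->
  (forall x y v, smooth_chart x -> atlas y -> overlap x y v ->
     T x v <-> T y (transition x y v)) ->
  (forall x v, atlas x -> cimg x v -> exists2 d : R, 0 < d &
     forall w, cimg x w -> cube v d w -> T x w <-> T x v) ->
  forall x0 v0 x v, smooth_chart x0 -> smooth_chart x -> cimg x0 v0 -> cimg x v ->
  T x0 v0 -> T x v.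
Proof.
move=> cM inv loc x0 v0 x v sx0 sx i0 iv T0.
pose Q : set M := [set p | exists2 y, atlas y /\ cdom y p & T y (cfun y p)].
have QP p y : smooth_chart y -> cdom y p -> T y (cfun y p) <-> Q p.
  move=> sy dy; split=> [Ty|[z [az dz] Tz]].
    have [z az dz] := atlas_cover p; exists z => //.
    by have := inv y z _ sy az (overlap_cfun dy dz); rewrite transition_cfun// => -[h _]; exact: h.
  by have := inv y z _ sy az (overlap_cfun dy dz); rewrite transition_cfun// => -[_ h]; exact: h.
have loc_cst p : exists2 A : set M, open A /\ A p & forall q, A q -> Q q <-> Q p.
  have [y ay dy] := atlas_cover p.
  have [d d0 hd] := loc y (cfun y p) ay (cfun_cimg dy).
  exists (cdom y `&` cfun y @^-1` cube (cfun y p) d).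
    by split; [exact: (@open_cfun_preimage y _ (@open_cube R n (cfun y p) d))|split=> //; exact: cube_center].
  move=> q [dq cq]; rewrite -(QP q y (atlas_smooth ay) dq) -(QP p y (atlas_smooth ay) dy).
  by apply: hd => //; exact: cfun_cimg.
have Q0 : Q (cinv x0 v0).
  by apply/(QP _ x0 sx0 (cinv_cdom i0)); rewrite cinvK.
have oQ : open Q.
  rewrite openE => p Qp; have [A [oA Ap] hA] := loc_cst p.
  apply: (filterS (P := A)); first by move=> q /hA ->.
  exact: open_nbhs_nbhs.
have oQc : open (~` Q).
  rewrite openE => p Qp; have [A [oA Ap] hA] := loc_cst p.
  apply: (filterS (P := A)); first by move=> q /hA h /h.
  exact: open_nbhs_nbhs.
have QT : Q = [set: M].
  apply: cM; first by exists (cinv x0 v0).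
  - by exists Q => //; rewrite setTI.
  - by exists Q; [rewrite -openC|rewrite setTI].
have : Q (cinv x v) by rewrite QT.
by move/(QP _ x sx (cinv_cdom iv)); rewrite cinvK.
Qed.

End OnManifold.

(** * Global consequences of a parallel differential *)

Section ParallelFunction.
Variables (R : realType) (n : nat) (M : manifold R n) (g : comp2 M) (phi : M -> R).
Hypotheses (cM : connected [set: M]) (mg : metric g).
Hypothesis sphi : forall x, smooth_chart x -> smooth_on (cimg x) (loc phi x).
Hypothesis hphi : forall x, smooth_chart x -> forall v, cimg x v ->
  hess (g x) (loc phi x) v = 0.
Variables (x0 : chart R n M) (v0 : 'rV[R]_n).
Hypotheses (sx0 : smooth_chart x0) (iv0 : cimg x0 v0).
Hypothesis ne0 : grad_cov (loc phi x0) v0 != 0.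

Lemma grad_cov_neq0 x v : smooth_chart x -> cimg x v -> grad_cov (loc phi x) v != 0.
Proof.
move=> sx iv; apply/negP => /eqP H.
suff : grad_cov (loc phi x0) v0 = 0 by move/eqP; rewrite (negbTE ne0).
(* A single zero would propagate to [v0]: zeros persist nearby by [parallel_vanish], and non-zeros
   persist by continuity. *)
apply: (@chart_property_global R n M (fun x v => grad_cov (loc phi x) v = 0) cM _ _
  x v x0 v0 sx sx0 iv iv0 H) => {x v sx iv H}.
- move=> x y v sx ay ov; have sy := atlas_smooth ay.
  rewrite (grad_cov_transition (sx y ay) (sphi sy) ov); split=> [H|->].
    by rewrite -[LHS](mulKmx (jac_unit mg sx sy ov)) H mulmx0.
  by rewrite mulmx0.
- move=> x v ax iv; have sx := atlas_smooth ax.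
  have oU := @open_cimg _ _ _ x.
  have [H|/eqP H] := eqVneq (grad_cov (loc phi x) v) 0.
    have [d d0 [dU hd]] := parallel_vanish oU (smooth_grad_cov (sphi sx))
      (fun i => smooth_conn oU (mg.2 x sx) i)
      (fun w i Uw => mxd_grad (hphi sx) i Uw) iv H.
    by exists d => // w _ wd; rewrite H (hd w wd).
  have [i Hi] : exists i, pd i (loc phi x) v != 0.
    apply: contrapT => h; apply: H; apply/colP => i; rewrite [LHS]mxE [RHS]mxE.
    by apply/eqP/negPn/negP => hi; apply: h; exists i.
  have ci := smooth_on_continuous (smooth_on_pd i (sphi sx)) iv.
  have := @cvgr_neq0 _ _ _ _ (nbhs_filter v) _ _ ci Hi.
  move=> /nbhs_ballP [d /= d0 hd]; exists d => // w _ wd; split => //.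
  have : pd i (loc phi x) w != 0 by apply: hd; rewrite -cube_ball.
  move=> /negP h e; case: h; apply/eqP.
  have := congr1 (fun B : 'cV[R]_n => B i 0) e; rewrite !mxE; exact.
Qed.

Lemma norm2_grad_constant x v : smooth_chart x -> cimg x v ->
  norm2_grad (g x) (loc phi x) v = norm2_grad (g x0) (loc phi x0) v0.
Proof.
move=> sx iv.
apply: (@chart_property_global R n M (fun x v => norm2_grad (g x) (loc phi x) v =
  norm2_grad (g x0) (loc phi x0) v0) cM _ _ x0 v0 x v sx0 sx iv0 iv erefl) => {x v sx iv}.
- move=> x y v sx ay ov; have sy := atlas_smooth ay.
  by rewrite (norm2_grad_transition mg sx sy (sx y ay) (sphi sy) ov).
- move=> x v ax iv; have sx := atlas_smooth ax.
  have oU := @open_cimg _ _ _ x.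
  have [d d0 dU] := open_cube_subset oU iv; exists d => // w _ wd.
  have sN : smooth_on (cimg x) (norm2_grad (g x) (loc phi x)).
    have -> : norm2_grad (g x) (loc phi x) = entry (fun w => (grad_cov (loc phi x) w)^T
        *m invmx (g x w) *m grad_cov (loc phi x) w) 0 0.
      by apply/funext => z; exact: norm2_gradE.
    apply: (smooth_mx_mul oU); last exact: (smooth_grad_cov (sphi sx)).
    exact: (smooth_grad_vec oU (mg.2 x sx) (sphi sx)).
  rewrite (pd0_constant sN dU _ wd) // => z i Uz.
  exact: (pd_norm2_grad oU (mg.2 x sx) (sphi sx) (hphi sx) i Uz).
Qed.

Lemma grad_parallel_null x : smooth_chart x ->
  (forall v, cimg x v -> norm2_grad (g x) (loc phi x) v = 0) ->
  exists X, parallel_null_on (cimg x) (g x) X.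
Proof.
move=> sx N0; have oU := @open_cimg _ _ _ x; have mx := mg.2 x sx.
pose X v : 'rV[R]_n := (grad_cov (loc phi x) v)^T *m invmx (g x v).
exists X; split; first exact: (smooth_grad_vec oU mx (sphi sx)).
move=> v iv; have Xg : X v *m g x v = (grad_cov (loc phi x) v)^T.
  by rewrite /X mulmxKV// (metric_unit mx iv).
split.
- apply/negP => /eqP X0; move/eqP: (grad_cov_neq0 sx iv); apply.
  by apply: (can_inj (@trmxK _ _ _)); rewrite -Xg X0 mul0mx trmx0.
- rewrite -[RHS](N0 v iv) norm2_gradE -/(X v).
  have -> : grad_cov (loc phi x) v = g x v *m (X v)^T.
    by apply: (can_inj (@trmxK _ _ _)); rewrite trmx_mul trmxK (metric_tr mx iv) Xg.
  rewrite mulmxA; move: (X v) (g x v) => Z G.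
  rewrite mulmxE exchange_big; apply: eq_bigr => j _ /=.
  rewrite mulmxE mulr_suml trmx_entry; apply: eq_bigr => i _.
  by rewrite [Z 0 i * _]mulrC.
- by move=> i j; exact: (nabla_grad_vec oU mx (sphi sx) (hphi sx) i j iv).
Qed.

End ParallelFunction.

(** Index 0 or [n] means that [A] is congruent to the identity up to the sign [e], so its quadratic
    form is a sum of squares up to sign. *)
Lemma definite_no_null (R : realType) n (A : 'M[R]_n) (X : 'rV[R]_n) :
  has_index 0 A \/ has_index n A -> (X *m A *m X^T) 0 0 = 0 -> X = 0.
Proof.
move=> H N; have [e [e0 [P [Pu PA]]]] : exists e : R, e != 0 /\
    exists P : 'M[R]_n, P \in unitmx /\ P *m A *m P^T = e%:M.
  case: H => -[P [Pu PA]].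
    exists 1; split; first exact: oner_neq0.
    exists P; split=> //; rewrite PA; apply/matrixP => i j; rewrite !mxE ltn0.
    by case: eqP.
  exists (-1); split; first by rewrite oppr_eq0 oner_neq0.
  exists P; split=> //; rewrite PA; apply/matrixP => i j; rewrite !mxE ltn_ord.
  by case: eqP.
have [Z XE] : exists Z, X = Z *m P by exists (X *m invmx P); rewrite mulmxKV.
have : (Z *m Z^T) 0 0 = 0.
  have : (Z *m e%:M *m Z^T) 0 0 = 0 by rewrite -PA -[RHS]N XE trmx_mul !mulmxA.
  rewrite mul_mx_scalar -scalemxAl mxE => /eqP.
  by rewrite mulf_eq0 (negbTE e0) => /eqP.
rewrite mulmxE => S0; suff Z0 : Z = 0 by rewrite XE Z0 mul0mx.
apply/rowP => i; rewrite [RHS]mxE.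
have := @psumr_eq0P R _ predT (fun h => Z 0 h * (Z^T) h 0) _ S0 i isT.
rewrite trmx_entry -expr2 => h; apply/eqP; rewrite -sqrf_eq0; apply/eqP/h => j _.
by rewrite trmx_entry -expr2 sqr_ge0.
Qed.

Section AlongCoordinate.
Variables (R : realType) (n : nat) (i0 : 'I_n) (v0 : 'rV[R]_n) (d : R).
Hypothesis d0 : 0 < d.

Lemma upd_center_cube v : cube v0 d v -> cube v0 d (upd i0 v (v0 0 i0)).
Proof. by move=> vd; apply: (upd_cube vd); rewrite subrr normr0. Qed.

Lemma pd0_upd f v : smooth_on (cube v0 d) f ->
  (forall w, cube v0 d w -> pd i0 f w = 0) -> cube v0 d v ->
  f v = f (upd i0 v (v0 0 i0)).
Proof.
move=> sf f0 vd; set w := upd i0 v (v0 0 i0).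
have lineE s : s *: delta_mx 0 i0 + w = upd i0 v (s + v0 0 i0).
  by rewrite (upd_line i0 v (s + v0 0 i0) (v0 0 i0)) addrK.
have inC s : `|s| <= `|v 0 i0 - v0 0 i0| -> cube v0 d (s *: delta_mx 0 i0 + w).
  by move=> hs; rewrite lineE; apply: upd_cube_le => //; rewrite addrK.
have [|s hs] := @MVT_line R _ f w (delta_mx 0 i0) (v 0 i0 - v0 0 i0).
  by move=> s hs; exact: (smooth_on_derivable sf (inC s hs)).
rewrite -[X in X * _]/(pd i0 f _) f0; last exact: inC.
by rewrite lineE subrK upd_self mul0r => /eqP; rewrite subr_eq0 => /eqP.
Qed.

Lemma pd_cst_upd f c v : smooth_on (cube v0 d) f ->
  (forall w, cube v0 d w -> pd i0 f w = c) -> cube v0 d v ->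
  f v = f (upd i0 v (v0 0 i0)) + c * (v 0 i0 - v0 0 i0).
Proof.
move=> sf fc vd; have oC : open (cube v0 d) by exact: open_cube.
have sc := smoothM oC (@smooth_cst R n (cube v0 d) c) (@smooth_coord R n (cube v0 d) i0).
have := @pd0_upd (fun w => f w - c * w 0 i0) v (smoothB oC sf sc) _ vd.
rewrite upd_i0 => H; rewrite mulrBr [c * _ - _]addrC addrA -H ?subrK// => w wd.
rewrite (pdB (smooth_on_derivable sf wd) (smooth_on_derivable sc wd)) fc//.
rewrite pdZ; last exact: (smooth_on_derivable (@smooth_coord R n (cube v0 d) i0) wd).
by rewrite pd_coord eqxx mulr1 subrr.
Qed.

End AlongCoordinate.

(** The shape of the Jacobian of the straightening map at the base point: the vector field in row
    [i0], and sheared basis vectors e_j - c_j X in the others. Row operations undo the shear and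
    leave the identity with row [i0] replaced by [X]. *)
Lemma unitmx_row_perturb (F : fieldType) n (J : 'M[F]_n) (X c : 'I_n -> F) i0 :
  X i0 != 0 -> (forall k, J i0 k = X k) ->
  (forall j k, j != i0 -> J j k = (j == k)%:R - c j * X k) -> J \in unitmx.
Proof.
move=> X0 J0 Jj; rewrite -row_free_unit -kermx_eq0; apply/rowV0P => w /sub_kermxP wJ.
pose s := w 0 i0 - \sum_(j | j != i0) w 0 j * c j.
have E k : (w *m J) 0 k = (if k == i0 then 0 else w 0 k) + s * X k.
  rewrite mulmxE (bigD1 i0)//= J0.
  rewrite (eq_bigr (fun j => w 0 j * (j == k)%:R - w 0 j * c j * X k)) => [|j ji]; last first.
    by rewrite Jj// mulrBr mulrA.
  rewrite sumrB -mulr_suml /s mulrBl addrCA; congr (_ + _).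
  case: eqVneq => [->|ki].
    by apply: big1 => j /negbTE ->; rewrite mulr0.
  rewrite (bigD1 k)//= eqxx mulr1 big1 ?addr0// => j /andP[_ /negbTE ->].
  by rewrite mulr0.
have s0 : s = 0.
  have := E i0; rewrite wJ mxE eqxx add0r => /esym/eqP.
  by rewrite mulf_eq0 (negbTE X0) orbF => /eqP.
have wk k : k != i0 -> w 0 k = 0.
  by move=> ki; have := E k; rewrite wJ mxE (negbTE ki) s0 mul0r addr0.
apply/rowP => k; rewrite [RHS]mxE; have [->|/wk//] := eqVneq k i0.
by move: s0; rewrite /s big1 ?subr0// => j /wk ->; rewrite mul0r.
Qed.

(** * Straightening coordinates and product splitting *)

Section Straighten.
Variables (R : realType) (n : nat) (U : set 'rV[R]_n) (tau : 'rV[R]_n -> R).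
Variables (X : 'rV[R]_n -> 'rV[R]_n) (v0 : 'rV[R]_n).
Hypotheses (oU : open U) (Uv0 : U v0) (st : smooth_on U tau) (sX : smooth_mx_on U X).
Hypothesis Xtau : forall v, U v -> \sum_j X v 0 j * pd j tau v = 1.

(* Psi is the flow of X started on the slice v_{i0} = v0_{i0}, precomposed with
   the shear that subtracts the initial value of tau from the flow time. *)
Theorem straighten_function : exists i0 d (Psi G : 'rV[R]_n -> 'rV[R]_n),
  [/\ 0 < d /\ Psi v0 = v0,
      (forall j, smooth_on (cube v0 d) (entry Psi 0 j)) /\
      (forall v, cube v0 d v -> U (Psi v)),
      open (Psi @` cube v0 d) /\ (forall j, smooth_on (Psi @` cube v0 d) (entry G 0 j)),
      forall v, cube v0 d v -> G (Psi v) = v &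
      forall v, cube v0 d v -> tau (Psi v) = v 0 i0 + (tau v0 - v0 0 i0) /\
        forall j, pd i0 (entry Psi 0 j) v = X (Psi v) 0 j].
Proof.
have [i0 Xi0] : exists i0, X v0 0 i0 != 0.
  apply: contrapT => h; have := Xtau Uv0; rewrite big1 => [/esym/eqP|j _].
    by rewrite oner_eq0.
  have [->|h'] := eqVneq (X v0 0 j) 0; first by rewrite mul0r.
  by exfalso; apply: h; exists j.
pose a := v0 0 i0.
have [dl dl0 [Phi [sP PU dP Pid]]] := @flow_box R n i0 v0 U (fun j => entry X 0 j) oU Uv0 (fun j => sX 0 j).
have [r' r'0 rU] := open_cube_subset oU Uv0.
pose r := Num.min r' dl.
have r0 : 0 < r by rewrite lt_min r'0.
have rU' : cube v0 r `<=` U by move=> v h; apply: rU; apply: lt_le_trans h _; rewrite ge_min lexx.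
have rdl : cube v0 r `<=` cube v0 dl by move=> v h; apply: lt_le_trans h _; rewrite ge_min lexx orbT.
have oC t : open (cube v0 t) by exact: open_cube.
pose u v := upd i0 v a.
have su j : smooth_on (cube v0 r) (entry u 0 j).
  have [ji|ji] := eqVneq j i0.
    apply: (@smooth_on_ext _ _ _ (fun=> a) _ (oC r)); last exact: smooth_cst.
    by move=> w _; rewrite /entry updE ji eqxx.
  apply: (@smooth_on_ext _ _ _ (fun w => w 0 j) _ (oC r)); last exact: smooth_coord.
  by move=> w _; rewrite /entry updE (negbTE ji).
have pdu i j v : pd i (entry u 0 j) v = if j == i0 then 0 else (i == j)%:R.
  have [ji|ji] := eqVneq j i0.
    have -> : entry u 0 j = fun=> a by apply/funext => w; rewrite /entry updE ji eqxx.
    exact: pd_cst.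
  have -> : entry u 0 j = fun w => w 0 j.
    by apply/funext => w; rewrite /entry updE (negbTE ji).
  exact: pd_coord.
pose S v : 'rV[R]_n := upd i0 v (v 0 i0 + (tau v0 - tau (u v))).
have uC v : cube v0 r v -> cube v0 r (u v) by exact: upd_center_cube.
have uU v : cube v0 r v -> U (u v) by move=> /uC /rU'.
have stu : smooth_on (cube v0 r) (tau \o u) by exact: (smooth_comp (oC r) oU uU su st).
have SE0 : entry S 0 i0 = fun v => v 0 i0 + (tau v0 - (tau \o u) v).
  by apply/funext => v; rewrite /entry upd_i0.
have SEj j : j != i0 -> entry S 0 j = fun v => v 0 j.
  by move=> ji; apply/funext => v; rewrite /entry updE (negbTE ji).
have s1 := smoothB (oC r) (@smooth_cst R n (cube v0 r) (tau v0)) stu.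
have s2 := @smooth_coord R n (cube v0 r).
have sS j : smooth_on (cube v0 r) (entry S 0 j).
  have [->|ji] := eqVneq j i0; first by rewrite SE0; exact: (smoothD (oC r) (s2 i0) s1).
  by rewrite SEj//; exact: s2.
pose W := cube v0 r `&` S @^-1` cube v0 dl.
have Wr : W `<=` cube v0 r by move=> v [].
have uS v : u (S v) = u v by exact: upd_upd.
have Sv0 : S v0 = v0.
  have -> : S v0 = upd i0 v0 (v0 0 i0 + (tau v0 - tau v0)).
    by rewrite /S /u upd_self.
  by rewrite subrr addr0 upd_self.
have oW : open W.
  rewrite openE => v [vr Sv]; apply: filterI; first by apply: open_nbhs_nbhs.
  have cS : {for v, continuous S}.
    by apply: continuous_rv => j; exact: (smooth_on_continuous (sS j) vr).
  by apply: cS; apply: open_nbhs_nbhs.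
have Wv0 : W v0 by split; [exact: cube_center|rewrite /preimage/= Sv0; exact: cube_center].
pose Psi v := Phi (S v).
have WS v : W v -> cube v0 dl (S v) by case.
have sSW j : smooth_on W (entry S 0 j) by exact: smooth_on_subset (sS j).
have sPsi j : smooth_on W (entry Psi 0 j).
  exact: (smooth_comp oW (oC dl) WS sSW (sP j)).
have pdPsi i j v : W v -> pd i (entry Psi 0 j) v =
    \sum_l pd l (entry Phi 0 j) (S v) * pd i (entry S 0 l) v.
  by move=> Wv; exact: (pd_comp_smooth i (oC dl) WS sSW (sP j) Wv).
have pdS i v : W v -> pd i (entry S 0 i0) v =
    (i == i0)%:R - (if i == i0 then 0 else pd i tau (u v)).
  move=> Wv; have vr := Wr v Wv.
  rewrite SE0 (pdD (smooth_on_derivable (s2 i0) vr) (smooth_on_derivable s1 vr)) pd_coord.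
  congr (_ + _); rewrite (pdB (smooth_on_derivable (smooth_cst (W := cube v0 r) (tau v0)) vr) (smooth_on_derivable stu vr)) pd_cst add0r.
  congr (- _); rewrite (pd_comp_smooth i oU uU su st vr).
  case: eqVneq => [ii|ii].
    apply: big1 => j _; rewrite pdu; case: eqVneq => [_|ji]; first by rewrite mulr0.
    by rewrite ii eq_sym (negbTE ji) mulr0.
  rewrite (bigD1 i)//= pdu (negbTE ii) eqxx mulr1 big1 ?addr0// => j ji.
  by rewrite pdu [i == j]eq_sym (negbTE ji); case: ifP; rewrite mulr0.
have dPsi j v : W v -> pd i0 (entry Psi 0 j) v = X (Psi v) 0 j.
  move=> Wv; rewrite pdPsi// (bigD1 i0)//= pdS// eqxx subr0 mulr1 big1 ?addr0.
    by rewrite dP//; exact: WS.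
  by move=> l li; rewrite SEj// pd_coord eq_sym (negbTE li) mulr0.
have tauPhi v : cube v0 dl v -> tau (Phi v) = tau (u v) + (v 0 i0 - a).
  move=> vd; have := @pd_cst_upd R n i0 v0 dl dl0 (tau \o Phi) 1 v
    (smooth_comp (oC dl) oU PU sP st) _ vd.
  rewrite mul1r /= [Phi (upd _ _ _)]Pid; [|exact: upd_center_cube|by rewrite upd_i0].
  apply=> w wd; rewrite (pd_comp_smooth i0 oU PU sP st wd).
  rewrite -[RHS](Xtau (PU w wd)); apply: eq_bigr => j _.
  by rewrite mulrC dP.
have tauPsi v : W v -> tau (Psi v) = v 0 i0 + (tau v0 - a).
  move=> Wv; rewrite /Psi tauPhi; last exact: WS.
  rewrite uS /S upd_i0; move: (tau (u v)) (v 0 i0) (tau v0) => x y z; ring.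
have Psi0 : Psi v0 = v0 by rewrite /Psi Sv0 Pid//; exact: cube_center.
have dPhi0 l k : l != i0 -> pd l (entry Phi 0 k) v0 = (l == k)%:R.
  move=> li; have v0d : cube v0 dl v0 by exact: cube_center.
  have v0r : cube v0 r v0 by exact: cube_center.
  have udl v : cube v0 r v -> cube v0 dl (u v) by move=> /uC /rdl.
  have := pd_comp_smooth l (oC dl) udl su (sP k) v0r.
  have uv0 : u v0 = v0 by exact: upd_self.
  have E w : cube v0 r w -> (entry Phi 0 k \o u) w = entry u 0 k w.
    by move=> wr; rewrite /= /entry Pid//; [exact: udl|exact: upd_i0].
  rewrite (pd_ext l (oC r) E v0r) pdu uv0 (bigD1 l)//= pdu (negbTE li) eqxx mulr1 big1.
    rewrite addr0 => <-; case: eqVneq => // ->.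
    by rewrite (negbTE li).
  by move=> m ml; rewrite pdu [l == m]eq_sym (negbTE ml); case: ifP; rewrite mulr0.
have Ju : jacobian_mx Psi v0 \in unitmx.
  apply: (@unitmx_row_perturb R n _ (fun k => X v0 0 k) (fun j => pd j tau v0) i0 Xi0).
    by move=> k; rewrite mxE dPsi// Psi0.
  move=> j k ji; rewrite mxE pdPsi// Sv0 (bigD1 i0)//= pdS// (negbTE ji) sub0r.
  have -> : u v0 = v0 by exact: upd_self.
  have v0d : cube v0 dl v0 by exact: cube_center.
  rewrite (dP v0 k v0d) (Pid v0 v0d erefl) mulrN mulrC addrC; congr (_ - _).
  rewrite (bigD1 j)//= SEj// pd_coord eqxx mulr1 dPhi0// big1 ?addr0// => l /andP[li lj].
  by rewrite SEj// pd_coord eq_sym (negbTE lj) mulr0.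
have [d d0 [dW [G [GP oP sG]]]] := inverse_function oW Wv0 sPsi Ju.
exists i0, d, Psi, G; split=> //.
- split=> [j|v vd]; first exact: smooth_on_subset (sPsi j).
  by apply: PU; apply: WS; exact: dW.
- move=> v vd; split; first by apply: tauPsi; exact: dW.
  by move=> j; apply: dPsi; exact: dW.
Qed.

End Straighten.

(** * New charts from a local diffeomorphism of coordinates *)

Section ReparametrizedChart.
Variables (R : realType) (n : nat) (M : manifold R n) (x : chart R n M).
Variables (C : set 'rV[R]_n) (Psi G : 'rV[R]_n -> 'rV[R]_n).
Hypotheses (ax : atlas x) (oC : open C) (sPsi : forall j, smooth_on C (entry Psi 0 j)).
Hypotheses (PsiU : forall v, C v -> cimg x (Psi v)) (oPsiC : open (Psi @` C)).
Hypotheses (sG : forall j, smooth_on (Psi @` C) (entry G 0 j)).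
Hypothesis (GK : forall v, C v -> G (Psi v) = v).

Let D : set M := cdom x `&` cfun x @^-1` (Psi @` C).
Let F : M -> 'rV[R]_n := G \o cfun x.
Let I : 'rV[R]_n -> M := cinv x \o Psi.

Let oD : open D. Proof. exact: (@open_cfun_preimage R n M x _ oPsiC). Qed.

Let FC p : D p -> C (F p).
Proof. by move=> [_ [v Cv e]]; rewrite /F /= -e GK. Qed.

Let ID v : C v -> D (I v).
Proof.
move=> Cv; split; first exact: cinv_cdom (PsiU Cv).
by exists v => //; rewrite /I /= cinvK//; exact: PsiU.
Qed.

Let FK p : D p -> I (F p) = p.
Proof. by move=> [dp [v Cv e]]; rewrite /I /F /= -e GK// e cfunK. Qed.

Let IK v : C v -> F (I v) = v.
Proof. by move=> Cv; rewrite /I /F /= cinvK ?GK//; exact: PsiU. Qed.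

Let F_continuous p : D p -> {for p, continuous F}.
Proof.
move=> [dp Pp]; apply: continuous_comp; first exact: cfun_continuous.
by apply: continuous_rv => j; exact: (smooth_on_continuous (sG j) Pp).
Qed.

Let I_continuous v : C v -> {for v, continuous I}.
Proof.
move=> Cv; apply: continuous_comp; last exact: cinv_continuous (PsiU Cv).
by apply: continuous_rv => j; exact: (smooth_on_continuous (sPsi j) Cv).
Qed.

Definition reparam_chart : chart R n M :=
  Chart oD oC FC ID FK IK F_continuous I_continuous.

(** The transitions to and from a chart of the atlas factor through those of [x], precomposed with
    [Psi] or followed by [G]; the new chart thus lies in the maximal atlas. *)
Lemma reparam_smooth_chart : smooth_chart reparam_chart.
Proof.
move=> z az; have [sxz szx] := atlas_compatible ax az.
split=> [i j|i j]; rewrite (ord1 i).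
- have oW := @open_overlap _ _ _ reparam_chart z.
  have h v : overlap reparam_chart z v -> overlap x z (Psi v).
    by move=> [Cv dz]; split=> //; exact: PsiU.
  apply: (smooth_comp oW (@open_overlap _ _ _ x z) h _ (sxz 0 j)) => l.
  by apply: smooth_on_subset (sPsi l) => v [].
- have oW := @open_overlap _ _ _ z reparam_chart.
  have h1 v : overlap z reparam_chart v -> overlap z x v by move=> [iv [dx _]].
  have h2 v : overlap z reparam_chart v -> (Psi @` C) (transition z x v) by move=> [_ [_]].
  apply: (smooth_comp oW oPsiC h2 _ (sG j)) => l.
  exact: smooth_on_subset (szx 0 l).
Qed.

Lemma reparam_overlap v : C v -> overlap reparam_chart x v.
Proof. by move=> Cv; split=> //; exact: (ID Cv).1. Qed.

Lemma reparam_transition v : C v -> transition reparam_chart x v = Psi v.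
Proof. by move=> Cv; rewrite /transition /= cinvK//; exact: PsiU. Qed.

Lemma reparam_jac i j v : C v -> jac reparam_chart x v i j = pd i (entry Psi 0 j) v.
Proof.
move=> Cv; rewrite mxE; apply: (pd_ext i oC _ Cv) => w Cw.
by rewrite /entry reparam_transition.
Qed.

End ReparametrizedChart.

(** * Product structure in coordinates with a parallel coordinate differential *)

Section ProductSplitting.
Variables (R : realType) (n : nat) (i0 : 'I_n.+1) (v0 : 'rV[R]_n.+1) (d eps : R).
Variable g : 'rV[R]_n.+1 -> 'M[R]_n.+1.
Let C := cube v0 d.
Hypotheses (d0 : 0 < d) (mg : metric_on C g) .
Hypothesis gi0 : forall v j, C v -> g v i0 j = eps * (j == i0)%:R.
Hypothesis G0 : forall v a b, C v -> christoffel g i0 a b v = 0.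

Let oC : open C. Proof. exact: open_cube. Qed.
Let a := v0 0 i0.

Lemma pd_metric_i0 k j v : C v -> pd k (entry g i0 j) v = 0 /\ pd k (entry g j i0) v = 0.
Proof.
move=> Cv; suff H : pd k (entry g i0 j) v = 0.
  by split=> //; rewrite (pd_metric_sym oC mg k j i0 Cv).
by rewrite (pd_ext k oC (fun w Cw => gi0 j Cw) Cv) pd_cst.
Qed.

(** Compare entry [(b, i0)] of both sides of [conn_lowE]. The left one vanishes by [G0] and the
    block form of the metric; on the right only the derivative along [i0] is left. *)
Lemma pd_i0_metric b c v : C v -> pd i0 (entry g b c) v = 0.
Proof.
move=> Cv; have := congr1 (fun A : 'M[R]_n.+1 => A b i0) (conn_lowE mg c Cv).
rewrite mulmxE (bigD1 i0)//= conn_entryE G0// mul0r add0r big1 => [|k ki]; last first.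
  by rewrite (metric_sym mg k i0 Cv) gi0// (negbTE ki) !mulr0.
rewrite mxE (pd_metric_i0 c b Cv).1 (pd_metric_i0 b c Cv).1 add0r sub0r (pd_metric_sym oC mg i0 b c Cv).
by move/esym/eqP; rewrite mulf_eq0 invr_eq0 pnatr_eq0 orFb oppr_eq0 => /eqP.
Qed.

Lemma christoffel_i0 k b v : C v -> christoffel g k i0 b v = 0 /\ christoffel g k b i0 v = 0.
Proof.
move=> Cv; rewrite /christoffel; split; rewrite big1 ?mulr0// => l _.
  by rewrite pd_i0_metric// (pd_metric_i0 _ _ Cv).1 (pd_metric_i0 _ _ Cv).2 addr0 subr0 mulr0.
by rewrite pd_i0_metric// !(pd_metric_i0 _ _ Cv).2 addr0 subr0 mulr0.
Qed.

Definition insert_coord (w : 'rV[R]_n) : 'rV[R]_n.+1 :=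
  \row_j (if unlift i0 j is Some A then w 0 A else a).

Lemma insert_coord_lift w A : insert_coord w 0 (lift i0 A) = w 0 A.
Proof. by rewrite mxE liftK. Qed.

Lemma insert_coord_i0 w : insert_coord w 0 i0 = a.
Proof. by rewrite mxE unlift_none. Qed.

Lemma insert_coord_col' v : insert_coord (col' i0 v) = upd i0 v a.
Proof.
apply/rowP => j; rewrite updE; case: (unliftP i0 j) => [A ->|->].
  by rewrite insert_coord_lift mxE eq_sym (negbTE (neq_lift i0 A)).
by rewrite insert_coord_i0 eqxx.
Qed.

Let V := cube (col' i0 v0) d.
Let oV : open V. Proof. exact: open_cube. Qed.

Lemma insert_coord_cube w : V w -> C (insert_coord w).
Proof.
move=> Vw; apply/(cubeP _ _ d0) => j; case: (unliftP i0 j) => [A ->|->].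
  by have := (cubeP _ _ d0).1 Vw A; rewrite insert_coord_lift [col' i0 v0 _ _]mxE.
by rewrite insert_coord_i0 subrr normr0.
Qed.

Lemma cube_split : C = [set v : 'rV[R]_n.+1 | a - d < v 0 i0 < a + d /\ V (col' i0 v)].
Proof.
apply/seteqP; split=> v /=.
  move=> Cv; have H := (cubeP _ _ d0).1 Cv; split; first by rewrite -ltr_distl; exact: H.
  by apply/(cubeP _ _ d0) => A; have := H (lift i0 A); rewrite !mxE.
move=> [h Vv]; apply/(cubeP _ _ d0) => j; case: (unliftP i0 j) => [A ->|->].
  by have := (cubeP _ _ d0).1 Vv A; rewrite !mxE.
by rewrite ltr_distl.
Qed.

Lemma entry_insert j : entry insert_coord 0 j =
  if unlift i0 j is Some A then fun w => w 0 A else fun=> a.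
Proof. by apply/funext => w; rewrite /entry mxE; case: unlift. Qed.

Lemma smooth_insert j : smooth_on V (entry insert_coord 0 j).
Proof.
by rewrite entry_insert; case: unlift => [A|]; [exact: smooth_coord|exact: smooth_cst].
Qed.

Lemma pd_insert A f w : smooth_on C f -> V w ->
  pd A (f \o insert_coord) w = pd (lift i0 A) f (insert_coord w).
Proof.
move=> sf Vw; rewrite (pd_comp_smooth A oC insert_coord_cube smooth_insert sf Vw).
rewrite (bigD1 (lift i0 A))//= entry_insert liftK pd_coord eqxx mulr1 big1 ?addr0// => j jA.
rewrite entry_insert; case: (unliftP i0 j) => [B jB|_]; last by rewrite pd_cst mulr0.
rewrite pd_coord; case: eqVneq => [AB|]; last by rewrite mulr0.
by move: jA; rewrite jB AB eqxx.
Qed.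

Definition slice_metric (w : 'rV[R]_n) : 'M[R]_n :=
  \matrix_(A, B) g (insert_coord w) (lift i0 A) (lift i0 B).

Let entry_slice A B : entry slice_metric A B = entry g (lift i0 A) (lift i0 B) \o insert_coord.
Proof. by apply/funext => w; rewrite /entry mxE. Qed.

(** The metric is block diagonal with respect to [i0], so the inverse of the block is the block of
    the inverse. *)
Lemma slice_metric_inv w : V w -> slice_metric w \in unitmx /\
  forall A B, invmx (slice_metric w) A B = invmx (g (insert_coord w)) (lift i0 A) (lift i0 B).
Proof.
move=> Vw; have Cw := insert_coord_cube Vw.
pose H : 'M[R]_n := \matrix_(A, B) invmx (g (insert_coord w)) (lift i0 A) (lift i0 B).
have E : slice_metric w *m H = 1%:M.
  apply/matrixP => A B; rewrite mulmxE.
  have := congr1 (fun Z : 'M[R]_n.+1 => Z (lift i0 A) (lift i0 B)) (mulmxV (metric_unit mg Cw)).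
  rewrite mulmxE (bigD1_ord i0)//= (metric_sym mg _ i0 Cw) gi0// eq_sym (negbTE (neq_lift i0 A)).
  rewrite mulr0 mul0r add0r !mxE (inj_eq lift_inj) => <-.
  by apply: eq_bigr => D _; rewrite !mxE.
have [u _] := mulmx1_unit E; split=> // A B.
have -> : invmx (slice_metric w) = H by rewrite -[LHS]mulmx1 -E mulKmx.
by rewrite mxE.
Qed.

Lemma slice_metric_on : metric_on V slice_metric.
Proof.
split=> [A B|w Vw].
  rewrite entry_slice.
  exact: (smooth_comp oV oC insert_coord_cube smooth_insert (metric_smooth mg _ _)).
split; last exact: (slice_metric_inv Vw).1.
by apply/matrixP => A B; rewrite !mxE (metric_sym mg _ _ (insert_coord_cube Vw)).
Qed.

Lemma pd_slice A B D w : V w ->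
  pd A (entry slice_metric B D) w = pd (lift i0 A) (entry g (lift i0 B) (lift i0 D)) (insert_coord w).
Proof. by move=> Vw; rewrite entry_slice (pd_insert A (metric_smooth mg _ _) Vw). Qed.

Lemma christoffel_slice A B D w : V w -> christoffel slice_metric A B D w =
  christoffel g (lift i0 A) (lift i0 B) (lift i0 D) (insert_coord w).
Proof.
move=> Vw; have Cw := insert_coord_cube Vw; rewrite /christoffel; congr (_ * _).
rewrite [RHS](bigD1_ord i0)//= pd_i0_metric//.
rewrite !(pd_metric_i0 _ _ Cw).1 addr0 subr0 mulr0 add0r.
apply: eq_bigr => L _; rewrite !pd_slice// /ginv.
by congr (_ * _); exact: (slice_metric_inv Vw).2.
Qed.

Lemma ricci_slice A B w : V w ->
  ricci slice_metric w A B = ricci g (insert_coord w) (lift i0 A) (lift i0 B).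
Proof.
move=> Vw; have Cw := insert_coord_cube Vw.
have sGm i j k : smooth_on C (christoffel g i j k).
  have -> : christoffel g i j k = entry (conn g j) k i.
    by apply/funext => v; rewrite /entry conn_entryE.
  exact: (smooth_conn oC mg).
have dG D A' B' D' : pd D (christoffel slice_metric A' B' D') w =
    pd (lift i0 D) (christoffel g (lift i0 A') (lift i0 B') (lift i0 D')) (insert_coord w).
  rewrite -(pd_insert D (sGm _ _ _) Vw); apply: (pd_ext D oV _ Vw) => w' Vw'.
  exact: christoffel_slice.
have d00 k j l : pd k (christoffel g i0 j l) (insert_coord w) = 0.
  by rewrite (pd_ext k oC (fun v Cv => G0 j l Cv) Cw) pd_cst.
rewrite mxE [RHS]mxE; congr (_ + _).
  rewrite [RHS](bigD1_ord i0)//= !d00 subrr add0r; apply: eq_bigr => D _.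
  by rewrite !dG.
rewrite [RHS](bigD1_ord i0)//= [X in _ = X + _]big1 ?add0r => [|l _]; last by rewrite !G0// !mul0r subrr.
apply: eq_bigr => D _; rewrite [RHS](bigD1_ord i0)//= !G0// (christoffel_i0 _ _ Cw).2.
rewrite mul0r mulr0 subrr add0r; apply: eq_bigr => L _.
by rewrite !christoffel_slice.
Qed.

Lemma metric_upd v b c : C v -> g v b c = g (upd i0 v a) b c.
Proof. by move=> Cv; exact: (pd0_upd d0 (metric_smooth mg b c) (pd_i0_metric b c) Cv). Qed.

Lemma product_on_cube : product_on C g i0 eps V slice_metric.
Proof.
split=> //; first by exists (a - d), (a + d); exact: cube_split.
move=> v Cv; split=> [|A|A B].
- by rewrite gi0// eqxx mulr1.
- rewrite (metric_sym mg (lift i0 A) i0 Cv) gi0//.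
  by rewrite eq_sym (negbTE (neq_lift i0 A)) mulr0.
- by rewrite metric_upd// -insert_coord_col' mxE.
Qed.

End ProductSplitting.

(** * The splitting chart in the non-null case *)

Section SplitChart.
Variables (R : realType) (n : nat) (M : manifold R n.+1) (g : comp2 M) (phi : M -> R).
Variables (eps c2 : R).
Hypothesis mg : metric g.
Hypothesis sphi : forall x, smooth_chart x -> smooth_on (cimg x) (loc phi x).
Hypothesis hphi : forall x, smooth_chart x -> forall v, cimg x v ->
  hess (g x) (loc phi x) v = 0.
Hypothesis ricci0 : forall x, smooth_chart x -> forall v, cimg x v -> ricci (g x) v = 0.
Hypotheses (eps2 : eps * eps = 1) (c2_gt0 : 0 < c2).
Hypothesis norm_phi : forall x, smooth_chart x -> forall v, cimg x v ->
  norm2_grad (g x) (loc phi x) v = eps * c2 ^+ 2.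

Theorem split_chart (p : M) : exists (x : chart R n.+1 M) (i0 : 'I_n.+1)
    (V : set 'rV[R]_n) (h : 'rV[R]_n -> 'M[R]_n),
  let tau := fun v : 'rV[R]_n.+1 => v 0 i0 in
  [/\ smooth_chart x /\ cdom x p,
      (forall v, cimg x v ->
         [/\ hess (g x) tau v = 0,
             norm2_grad (g x) tau v = eps &
             forall i, pd i (loc phi x) v = c2 * pd i tau v]),
      product_on (cimg x) (g x) i0 eps V h,
      metric_on V h &
      forall w, V w -> ricci h w = 0].
Proof.
have c20 : c2 != 0 by rewrite gt_eqF.
have e0 : eps != 0.
  by apply/eqP => e; move/eqP: eps2; rewrite e mul0r eq_sym oner_eq0.
have [x ax dx] := atlas_cover p; have sx := atlas_smooth ax.
set U := cimg x; have oU : open U := @open_cimg _ _ _ x.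
have mx : metric_on U (g x) := mg.2 x sx.
pose f := loc phi x; have sf : smooth_on U f := sphi sx.
pose P v : 'rV[R]_n.+1 := (grad_cov f v)^T *m invmx (g x v).
have sP : smooth_mx_on U P := smooth_grad_vec oU mx sf.
(* The factor makes the derivative of [t] along [X] equal to 1: the gradient applied to phi gives
   [eps * c2 ^+ 2], and [eps * eps = 1]. *)
pose X v := (eps * c2^-1) *: P v.
have sX : smooth_mx_on U X := smooth_mx_scale oU (@smooth_cst R _ U (eps * c2^-1)) sP.
pose t v := c2^-1 * f v.
have st : smooth_on U t := smoothM oU (@smooth_cst R _ U c2^-1) sf.
have pdt j v : U v -> pd j t v = c2^-1 * pd j f v.
  by move=> Uv; exact: (pdZ (smooth_on_derivable sf Uv)).
have Xt v : U v -> \sum_j X v 0 j * pd j t v = 1.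
  move=> Uv; transitivity (eps * c2^-1 * c2^-1 * (P v *m grad_cov f v) 0 0).
    rewrite mulmxE mulr_sumr; apply: eq_bigr => j _.
    rewrite pdt// [X v 0 j]mxE [grad_cov f v j 0]mxE.
    move: (P v 0 j) (pd j f v) => y z; ring.
  rewrite /P -norm2_gradE norm_phi//.
  rewrite -[RHS]eps2; by field.
have Uv0 : U (cfun x p) by exact: cfun_cimg.
have [i0 [d [Psi [G [[d0 Psi0] [sPsi PsiU] [oP sG] GK tP]]]]] := straighten_function oU Uv0 st sX Xt.
set v0 := cfun x p in d0 Psi0 sPsi PsiU oP sG GK tP.
set C := cube v0 d in d0 Psi0 sPsi PsiU oP sG GK tP.
have oC : open C by exact: open_cube.
pose y := reparam_chart oC sPsi PsiU oP sG GK.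
have sy : smooth_chart y := reparam_smooth_chart ax oC sPsi PsiU oP sG GK.
have my : metric_on C (g y) := mg.2 y sy.
have phiE v : C v -> loc phi y v = c2 * (v 0 i0 + (t v0 - v0 0 i0)).
  by move=> Cv; rewrite -(tP v Cv).1 /t mulVKf.
pose tau (v : 'rV[R]_n.+1) := v 0 i0.
have pdtau i v : pd i tau v = (i == i0)%:R by exact: pd_coord.
have pdphi i v : C v -> pd i (loc phi y) v = c2 * (i == i0)%:R.
  move=> Cv; rewrite (pd_ext i oC phiE Cv).
  have dt : derivable tau v (delta_mx 0 i) := smooth_on_derivable (@smooth_coord R _ C i0) Cv.
  have dc : derivable (fun=> t v0 - v0 0 i0 : R) v (delta_mx 0 i).
    exact: (smooth_on_derivable (@smooth_cst R _ C _) Cv).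
  rewrite (pdZ (f := fun w => tau w + (t v0 - v0 0 i0))); last exact: derivableD.
  by rewrite (pdD dt dc) pd_cst addr0 pdtau.
(* In the new chart phi is affine in the coordinate [i0] alone, so its Hessian consists only of the
   Christoffel term with upper index [i0], times [- c2]. *)
have G0 v a b : C v -> christoffel (g y) i0 a b v = 0.
  move=> Cv; have := congr1 (fun A : 'M[R]_n.+1 => A a b) (hphi sy (v := v) Cv).
  rewrite mxE [RHS]mxE (pd_ext a oC (fun w Cw => pdphi b w Cw) Cv) pd_cst sub0r.
  rewrite (bigD1 i0)//= pdphi// eqxx mulr1 big1 ?addr0 => [|k ki]; last first.
    by rewrite pdphi// (negbTE ki) !mulr0.
  by move/eqP; rewrite oppr_eq0 mulf_eq0 (negbTE c20) orbF => /eqP.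
(* The coordinate field of [i0] is [X], whose metric dual is [eps * c2^-1] times dphi, that is, eps
   dtau. *)
have gi0 v j : C v -> g y v i0 j = eps * (j == i0)%:R.
  move=> Cv; have ov := reparam_overlap oC sPsi PsiU oP sG GK Cv.
  have cyx : compatible y x := sy x ax.
  rewrite (mg.1.2 y x sy sx v ov) /y reparam_transition// -/y.
  have UP := PsiU v Cv.
  have rJ : row i0 (jac y x v) = X (Psi v).
    by apply/rowP => k; rewrite mxE reparam_jac//; exact: (tP v Cv).2.
  have rg : row i0 (jac y x v *m g x (Psi v)) = (eps * c2^-1) *: (grad_cov f (Psi v))^T.
    by rewrite row_mul rJ /X -scalemxAl /P mulmxKV// (metric_unit mx UP).
  have gE := grad_cov_transition cyx sf ov.
  rewrite /y reparam_transition// -/y in gE.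
  transitivity ((row i0 (jac y x v *m g x (Psi v)) *m (jac y x v)^T) 0 j).
    by rewrite -row_mul [RHS]mxE.
  rewrite rg -scalemxAl -trmx_mul -gE mxE trmx_entry [grad_cov _ _ _ _]mxE pdphi//.
  by rewrite !mulrA mulfVK.
exists y, i0, (cube (col' i0 v0) d), (slice_metric i0 v0 (g y)).
move=> tau'; split.
- split=> //; split=> //; exists v0; [exact: cube_center|exact: Psi0].
- move=> v Cv; split=> [||i].
  + apply/matrixP => a b; rewrite mxE [RHS]mxE.
    have -> : pd b tau' = fun=> (b == i0)%:R by apply/funext => w; exact: pdtau.
    rewrite pd_cst (bigD1 i0)//= G0// mul0r big1 ?addr0 ?subr0// => k ki.
    by rewrite [pd k _ v]pdtau (negbTE ki) mulr0.
  + have c22 : c2 ^+ 2 != 0 by rewrite expf_neq0.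
    apply: (mulIf c22); rewrite -(norm_phi sy Cv) /norm2_grad mulr_suml.
    apply: eq_bigr => a _; rewrite mulr_suml; apply: eq_bigr => b _.
    rewrite !pdphi// [pd a _ v]pdtau [pd b _ v]pdtau.
    move: (ginv _ _ _ _) (_ == i0) (_ == i0) => z1 z2 z3; ring.
  + by rewrite pdphi// [pd i tau' v]pdtau.
- exact: (product_on_cube d0 my gi0 G0).
- exact: (slice_metric_on d0 my gi0).
- move=> w Vw; apply/matrixP => A B; rewrite (ricci_slice d0 my gi0 G0 A B Vw).
  by rewrite ricci0 ?mxE//; exact: (insert_coord_cube d0 Vw).
Qed.

End SplitChart.

Unset Implicit Arguments.
Set Strict Implicit.

Theorem mainTheorem12 (R : realType) (n : nat) (hn : (3 <= n)%N)
  (M : manifold R n) (hM : connected [set: M])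
  (g Y : comp2 M) (u : M -> R) (lam Lam : R)
  (hS : einstein_cky_rs g u Y lam Lam)
  (phi : M -> R) (hphi : forall p, phi p = expR (- u p))
  (hdphi : exists x, smooth_chart x /\
     exists v i, cimg x v /\ pd i (loc phi x) v <> 0)
  (hK : forall x, smooth_chart x -> forall v, cimg x v ->
     rs_K (g x) (loc u x) (Y x) lam Lam v = 0) :
  (* d phi is a non-zero parallel one-form *)
  (forall x, smooth_chart x -> forall v, cimg x v ->
     (exists i, pd i (loc phi x) v <> 0) /\ hess (g x) (loc phi x) v = 0)
  /\
  (* d phi non-null *)
  ((forall x, smooth_chart x -> forall v, cimg x v ->
      norm2_grad (g x) (loc phi x) v <> 0) ->
   exists eps c2 : R,
     [/\ (eps = 1 \/ eps = -1),
         0 < c2,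
         (forall x, smooth_chart x -> forall v, cimg x v ->
            norm2_grad (g x) (loc phi x) v = eps * c2 ^+ 2),
         (forall x, smooth_chart x -> forall v, cimg x v ->
            rs_c (g x) (loc u x) (Y x) lam v
            = - (eps * (n%:R - 1) * c2 ^+ 2)) &
         forall p : M, exists (x : chart R n M) (i0 : 'I_n)
             (V : set 'rV[R]_n.-1) (h : 'rV[R]_n.-1 -> 'M[R]_n.-1),
           let tau := fun v : 'rV[R]_n => v 0 i0 in
           [/\ smooth_chart x /\ cdom x p,
               (forall v, cimg x v ->
                  [/\ hess (g x) tau v = 0,
                      norm2_grad (g x) tau v = eps &
                      forall i, pd i (loc phi x) v = c2 * pd i tau v]),
               product_on (cimg x) (g x) i0 eps V h,
               metric_on V h &
               forall w, V w -> ricci h w = 0]])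
  /\
  (* d phi null *)
  ((forall x, smooth_chart x -> forall v, cimg x v ->
      norm2_grad (g x) (loc phi x) v = 0) ->
   (forall p : M, exists x : chart R n M,
      [/\ smooth_chart x, cdom x p &
          exists X, parallel_null_on (cimg x) (g x) X])
   /\
   (definite g \/ lorentzian g ->
    lorentzian g /\
    forall p : M, exists x : chart R n M,
      [/\ smooth_chart x, cdom x p & brinkmann_on (cimg x) (g x)])).
Proof.
have [[mg su [tY ckyY] rs] ein] := hS.
(* With the dimension a successor, [n.-1] in the statement computes to [m], the dimension of the
   slice in [split_chart]. *)
destruct n as [|m]; first by [].
have phiE x v : loc phi x v = expR (- loc u x v) by exact: hphi.
have sphi x : smooth_chart x -> smooth_on (cimg x) (loc phi x).
  by move=> sx; exact: (smooth_phi (@open_cimg _ _ _ x) (su x sx) (phiE x)).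
have hp x : smooth_chart x -> forall v, cimg x v -> hess (g x) (loc phi x) v = 0.
  move=> sx v iv.
  exact: (hess_phi hn (@open_cimg _ _ _ x) (mg.2 x sx) (su x sx) (tY.1.1 x sx) (tY.2 x sx)
    (ckyY x sx) (rs x sx) (ein x sx) (hK x sx) (phiE x) iv).
have [x0 [sx0 [v0 [i [iv0 hi]]]]] := hdphi.
have ne0 : grad_cov (loc phi x0) v0 != 0.
  apply/eqP => e; apply: hi; have := congr1 (fun B : 'cV[R]_m.+1 => B i 0) e.
  by rewrite !mxE.
have gne x v : smooth_chart x -> cimg x v -> exists i, pd i (loc phi x) v <> 0.
  move=> sx iv; have := grad_cov_neq0 hM mg sphi hp sx0 iv0 ne0 sx iv.
  move=> /eqP H; apply: contrapT => h; apply: H; apply/colP => j; rewrite [LHS]mxE [RHS]mxE.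
  by apply: contrapT => hj; apply: h; exists j.
have L0 : Lam = 0.
  apply: (einstein_flat (@open_cimg _ _ _ x0) (mg.2 x0 sx0) (sphi x0 sx0) (hp x0 sx0)
    iv0 (ein x0 sx0 v0 iv0)); exact/eqP/hi.
have rsc x : smooth_chart x -> forall v, cimg x v ->
    rs_c (g x) (loc u x) (Y x) lam v = - ((m.+1%:R - 1) * norm2_grad (g x) (loc phi x) v).
  move=> sx v iv.
  exact: (rs_c_phi hn (@open_cimg _ _ _ x) (mg.2 x sx) (su x sx) (tY.1.1 x sx) (tY.2 x sx)
    (ckyY x sx) (rs x sx) (ein x sx) (hK x sx) (phiE x) L0 iv).
split; last split.
- by move=> x sx v iv; split; [exact: gne|exact: hp].
- move=> nn; set N := norm2_grad (g x0) (loc phi x0) v0.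
  have NE x v : smooth_chart x -> cimg x v -> norm2_grad (g x) (loc phi x) v = N.
    by move=> sx iv; exact: (norm2_grad_constant hM mg sphi hp sx0 iv0 sx iv).
  have N0 : N != 0 by apply/eqP; exact: nn.
  (* [eps] is the sign of the constant norm [N], and c2 is the square root of its absolute value. *)
  have [eps [epsE eps2 NN]] : exists eps : R,
      [/\ eps = 1 \/ eps = -1, eps * eps = 1 & N = eps * Num.sqrt `|N| ^+ 2].
    rewrite sqr_sqrtr//; have [h|h] := leP 0 N.
      by exists 1; split; [left|rewrite mul1r|rewrite mul1r ger0_norm].
    by exists (-1); split; [right|rewrite mulN1r opprK|rewrite mulN1r ltr0_norm// opprK].
  have c0 : 0 < Num.sqrt `|N| by rewrite sqrtr_gt0 normr_gt0.
  have Ne x : smooth_chart x -> forall v, cimg x v ->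
      norm2_grad (g x) (loc phi x) v = eps * Num.sqrt `|N| ^+ 2.
    by move=> sx v iv; rewrite NE.
  exists eps, (Num.sqrt `|N|); split=> //.
    by move=> x sx v iv; rewrite rsc// Ne// mulrA [_ * eps]mulrC.
  move=> p; apply: (split_chart mg sphi hp _ eps2 c0 Ne).
  by move=> x sx v iv; rewrite ein// L0 scale0r.
- move=> nn.
  have PN x : smooth_chart x -> exists X, parallel_null_on (cimg x) (g x) X.
    by move=> sx; exact: (grad_parallel_null hM mg sphi hp sx0 iv0 ne0 sx (nn x sx)).
  have PNp (p : M) : exists x : chart R m.+1 M, [/\ smooth_chart x, cdom x p &
      exists X, parallel_null_on (cimg x) (g x) X].
    have [x ax dx] := atlas_cover p; exists x.
    by split=> //; [exact: atlas_smooth|apply: PN; exact: atlas_smooth].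
  split=> // dl.
  have lor : lorentzian g.
    case: dl => // df; exfalso.
    have [X [_ /(_ v0 iv0) [X0 XN _]]] := PN x0 sx0.
    move/eqP: X0; apply; apply: (@definite_no_null R m.+1 (g x0 v0)).
      by case: df => /(_ x0 sx0 v0 iv0) h; [left|right].
    rewrite mulmxE -[RHS]XN exchange_big; apply: eq_bigr => j _ /=.
    rewrite mulmxE mulr_suml trmx_entry; apply: eq_bigr => k _.
    by rewrite [g x0 v0 k j * _]mulrC.
  split=> // p; have [x [sx dx PX]] := PNp p; exists x; split=> //; split=> //.
  by case: lor => h; [left|right]; exact: h.
Qed.
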